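(* For integers $n,k,r$, the number of contracted plabic trees of type $(k,n)$ with momentum amplituhedron dimension $r$ equals $[x^ny^kq^r]\mathcal P_{\mathrm{tree}}(x,y,q)$, where $$\mathcal P_{\mathrm{tree}}(x,y,q)=x\left(1+y+yq\,C^{\langle-1\rangle}(x,y,q)\right),\qquad C(x,y,q)=\frac{x(1-q^2x^2y)}{(1+xq)(1+xyq)},$$ with compositional inverse taken with respect to $x$. The number of contracted plabic forests of type $(k,n)$ with momentum amplituhedron dimension $r$ equals $[x^ny^kq^r]\mathcal P_{\mathrm{forest}}(x,y,q)$, where $$x\,\mathcal P_{\mathrm{forest}}(x,y,q)=\left(\frac{x}{1+\mathcal P_{\mathrm{tree}}(x,y,q)}\right)^{\langle-1\rangle}$$ (compositional inverse in $x$); equivalently, $[x^n]\mathcal P_{\mathrm{forest}}(x,y,q)=\frac{1}{n+1}[x^n]\left(1+\mathcal P_{\mathrm{tree}}(x,y,q)\right)^{n+1}$.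
   Context: A Grassmannian graph is a finite planar graph embedded in a closed disk with $n$ boundary vertices $b_1,\dots,b_n$ of degree $1$ on the boundary circle, labelled clockwise; all other vertices (internal vertices) lie in the interior, each is connected by a path to the boundary, and no vertex has degree $2$. Each internal vertex $v$ carries an integer helicity $h(v)$: if $v$ is a boundary leaf (an internal vertex of degree $1$ adjacent to a boundary vertex) then $h(v)\in\{0,1\}$; otherwise $1\le h(v)\le\deg(v)-1$. An internal vertex is white if $h(v)=1$, black if $h(v)=\deg(v)-1$, generic otherwise. The helicity of the graph $G$ is $h(G)=\sum_{v\text{ internal}}\left(h(v)-\frac{\deg v}{2}\right)+\frac n2$, and $G$ has type $(k,n)$ if $h(G)=k$. A plabic graph is a Grassmannian graph with no generic vertices. A plabic forest (tree) is an acyclic (connected acyclic) plabic graph; it is contracted if no two adjacent internal vertices are both white and no two adjacent internal vertices are both black. Graphs are counted up to isotopy of the disk fixing the labelled boundary vertices (the empty forest with $n=0$ is allowed). Momentum amplituhedron dimension: for an internal vertex $v$ let $m(v)=2\deg(v)-4$ if $v$ is generic and $m(v)=\deg(v)-1$ otherwise; for a tree $T$ with $n$ boundary vertices, $\dim_{\mathcal M}(T)=n-1$ if $n\le2$ and $1+\sum_{v\text{ internal}}(m(v)-1)$ otherwise; for a forest, $\dim_{\mathcal M}$ is the sum over its connected components (each a tree on its own boundary vertices). Compositional inverse $f^{\langle -1\rangle}$ of a series $f\in x\,\mathbb Q(y,q)[[x]]$ with nonzero coefficient of $x$ is the series with $f(f^{\langle-1\rangle}(x))=f^{\langle-1\rangle}(f(x))=x$;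 $[x^ny^kq^r]$ denotes coefficient extraction. *)

(* Defs.v *)
From HB Require Import structures.
From Stdlib Require Import ClassicalEpsilon FunctionalExtensionality.
From mathcomp Require Import all_boot all_order all_algebra all_fingroup.
From mathcomp Require Import boolp.

Set Implicit Arguments.
Unset Strict Implicit.
Unset Printing Implicit Defensive.

Import Order.TTheory GRing.Theory Num.Theory.
Local Open Scope ring_scope.

Record fps (K : fieldType) := Fps { fps_coef :> nat -> K }.

Section FormalPowerSeries.
Variable K : fieldType.
Implicit Types (f g h : fps K) (c : K) (p r : {poly K}).

HB.instance Definition _ := gen_eqMixin (fps K).
HB.instance Definition _ := gen_choiceMixin (fps K).

Lemma fpsP f g : f =1 g -> f = g.
Proof. by case: f g => [f] [g] /= E; congr Fps; apply: functional_extensionality. Qed.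

Definition fps_const c : fps K := Fps (fun n => if n == 0%N then c else 0).
Definition fps_X : fps K := Fps (fun n => (n == 1%N)%:R).
Definition fps_add f g : fps K := Fps (fun n => f n + g n).
Definition fps_opp f : fps K := Fps (fun n => - f n).
Definition fps_mul f g : fps K :=
  Fps (fun n => \sum_(i < n.+1) f i * g (n - i)%N).

Fact fps_addA : associative fps_add.
Proof. by move=> f g h; apply: fpsP => n /=; rewrite addrA. Qed.
Fact fps_addC : commutative fps_add.
Proof. by move=> f g; apply: fpsP => n /=; rewrite addrC. Qed.
Fact fps_add0 : left_id (fps_const 0) fps_add.
Proof. by move=> f; apply: fpsP => n /=; case: eqP; rewrite add0r. Qed.
Fact fps_addN : left_inverse (fps_const 0) fps_opp fps_add.
Proof. by move=> f; apply: fpsP => n /=; case: eqP; rewrite addNr. Qed.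

HB.instance Definition _ :=
  GRing.isZmodule.Build (fps K) fps_addA fps_addC fps_add0 fps_addN.

Definition fps_trunc N f : {poly K} := \poly_(i < N) f i.

Lemma coef_fps_trunc N f i : (i < N)%N -> (fps_trunc N f)`_i = f i.
Proof. by move=> ltiN; rewrite coef_poly ltiN. Qed.

Fact coef_fps_mul N f g n : (n < N)%N ->
  fps_mul f g n = (fps_trunc N f * fps_trunc N g)`_n.
Proof.
move=> ltnN; rewrite coefM; apply: eq_bigr => i _.
have lein : (i <= n)%N by rewrite -ltnS.
by rewrite !coef_fps_trunc ?(leq_ltn_trans _ ltnN) // leq_subr.
Qed.

Fact fps_mulA : associative fps_mul.
Proof.
move=> f g h; apply: fpsP => n.
transitivity ((fps_trunc n.+1 f * (fps_trunc n.+1 g * fps_trunc n.+1 h))`_n).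
  rewrite coefM; apply: eq_bigr => i _.
  by rewrite coef_fps_trunc // (@coef_fps_mul n.+1) // ltnS leq_subr.
rewrite mulrA coefM; apply: eq_bigr => i _.
by rewrite coef_fps_trunc ?ltnS ?leq_subr // (@coef_fps_mul n.+1).
Qed.

Fact fps_mulC : commutative fps_mul.
Proof.
by move=> f g; apply: fpsP => n; rewrite !(@coef_fps_mul n.+1) // mulrC.
Qed.

Fact fps_mul1 : left_id (fps_const 1) fps_mul.
Proof.
move=> f; apply: fpsP => n /=.
by rewrite big_ord_recl big1 /= ?mul1r ?addr0 ?subn0 // => i _; rewrite mul0r.
Qed.

Fact fps_mulDl : left_distributive fps_mul fps_add.
Proof.
move=> f g h; apply: fpsP => n /=.
by rewrite -big_split /=; apply: eq_bigr => i _; rewrite mulrDl.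
Qed.

Fact fps_1neq0 : fps_const 1 != 0.
Proof.
apply/eqP => E; have /eqP := congr1 (fun f : fps K => f 0%N) E.
by rewrite /= oner_eq0.
Qed.

HB.instance Definition _ := GRing.Zmodule_isComNzRing.Build (fps K)
  fps_mulA fps_mulC fps_mul1 fps_mulDl fps_1neq0.

Lemma fps_coef0 n : (0 : fps K) n = 0. Proof. by rewrite /=; case: eqP. Qed.
Lemma fps_coef1 n : (1 : fps K) n = (n == 0%N)%:R.
Proof. by rewrite /=; case: eqP. Qed.
Lemma fps_coefD f g n : (f + g) n = f n + g n. Proof. by []. Qed.
Lemma fps_coefN f n : (- f) n = - f n. Proof. by []. Qed.
Lemma fps_coefB f g n : (f - g) n = f n - g n. Proof. by []. Qed.
Lemma fps_coefM f g n : (f * g) n = \sum_(i < n.+1) f i * g (n - i)%N.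
Proof. by []. Qed.
Lemma fps_coefM0 f g : (f * g) 0%N = f 0%N * g 0%N.
Proof. by rewrite fps_coefM big_ord1. Qed.
Lemma fps_coef_sum I (s : seq I) (P : pred I) (F : I -> fps K) n :
  (\sum_(i <- s | P i) F i) n = \sum_(i <- s | P i) F i n.
Proof.
by elim/big_rec2: _ => [|i f g _ <-]; rewrite ?fps_coef0.
Qed.
Lemma fps_coefCM c f n : (fps_const c * f) n = c * f n.
Proof.
rewrite fps_coefM big_ord_recl big1 /= ?addr0 ?subn0 // => i _.
by rewrite mul0r.
Qed.
Lemma fps_coefXM f n : (fps_X * f) n = if n is m.+1 then f m else 0.
Proof.
case: n => [|n]; rewrite fps_coefM; first by rewrite big_ord1 /= mul0r.
rewrite big_ord_recl /= mul0r add0r big_ord_recl /= mul1r subn1 /= big1 ?addr0 //.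
by move=> i _; rewrite /= mul0r.
Qed.

Lemma fps_coefXn_lt f n j : f 0%N = 0 -> (n < j)%N -> (f ^+ j) n = 0.
Proof.
move=> f0; elim: j n => // j IHj n ltnj.
rewrite exprS fps_coefM big_ord_recl f0 mul0r add0r big1 // => i _.
by rewrite IHj ?mulr0 // lift0; case: n i ltnj => [[]//|n] i; rewrite subSS !ltnS; apply: leq_ltn_trans; rewrite leq_subr.
Qed.

Lemma fps_coefXn_diag f n : f 0%N = 0 -> (f ^+ n) n = f 1%N ^+ n.
Proof.
move=> f0; elim: n => [|n IHn]; first by rewrite !expr0 fps_coef1.
rewrite exprS fps_coefM big_ord_recl f0 mul0r add0r big_ord_recl lift0 /= subn1 /=.
rewrite IHn -exprS big1 ?addr0 // => i _.
rewrite fps_coefXn_lt ?mulr0 // /bump /= !add1n subSS.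
by case: n i {IHn} => [[]//|n] i; rewrite subSS ltnS leq_subr.
Qed.

Definition fps_inv f : fps K :=
  if f 0%N == 0 then f
  else fps_const (f 0%N)^-1 *
       Fps (fun n => \sum_(j < n.+1) ((1 - fps_const (f 0%N)^-1 * f) ^+ j) n).

Definition fps_unit : {pred fps K} := fun f => f 0%N != 0.

Fact fps_mulVf : {in fps_unit, left_inverse 1 fps_inv *%R}.
Proof.
move=> f; rewrite unfold_in => f0; rewrite /fps_inv (negPf f0).
set u := 1 - _; set s := Fps _.
have u0 : u 0%N = 0.
  by rewrite fps_coefB fps_coefCM fps_coef1 mulVf // subrr.
rewrite mulrAC.
have -> : fps_const (f 0%N)^-1 * f = 1 - u by rewrite /u opprB addrC subrK.
apply: fpsP => n.
have sE i : (i <= n)%N -> s i = (\sum_(j < n.+1) u ^+ j) i.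
  move=> lein; rewrite fps_coef_sum /=.
  rewrite -!(big_mkord xpredT (fun j => (u ^+ j) i)).
  rewrite [RHS](@big_cat_nat _ _ _ i.+1) //= [X in _ + X]big_nat_cond.
  by rewrite [X in _ + X]big1 ?addr0 // => j /andP[/andP[ltij _] _]; apply: fps_coefXn_lt.
transitivity (((1 - u) * \sum_(j < n.+1) u ^+ j) n).
  by rewrite !fps_coefM; apply: eq_bigr => i _; rewrite sE // leq_subr.
have -> : (1 - u) * \sum_(j < n.+1) u ^+ j = 1 - u ^+ n.+1.
  by rewrite -opprB mulNr -subrX1 opprB.
by rewrite fps_coefB fps_coefXn_lt // subr0.
Qed.

Fact fps_unitPl f g : g * f = 1 -> fps_unit f.
Proof.
move=> gf1; have : (g * f) 0%N = 1 by rewrite gf1 fps_coef1.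
rewrite fps_coefM0 /fps_unit; case: eqP => // ->.
by move/esym/eqP; rewrite mulr0 oner_eq0.
Qed.

Fact fps_inv_out : {in [predC fps_unit], fps_inv =1 id}.
Proof.
move=> f; rewrite inE /= => nu; rewrite /fps_inv; move: nu.
by rewrite -topredE /= /fps_unit negbK => ->.
Qed.

HB.instance Definition _ := GRing.ComNzRing_hasMulInverse.Build (fps K)
  fps_mulVf fps_unitPl fps_inv_out.

Lemma fps_unitE f : (f \is a GRing.unit) = (f 0%N != 0).
Proof. by []. Qed.

Lemma fps_coefV0 f : f 0%N = 1 -> f^-1 0%N = 1.
Proof.
move=> f0; have Uf : f \is a GRing.unit by rewrite fps_unitE f0 oner_eq0.
have := congr1 (fun u : fps K => u 0%N) (mulVr Uf).
by rewrite fps_coefM0 f0 mulr1 fps_coef1.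
Qed.

Fact fps_const_is_zmod_morphism : zmod_morphism fps_const.
Proof.
by move=> a b; apply: fpsP => n; rewrite fps_coefB /=; case: eqP; rewrite ?subr0.
Qed.
Fact fps_const_is_monoid_morphism : monoid_morphism fps_const.
Proof.
split=> // a b; apply: fpsP => n; rewrite fps_coefCM /=.
by case: eqP; rewrite ?mulr0.
Qed.
HB.instance Definition _ := GRing.isZmodMorphism.Build K (fps K) fps_const
  fps_const_is_zmod_morphism.
HB.instance Definition _ := GRing.isMonoidMorphism.Build K (fps K) fps_const
  fps_const_is_monoid_morphism.

(* Substitution f(g(x)); meaningful when g has no constant term, since then
   (g ^+ i) n = 0 for n < i. *)
Definition fps_comp f g : fps K :=
  Fps (fun n => \sum_(i < n.+1) f i * (g ^+ i) n).

Definition is_compinv f g : Prop :=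
  [/\ g 0%N = 0, fps_comp f g = fps_X & fps_comp g f = fps_X].

(* The series with the above property, by [fps_compinvP]; junk when f is not
   in x K[[x]] or its coefficient of x vanishes. *)
Definition fps_compinv f : fps K := epsilon (inhabits 0) (is_compinv f).

Lemma fps_comp_widen N f h n : h 0%N = 0 -> (n < N)%N ->
  fps_comp f h n = \sum_(i < N) f i * (h ^+ i) n.
Proof.
move=> h0 ltnN /=.
rewrite -!(big_mkord xpredT (fun i => f i * (h ^+ i) n)).
rewrite [RHS](@big_cat_nat _ _ _ n.+1) //= [X in _ + X]big_nat_cond.
rewrite [X in _ + X]big1 ?addr0 // => j /andP[/andP[ltnj _] _].
by rewrite fps_coefXn_lt // mulr0.
Qed.

Let ev p h := (map_poly fps_const p).[h].

Let evE N p h n : h 0%N = 0 -> (n < N)%N ->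
  ev p h n = \sum_(i < N) p`_i * (h ^+ i) n.
Proof.
move=> h0 ltnN; rewrite /ev horner_coef fps_coef_sum size_map_poly.
transitivity (\sum_(i < size p + N) p`_i * (h ^+ i) n).
  rewrite -!(big_mkord xpredT (fun i => p`_i * (h ^+ i) n)).
  rewrite -(big_mkord xpredT (fun i => ((map_poly fps_const p)`_i * h ^+ i) n)).
  rewrite [RHS](@big_cat_nat _ _ _ (size p)) ?leq_addr //= [X in _ + X]big_nat_cond.
  rewrite [X in _ + X]big1 ?addr0.
    by apply: eq_bigr => i _; rewrite coef_map; apply: fps_coefCM.
  by move=> j /andP[/andP[lej _] _]; rewrite nth_default // mul0r.
rewrite -!(big_mkord xpredT (fun i => p`_i * (h ^+ i) n)).
rewrite (@big_cat_nat _ _ _ N) ?leq_addl //= [X in _ + X]big_nat_cond.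
rewrite [X in _ + X]big1 ?addr0 // => j /andP[/andP[lej _] _].
by rewrite fps_coefXn_lt ?mulr0 // (leq_trans ltnN).
Qed.

Let ev_trunc N f h n : h 0%N = 0 -> (n < N)%N ->
  ev (fps_trunc N f) h n = fps_comp f h n.
Proof.
move=> h0 ltnN; rewrite (@evE N) // (@fps_comp_widen N) //.
by apply: eq_bigr => i _; rewrite coef_fps_trunc.
Qed.

Lemma fps_compM f g h : h 0%N = 0 ->
  fps_comp (f * g) h = fps_comp f h * fps_comp g h.
Proof.
move=> h0; apply: fpsP => n; rewrite (@fps_comp_widen n.+1) //.
transitivity (ev (fps_trunc n.+1 f * fps_trunc n.+1 g) h n).
  by rewrite (@evE n.+1) //; apply: eq_bigr => i _; rewrite -coef_fps_mul.
rewrite /ev rmorphM hornerM -!/(ev _ _) !fps_coefM.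
by apply: eq_bigr => i _; rewrite !ev_trunc // ltnS leq_subr.
Qed.

Lemma fps_comp1 h : fps_comp 1 h = 1.
Proof.
apply: fpsP => n /=; rewrite big_ord_recl big1 ?addr0 /= ?mul1r ?expr0 //.
by move=> i _; rewrite mul0r.
Qed.

Lemma fps_compXn f h i : h 0%N = 0 -> fps_comp (f ^+ i) h = fps_comp f h ^+ i.
Proof.
by move=> h0; elim: i => [|i IHi]; rewrite ?fps_comp1 // !exprS fps_compM // IHi.
Qed.

Lemma fps_comp_coef0 f h : fps_comp f h 0%N = f 0%N.
Proof. by rewrite /= big_ord1 expr0 fps_coef1 mulr1. Qed.

Lemma fps_compA f g h : g 0%N = 0 -> h 0%N = 0 ->
  fps_comp f (fps_comp g h) = fps_comp (fps_comp f g) h.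
Proof.
move=> g0 h0; have gh0 : fps_comp g h 0%N = 0 by rewrite fps_comp_coef0.
apply: fpsP => n; rewrite /=.
transitivity (\sum_(i < n.+1) \sum_(j < n.+1) f i * ((g ^+ i) j * (h ^+ j) n)).
  apply: eq_bigr => i _; rewrite -fps_compXn // (@fps_comp_widen n.+1) //.
  by rewrite mulr_sumr.
rewrite exchange_big /=; apply: eq_bigr => j _.
rewrite -[\sum_(i < j.+1) _]/(fps_comp f g j) (@fps_comp_widen n.+1) // mulr_suml.
by apply: eq_bigr => i _; rewrite mulrA.
Qed.

Lemma fps_compX f : f 0%N = 0 -> fps_comp fps_X f = f.
Proof.
move=> f0; apply: fpsP => n; rewrite (@fps_comp_widen n.+2) //.
rewrite big_ord_recl /= mul0r add0r big_ord_recl /= mul1r expr1 big1 ?addr0 //.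
by move=> i _; rewrite /= mul0r.
Qed.

Lemma fps_XXn i n : (fps_X ^+ i) n = (n == i)%:R.
Proof.
elim: i n => [|i IHi] n; first by rewrite expr0 fps_coef1.
by rewrite exprS fps_coefXM; case: n.
Qed.

Lemma fps_comp_X f : fps_comp f fps_X = f.
Proof.
apply: fpsP => n /=; rewrite big_ord_recr /= fps_XXn eqxx mulr1 big1 ?add0r //.
by move=> i _; rewrite fps_XXn gtn_eqF ?mulr0.
Qed.

Lemma fps_left_compinv f : f 0%N = 0 -> f 1%N != 0 ->
  exists2 g : fps K, g 0%N = 0 & fps_comp g f = fps_X.
Proof.
move=> f0 f1.
pose step (s : seq K) :=
  rcons s ((fps_X (size s) - \sum_(i < size s) s`_i * (f ^+ i) (size s))
           / f 1%N ^+ size s).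
pose g := Fps (fun n => (iter n.+1 step [::])`_n).
have szE n : size (iter n step [::]) = n.
  by elim: n => // n IHn; rewrite /= size_rcons IHn.
have gE n i : (i < n)%N -> (iter n step [::])`_i = g i.
  elim: n => // n IHn; rewrite ltnS leq_eqVlt => /orP[/eqP -> //|ltin].
  by rewrite iterS /step nth_rcons szE ltin IHn.
have gn n : g n = (fps_X n - \sum_(i < n) g i * (f ^+ i) n) / f 1%N ^+ n.
  rewrite /g; cbn [fps_coef]; rewrite iterS {1}/step nth_rcons szE ltnn eqxx.
  by congr ((_ - _) / _); apply: eq_bigr => i _; rewrite gE.
exists g; first by rewrite gn big_ord0 /= subr0 mul0r.
apply: fpsP => n; rewrite /fps_comp; cbn [fps_coef].
rewrite big_ord_recr /= fps_coefXn_diag // -[nth _ _ _]/(g n) gn.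
by rewrite divfK ?expf_neq0 // addrC subrK.
Qed.

Lemma fps_compinvP f : f 0%N = 0 -> f 1%N != 0 -> is_compinv f (fps_compinv f).
Proof.
move=> f0 f1; rewrite /fps_compinv; apply: epsilon_spec.
have [g g0 gf] := fps_left_compinv f0 f1.
have g1 : g 1%N != 0.
  have := congr1 (fun u : fps K => u 1%N) gf.
  rewrite /= !big_ord_recl big_ord0 /= g0 expr1 mul0r add0r addr0 => E.
  by apply/eqP => g1; move/eqP: E; rewrite g1 mul0r eq_sym oner_eq0.
have [h h0 hg] := fps_left_compinv g0 g1.
have hf : h = f by rewrite -[h]fps_comp_X -gf fps_compA // hg fps_compX.
by exists g; split=> //; rewrite -hf.
Qed.

Lemma fps_compinv_unique f g h : f 0%N = 0 ->
  is_compinv f g -> is_compinv f h -> g = h.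
Proof.
move=> f0 [g0 _ gf] [h0 fh _].
by rewrite -[g]fps_comp_X -fh fps_compA // gf fps_compX.
Qed.

Definition fps_divX f : fps K := Fps (fun n => f n.+1).

Lemma fps_divXK f : f 0%N = 0 -> fps_X * fps_divX f = f.
Proof. by move=> f0; apply: fpsP => -[|n]; rewrite fps_coefXM. Qed.

Lemma fps_XM0 f : (fps_X * f) 0%N = 0. Proof. by rewrite fps_coefXM. Qed.

Lemma fps_XdivXM1 f : (fps_X / (1 + fps_X * f)) 1%N != 0.
Proof.
rewrite fps_coefXM fps_coefV0 ?oner_eq0 //.
by rewrite fps_coefD fps_coefXM fps_coef1 addr0.
Qed.

Lemma Cseries_coef1 (y q : fps K) :
  (fps_X * ((1 - q ^+ 2 * fps_X ^+ 2 * y) *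
            ((1 + fps_X * q) * (1 + fps_X * y * q))^-1)) 1%N != 0.
Proof.
rewrite fps_coefXM fps_coefM0 fps_coefV0.
  rewrite mulr1 fps_coefB !fps_coefM0 fps_coef1.
  by rewrite [fps_X 0%N]/= !(mulr0, mul0r) subr0 oner_eq0.
by rewrite fps_coefM0 !fps_coefD -mulrA !fps_coefXM fps_coef1 !addr0 mulr1.
Qed.

End FormalPowerSeries.

(* A graph embedded in the disk, recorded up to isotopy by its half-edges
   (darts).  The orbits of [edge] are the edges and the orbits of [node] are the
   vertices: [node d] is the half-edge following [d] clockwise around its vertex.
   [bds] lists the half-edges at b_1, ..., b_n.  A vertex is represented by its
   set of half-edges, and [hel] is only meaningful on internal vertices. *)
Record disk_graph := DiskGraph {
  dart : finType;
  edge : {perm dart};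
  node : {perm dart};
  bds : seq dart;
  hel : {set dart} -> int
}.

Section DiskGraphs.
Variable G : disk_graph.
Implicit Types (d : dart G) (v c : {set dart G}).

Definition nbd := size (bds G).
Definition vertex d := porbit (node G) d.
Definition internal := porbits (node G) :\: [set [set d] | d in bds G].
Definition deg v : nat := #|v|.

Definition glink : rel (dart G) :=
  [rel d d' | (edge G d == d') || (node G d == d')].
Definition components := [set [set d' | connect glink d d'] | d : dart G].

(* Collapsing the complement of the open disk to a point turns b_1, ..., b_n
   into a single vertex of a map on the sphere.  Going clockwise around the disk
   is going counterclockwise around that point, whence [prev]. *)
Definition closed_node d := if d \in bds G then prev (bds G) d else node G d.
Definition closed_glink : rel (dart G) :=
  [rel d d' | (edge G d == d') || (closed_node d == d')].

(* Euler's formula for the closed map: V + F = E + 2 c. *)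
Definition planar : bool :=
  (fcard closed_node (dart G) + fcard (closed_node \o edge G) (dart G)
   == fcard (edge G) (dart G) + 2 * n_comp closed_glink (dart G))%N.

Definition embedded : bool :=
  [&& [forall d, (edge G d != d) && (edge G (edge G d) == d)],
      uniq (bds G),
      all (fun d => node G d == d) (bds G),
      [forall d, has (connect glink d) (bds G)] &
      planar].

Definition boundary_leaf v : bool :=
  (deg v == 1%N) && [exists d in v, edge G d \in bds G].
Definition admissible_helicity v : bool :=
  if boundary_leaf v then (hel v == 0) || (hel v == 1)
  else 1 <= hel v <= (deg v)%:Z - 1.

Definition grassmannian : bool :=
  embedded && [forall v in internal, (deg v != 2%N) && admissible_helicity v].

Definition white v : bool := hel v == 1.
Definition black v : bool := hel v == (deg v)%:Z - 1.
Definition generic v : bool := ~~ white v && ~~ black v.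

Definition helicity : rat :=
  \sum_(v in internal) ((hel v)%:~R - (deg v)%:R / 2) + nbd%:R / 2.

Definition has_type (k n : int) : Prop := helicity = k%:~R /\ nbd%:Z = n.

Definition plabic : bool :=
  grassmannian && [forall v in internal, ~~ generic v].

(* A cycle is given by half-edges pointing along it: its vertices are pairwise
   distinct, and so are its edges (an edge is not traversed back and forth). *)
Definition graph_cycle (s : seq (dart G)) : bool :=
  [&& s != [::],
      path.cycle [rel d d' | d' \in vertex (edge G d)] s,
      uniq [seq vertex d | d <- s] &
      all (fun d => edge G d \notin s) s].
Definition acyclic : Prop := forall s, ~~ graph_cycle s.
Definition connected : bool := #|components| == 1%N.

Definition contracted : bool :=
  [forall d, (vertex d \in internal) && (vertex (edge G d) \in internal) ==>
     ~~ (white (vertex d) && white (vertex (edge G d))) &&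
     ~~ (black (vertex d) && black (vertex (edge G d)))].

Definition contracted_plabic_forest : Prop :=
  [/\ plabic, acyclic & contracted].
Definition contracted_plabic_tree : Prop :=
  contracted_plabic_forest /\ connected.

Definition mdim_vertex v : int :=
  if generic v then 2 * (deg v)%:Z - 4 else (deg v)%:Z - 1.
Definition mdim_component c : int :=
  let n := count [in c] (bds G) in
  if (n <= 2)%N then n%:Z - 1
  else 1 + \sum_(v in internal | v \subset c) (mdim_vertex v - 1).
Definition mdim : int := \sum_(c in components) mdim_component c.

End DiskGraphs.

(* Isotopy of the disk fixing b_1, ..., b_n. *)
Definition isotopic (G H : disk_graph) : Prop :=
  exists f : dart G -> dart H,
    [/\ bijective f,
        {morph f : d / edge G d >-> edge H d},
        {morph f : d / node G d >-> node H d},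
        map f (bds G) = bds H &
        forall v, v \in internal G -> hel (f @: v) = hel v].

(* There are exactly N graphs satisfying P, up to isotopy. *)
Definition number_up_to_isotopy (P : disk_graph -> Prop) (N : nat) : Prop :=
  exists G : 'I_N -> disk_graph,
    [/\ forall i, P (G i),
        forall i j, isotopic (G i) (G j) -> i = j &
        forall H, P H -> exists i, isotopic H (G i)].

(* Q(y,q), as the fraction field of Q[q][y]: the outer variable is y, the inner
   one is q. *)
Definition Qyq := {fraction {poly {poly rat}}}.
Definition tofracQ (p : {poly {poly rat}}) : Qyq := tofrac p.

Definition coef_yq (p : {poly {poly rat}}) (k r : int) : rat :=
  match k, r with
  | Posz k', Posz r' => p`_k'`_r'
  | _, _ => 0
  end.

(* [x^n y^k q^r] F = a, for F whose coefficient of x^n lies in Q[y,q]. *)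
Definition has_coef (F : fps Qyq) (n k r : int) (a : rat) : Prop :=
  exists2 p : {poly {poly rat}},
    (if n is Posz m then F m else 0) = tofracQ p & coef_yq p k r = a.

Definition vx : fps Qyq := fps_X _.
Definition vy : fps Qyq := fps_const (tofracQ 'X).
Definition vq : fps Qyq := fps_const (tofracQ 'X%:P).

Definition Cseries : fps Qyq :=
  vx * (1 - vq ^+ 2 * vx ^+ 2 * vy) / ((1 + vx * vq) * (1 + vx * vy * vq)).

Definition Ptree : fps Qyq := vx * (1 + vy + vy * vq * fps_compinv Cseries).

Definition Pforest : fps Qyq := fps_divX (fps_compinv (vx / (1 + Ptree))).

Lemma Cseries_compinv : is_compinv Cseries (fps_compinv Cseries).
Proof. by apply: fps_compinvP; rewrite /Cseries -mulrA;
  [apply: fps_XM0|apply: Cseries_coef1]. Qed.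

Lemma Ptree_compinv :
  is_compinv (vx / (1 + Ptree)) (fps_compinv (vx / (1 + Ptree))).
Proof. by apply: fps_compinvP; [apply: fps_XM0|apply: fps_XdivXM1]. Qed.

Lemma PforestE : vx * Pforest = fps_compinv (vx / (1 + Ptree)).
Proof. by apply: fps_divXK; case: Ptree_compinv. Qed.

(* Main.v *)
(* Cutting an edge of a forest leaves on either side a plane tree whose leaves are
   labelled by boundary vertices, and these labelled trees, read at the first
   boundary vertex of every component, determine the forest up to isotopy.  In
   terms of permutations the closed map is obtained from the forest by multiplying
   the face permutation by n - 1 transpositions, each of which merges or splits
   orbits; Euler's formula says that the only merges are the unavoidable ones, which
   join a new component.  Equivalently, reading the boundary clockwise, the labels
   come out of a stack onto which every new component pushes its leaves.  Hence the
   labels can be forgotten: forests are the words in unlabelled trees and pops with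
   nonnegative heights ending at height 0, and every such word is realized.

   A tree beyond an edge is a leaf, white or black; let U be the series of those
   that are not of colour c, T that of all.  Reading the children of a vertex of
   colour c one by one gives T = U + q_c U T with q_white = q, q_black = yq, whence
   C(T) = x.  The words starting at height h have series (xF)^h F, where
   F = 1 + P_tree(xF).  The last formula is Lagrange inversion. *)
From HB Require Import structures.
Require Import Defs.
From mathcomp Require Import all_boot all_order all_algebra all_fingroup.
From mathcomp Require Import zify ring.
From mathcomp Require Import boolp fingraph.

Set Implicit Arguments.
Unset Strict Implicit.
Unset Printing Implicit Defensive.

Import Order.TTheory GRing.Theory Num.Theory.

(** * Labelled codes of subtrees determine a graph up to isotopy *)

Local Open Scope nat_scope.

Unset Elimination Schemes.

(** The statistics become additive because nothing is generic. At a vertex with [m] children m(v) -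
    1 is m - 1, and these numbers add up over a tree to its number of leaves minus one; so the
    dimension merely counts the boundary vertices that are not roots, and this is the exponent of q.
    A component has helicity 1 plus the sum of deg - 2 over its black vertices, whence the common
    factor yq in P_tree. The two lollipops have no leaf and are counted apart, by x(1 + y).

    The obstacle is that an isotopy class carries no topology here: it is a pair of permutations up
    to renaming of half-edges, and planarity is a count of orbits. Half-edges of two graphs must be
    matched by something intrinsic, the code of the labelled subtree beyond them; conversely, to
    realize a word, half-edges are named by such subtrees, whose distinct labels keep the names
    apart. Codes need fuel because acyclicity is only a hypothesis on a graph; it enters through the
    fact that every edge is a bridge, which makes the part beyond a half-edge shrink from parent to
    child. *)

Inductive ptree := Lf of nat | Nd of bool & seq ptree.
Set Elimination Schemes.

HB.instance Definition _ := gen_eqMixin ptree.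
HB.instance Definition _ := gen_choiceMixin ptree.

(** The children sit inside a [seq], where a generated scheme would give no induction hypothesis. *)
Lemma ptree_ind (K : ptree -> Prop) : (forall i, K (Lf i)) ->
  (forall c ts, {in ts, forall t, K t} -> K (Nd c ts)) -> forall t, K t.
Proof.
move=> KL KN; fix loop 1 => -[i|c ts]; first exact: KL.
apply: KN; elim: ts => [|t ts IHts]; first by clear.
have Kt := loop t; clear loop => u.
by rewrite inE => /predU1P[-> //|]; apply: IHts.
Qed.

Lemma porbit_orbit (T : finType) (s : {perm T}) x : porbit s x =i orbit s x.
Proof.
move=> y; rewrite -fconnect_orbit; apply/idP/idP.
  by case/porbitP=> i ->; rewrite permX fconnect_iter.
by move/iter_findex<-; rewrite -permX mem_porbit.
Qed.

Lemma card_porbit_order (T : finType) (s : {perm T}) x : #|porbit s x| = order s x.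
Proof. by apply: eq_card => y; rewrite porbit_orbit -fconnect_orbit. Qed.

Section Codes.
Variable H : disk_graph.
Implicit Types (d : dart H).

Fixpoint code N d : ptree :=
  if N is N'.+1 then
    if edge H d \in bds H then Lf (index (edge H d) (bds H))
    else Nd (~~ white (vertex (edge H d)))
            [seq code N' c | c <- behead (orbit (node H) (edge H d))]
  else Nd false [::].

(* [code] is junk when the fuel runs out; on a forest it is eventually constant. *)
Definition code_is d t := exists M, forall N, M <= N -> code N d = t.
End Codes.

Section Twins.
Variables H K : disk_graph.

(** Agreement for all large fuel makes sense, and propagates, in graphs with cycles as well. *)
Definition same_code (d : dart H) (d' : dart K) :=
  exists M, forall N, M <= N -> code N d = code N d'.
(* Both the subtree beyond a half-edge and the one behind it: this makes the
   relation invariant under [edge], and under [node] because the code behind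
   [node d] lists the other subtrees at the same vertex.  The labels of the leaves
   then force it to be a bijection, whatever the shape of the graphs. *)
Definition twin d d' := same_code d d' /\ same_code (edge H d) (edge K d').

Hypothesis eH : forall d, edge H (edge H d) = d.
Hypothesis eK : forall d, edge K (edge K d) = d.
Hypothesis bH : {in bds H, forall d, node H d = d}.
Hypothesis bK : {in bds K, forall d, node K d = d}.

Lemma twin_edge d d' : twin d d' -> twin (edge H d) (edge K d').
Proof. by case=> h1 h2; split=> //; rewrite eH eK. Qed.

Lemma same_code_bd d d' : same_code d d' -> edge H d \in bds H ->
  edge K d' \in bds K /\ index (edge H d) (bds H) = index (edge K d') (bds K).
Proof.
case=> M /(_ M.+1 (leqnSn _)) /= E b; rewrite b in E.
by case: ifP E => // _ [].
Qed.

Lemma same_code_nbd d d' : same_code d d' -> edge H d \notin bds H ->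
  [/\ edge K d' \notin bds K, 
      white (vertex (edge H d)) = white (vertex (edge K d')),
      order (node H) (edge H d) = order (node K) (edge K d') &
      forall j, 0 < j < order (node H) (edge H d) ->
        same_code (iter j (node H) (edge H d)) (iter j (node K) (edge K d'))].
Proof.
case=> M EM b; have:= EM M.+1 (leqnSn _); rewrite /= (negPf b).
case: ifP => // /negbT b' [] Ec Es.
have sz : order (node H) (edge H d) = order (node K) (edge K d').
  have := congr1 size Es; rewrite !size_map !size_behead !size_orbit.
  by rewrite -orderSpred -[order (node K) _]orderSpred /= => ->.
split=> //; first by apply: negb_inj.
case=> // j /= ltj; exists M => N leMN.
have := EM N.+1 (leqW leMN); rewrite /= (negPf b) (negPf b') => -[_].
move/(congr1 (fun s => nth (Nd false [::]) s j)).
have ltj1 : j < (order (node H) (edge H d)).-1 by rewrite -ltnS orderSpred.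
have ltj2 : j < (order (node K) (edge K d')).-1 by rewrite -sz.
rewrite !(nth_map (edge H d)) ?(nth_map (edge K d')) ?size_behead ?size_orbit //.
by rewrite !nth_behead !nth_traject // -sz.
Qed.

(** Unless [j] is a multiple of the order, the half-edge is a child in the code behind [d]; at a
    multiple it is [d] itself, whose own code is the other half of [twin]. *)
Lemma twin_iter d d' : twin d d' -> d \notin bds H ->
  forall j, same_code (iter j (node H) d) (iter j (node K) d').
Proof.
case=> h1 h2 db j.
have [|_ _ Eo Ej] := same_code_nbd h2; first by rewrite eH.
rewrite !eH !eK in Eo Ej.
have iterM (G : disk_graph) (x : dart G) n :
    iter n (node G) x = iter (n %% order (node G) x) (node G) x.
  have E : forall q, iter (q * order (node G) x) (node G) x = x.
    by elim=> // q IHq; rewrite mulSn addnC iterD iter_order ?IHq //; apply: perm_inj.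
  by rewrite {1}(divn_eq n (order (node G) x)) addnC iterD E.
rewrite iterM [iter j (node K) _]iterM -Eo.
have := ltn_pmod j (order_gt0 (node H) d).
case: (j %% _) => [_ //|k ltk]; exact: Ej.
Qed.

Lemma twin_node d d' : twin d d' -> twin (node H d) (node K d').
Proof.
move=> tw; case: (boolP (d \in bds H)) => db.
  have [] := same_code_bd (d := edge H d) (d' := edge K d') tw.2; rewrite !eH //.
  by rewrite eK => db' _; rewrite bH // bK.
have Ei := twin_iter tw db.
split; first exact: (Ei 1).
have := same_code_nbd (d := edge H d) (d' := edge K d') tw.2.
rewrite eH eK => /(_ db) [db' Ec Eo _].
(* The subtree behind [node x] has as children the half-edges that follow it around the vertex, from
   the second successor of [x] round to [x] itself. *)
have ch (G : disk_graph) (x : dart G) : (forall d, edge G (edge G d) = d) -> 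
    {in bds G, forall d, node G d = d} -> x \notin bds G -> forall N,
  code N.+1 (edge G (node G x)) = Nd (~~ white (vertex x)) 
     [seq code N (iter j.+2 (node G) x) | j <- iota 0 (order (node G) x).-1].
  move=> eG bG xb N; rewrite /= eG.
  have nxb : node G x \notin bds G.
    apply: contra xb => nx; have := bG _ nx => /perm_inj E; by rewrite -E.
  rewrite (negPf nxb); congr (Nd _ _).
    congr (~~ white _); apply/setP=> y; rewrite /vertex -!eq_porbit_mem.
    by congr (_ == _); have := porbit_perm (node G) 1 x; rewrite expg1.
  have -> : order (node G) x = order (node G) (node G x).
    apply: (eq_order_cycle (p := orbit (node G) x)); rewrite ?cycle_orbit ?in_orbit //; try exact: perm_inj.
    by apply: mem_orbit; rewrite in_orbit.
  rewrite /orbit -orderSpred /=.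
  apply: (@eq_from_nth _ (Nd false [::])) => [|i]; rewrite !size_map size_traject ?size_iota // => lti.
  rewrite (nth_map (node G (node G x))) ?size_traject // (nth_map 0) ?size_iota // nth_iota // nth_traject //.
  by rewrite -iterSr -iterSr.
(* Finitely many codes are involved, so one amount of fuel serves them all. *)
have : exists M, forall N, M <= N -> forall j, j < (order (node H) d).+2 ->
   code N (iter j (node H) d) = code N (iter j (node K) d').
  elim: (order (node H) d).+2 => [|m [M IHm]]; first by exists 0.
  have [M' EM'] := Ei m; exists (maxn M M') => N; rewrite geq_max => /andP[leM leM'] j.
  rewrite ltnS leq_eqVlt => /predU1P[-> |]; [exact: EM'|exact: IHm].
case=> M EM; exists M.+1 => -[//|N leMN].
rewrite !ch // Ec Eo; congr (Nd _ _); apply/eq_in_map => j; rewrite mem_iota add0n -Eo => /andP[_ ltj].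
by apply: EM => //; lia.
Qed.

Lemma twin_connect d d' x : twin d d' -> connect (@glink H) d x ->
  exists2 x', twin x x' & connect (@glink K) d' x'.
Proof.
move=> tw /connectP[p + ->]; elim: p d d' tw => [|y p IHp] d d' tw /=; first by exists d'.
case/andP=> /orP[] /eqP <- /IHp.
  case/(_ _ (twin_edge tw)) => x' h1 h2; exists x' => //.
  by apply: connect_trans h2; apply: connect1; rewrite /glink /= eqxx.
case/(_ _ (twin_node tw)) => x' h1 h2; exists x' => //.
by apply: connect_trans h2; apply: connect1; rewrite /glink /= eqxx orbT.
Qed.

Lemma twin_bd d d' : twin d d' -> d \in bds H ->
  d' \in bds K /\ index d (bds H) = index d' (bds K).
Proof. by case=> _ /same_code_bd; rewrite eH eK => h /h. Qed.

End Twins.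

(** Along a path from [d] to the boundary: the partner of a boundary half-edge is determined by its
    position, and injectivity of [edge] and [node] brings uniqueness back along the path. *)
Lemma twin_func H K : (forall d, edge H (edge H d) = d) ->
  (forall d, edge K (edge K d) = d) ->
  {in bds H, forall d, node H d = d} -> {in bds K, forall d, node K d = d} ->
  (forall d : dart H, has (connect (@glink H) d) (bds H)) ->
  forall (d : dart H) d1 d2, @twin H K d d1 -> @twin H K d d2 -> d1 = d2.
Proof.
move=> eH eK bH bK cH d d1 d2 t1 t2.
have /hasP[b bb /connectP[p pP Eb]] := cH d.
move: bb; rewrite {}Eb; elim: p d d1 d2 t1 t2 pP => [|y p IHp] d d1 d2 t1 t2 /=.
  move=> _ db; have [b1 E1] := twin_bd eH eK t1 db.
  have [b2 E2] := twin_bd eH eK t2 db.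
  by rewrite -(nth_index d1 b1) -E1 E2 nth_index.
case/andP=> /orP[] /eqP <- pP lb.
  by apply: perm_inj; apply: IHp pP lb; apply: twin_edge.
by apply: perm_inj; apply: IHp pP lb; apply: twin_node.
Qed.

Lemma twin_sym H K d d' : @twin H K d d' -> @twin K H d' d.
Proof. by case=> -[M1 E1] [M2 E2]; split; [exists M1|exists M2] => N ?; rewrite ?E1 ?E2. Qed.

Lemma nongeneric_hel (G : disk_graph) (v : {set dart G}) : ~~ generic v ->
  hel v = if white v then 1%R else ((deg v)%:Z - 1)%R.
Proof.
by rewrite /generic /white /black; case: eqP => [->//|_]; rewrite andTb negbK => /eqP.
Qed.

Lemma glink_connect_sym (G : disk_graph) : (forall d, edge G (edge G d) = d) ->
  connect_sym (@glink G).
Proof.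
move=> eG.
suff sub x y : connect (@glink G) x y -> connect (@glink G) y x.
  by move=> x y; apply/idP/idP; apply: sub.
case/connectP=> p + ->; elim: p x => //= z p IHp x /andP[st /IHp{IHp} IH].
apply: connect_trans IH _; case/orP: st => /eqP <-.
  by apply: connect1; rewrite /glink /= eG eqxx.
have : fconnect (node G) (node G x) x by rewrite fconnect_sym ?fconnect1 //; apply: perm_inj.
by apply: connect_sub => a b /= /eqP <-; apply: connect1; rewrite /glink /= eqxx orbT.
Qed.

(** Equal codes at one boundary position of each component suffice: there the half-edges are twins,
    and twins spread along [glink]. The defaults of [nth] are quantified because no half-edge of the
    other graph is at hand. *)
Lemma isotopicP H K : plabic H -> plabic K -> size (bds H) = size (bds K) ->
  (forall d, exists i, [/\ i < size (bds H), connect (@glink H) d (nth d (bds H) i) &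
     forall d', exists t, code_is (nth d (bds H) i) t /\ code_is (nth d' (bds K) i) t]) ->
  (forall d', exists i, [/\ i < size (bds H), connect (@glink K) d' (nth d' (bds K) i) &
     forall d, exists t, code_is (nth d (bds H) i) t /\ code_is (nth d' (bds K) i) t]) ->
  isotopic H K.
Proof.
move=> plH plK szb HK KH.
have [/andP[/and5P[/forallP eH uH /allP bH /forallP cH _] _] _] := andP plH.
have [/andP[/and5P[/forallP eK uK /allP bK /forallP cK _] _] _] := andP plK.
have {}eH d : edge H (edge H d) = d by apply/eqP; case/andP: (eH d).
have {}eK d : edge K (edge K d) = d by apply/eqP; case/andP: (eK d).
have {}bH : {in bds H, forall d, node H d = d} by move=> d /bH /eqP.
have {}bK : {in bds K, forall d, node K d = d} by move=> d /bK /eqP.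
have csH := glink_connect_sym eH; have csK := glink_connect_sym eK.
have base i : i < size (bds H) -> forall d d', 
    (exists t, code_is (nth d (bds H) i) t /\ code_is (nth d' (bds K) i) t) ->
    twin (nth d (bds H) i) (nth d' (bds K) i).
  move=> lti d d' [t [[M1 E1] [M2 E2]]]; split.
    exists (maxn M1 M2) => N; rewrite geq_max => /andP[? ?]; by rewrite E1 ?E2.
  (* Behind a boundary half-edge lies just a leaf carrying its position. *)
  exists 1 => -[//|N _] /=; rewrite eH eK !mem_nth -?szb //.
  by rewrite !index_uniq // -szb.
have exH d : exists d', @twin H K d d'.
  have [i [lti cdi /(_ _) ht]] := HK d.
  case: (bds K) szb (base i lti) ht => [|b s] szb; first by rewrite szb in lti.
  move=> tw ht; have [|x' tx _] := twin_connect eH eK bH bK (tw d b (ht b)) (x := d); last by exists x'.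
  by rewrite csH.
have exK d' : exists d, @twin H K d d'.
  have [i [lti cdi /(_ _) ht]] := KH d'.
  have := base i lti; case: (bds H) szb ht lti => [//|b s] szb ht lti tw.
  have [|x' tx _] := twin_connect eK eH bK bH (twin_sym (tw b d' (ht b))) (x := d'); first by rewrite csK.
  by exists x'; apply: twin_sym.
have [f fP] := choice exH.
have [g gP] := choice exK.
have func := @twin_func H K eH eK bH bK cH.
have func' := @twin_func K H eK eH bK bH cK.
have fE d d' : twin d d' -> f d = d' by move=> tw; apply: func (fP d) tw.
have fbij : bijective f.
  exists g => x; last by apply: fE.
  apply: (func' (f x)); apply: twin_sym; [exact: gP|exact: fP].
exists f; split=> // [d|d||v].
- by apply: fE; apply: twin_edge.
- by apply: fE; apply: twin_node.
- case Eb: (bds H) => [|d0 s].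
    by case: (bds K) szb; rewrite Eb.
  rewrite -Eb; apply: (@eq_from_nth _ (f d0)) => [|i]; rewrite size_map // => lti.
  rewrite (nth_map d0) //.
  have [h1 h2] := twin_bd eH eK (fP (nth d0 (bds H) i)) (mem_nth d0 lti).
  by rewrite index_uniq // in h2; rewrite [in RHS]h2 nth_index.
move=> vi; have /setDP[/imsetP[d _ Ev] nb] := vi.
have db : d \notin bds H.
  apply: contra nb => db; apply/imsetP; exists d => //; rewrite Ev.
  apply/setP=> y; rewrite porbit_orbit !inE -fconnect_orbit.
  by apply/idP/eqP => [/connectP[p + ->]|->//]; elim: p => //= z p IHp; rewrite bH // => /andP[/eqP <-].
have [|fb Ew Eo _] := same_code_nbd (d := edge H d) (d' := edge K (f d)) (fP d).2.
  by rewrite eH.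
rewrite ?eH ?eK in Eo Ew fb.
have Ef : f @: v = vertex (f d).
  have fn x : f (node H x) = node K (f x) by apply: fE; apply: twin_node.
  have fi i : f (iter i (node H) d) = iter i (node K) (f d).
    by elim: i => //= i IHi; rewrite fn IHi.
  apply/setP=> y; apply/imsetP/idP => [[x + ->]|].
    by rewrite Ev => /porbitP[i ->]; rewrite permX fi -permX mem_porbit.
  case/porbitP=> i ->; exists (iter i (node H) d); last by rewrite permX fi.
  by rewrite Ev -permX mem_porbit.
have fvi : vertex (f d) \in internal K.
  rewrite inE imset_f // andbT; apply/imsetP => -[b bb Eb].
  have : f d \in vertex (f d) by rewrite /vertex porbit_id.
  by rewrite Eb inE => /eqP E; rewrite E bb in fb.
(* Twins share colour and degree, and without generic vertices these determine the helicity. *)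
have [_ /forall_inP/(_ _ vi) ngv] := andP plH.
have [_ /forall_inP/(_ _ fvi) ngf] := andP plK.
by rewrite Ef !nongeneric_hel // -Ew /deg Ev /vertex !card_porbit_order Eo.
Qed.

Lemma isotopic_code H K (f : dart H -> dart K) : injective f ->
    {morph f : d / edge H d >-> edge K d} -> {morph f : d / node H d >-> node K d} ->
    map f (bds H) = bds K ->
    (forall v, v \in internal H -> hel (f @: v) = hel v) ->
    {in bds H, forall d, node H d = d} ->
  forall N d, code N (f d) = code N d.
Proof.
move=> fI fe fn fb fh bH; elim=> //= N IHN d.
have mb x : (f x \in bds K) = (x \in bds H) by rewrite -fb mem_map.
rewrite -fe mb -fb index_map //; case: ifP => // xb.
have oE x : orbit (node K) (f x) = map f (orbit (node H) x).
  have tr n y : traject (node K) (f y) n = map f (traject (node H) y n).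
    by elim: n y => //= n IHn y; rewrite -fn IHn.
  have cyc : fcycle (node K) (map f (orbit (node H) x)).
    rewrite cycle_map; apply: sub_cycle (cycle_orbit (@perm_inj _ _) x).
    by move=> a b /= /eqP <-; rewrite fn.
  rewrite (orbitE cyc) ?map_inj_uniq ?orbit_uniq //.
    by rewrite index_map // /orbit -orderSpred /= eqxx rot0.
  by rewrite mem_map // in_orbit.
congr (Nd _ _).
  congr (~~ _); rewrite /white -(fh (vertex (edge H d))).
    congr (hel _ == _); apply/setP => y; apply/idP/imsetP.
      by rewrite porbit_orbit oE => /mapP[z zo ->]; exists z => //; rewrite porbit_orbit.
    by case=> z zo ->; rewrite porbit_orbit oE map_f // -porbit_orbit.
  rewrite inE imset_f // andbT; apply/imsetP => -[b bb Eb].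
  have : edge H d \in vertex (edge H d) by rewrite /vertex porbit_id.
  by rewrite Eb inE => /eqP E; rewrite E bb in xb.
by rewrite oE behead_map -map_comp; apply: eq_map => c /=; rewrite IHN.
Qed.

(** * Bridges and subtrees of a forest *)

Fixpoint leaves t := match t with Lf i => [:: i] | Nd _ ts => flatten (map leaves ts) end.

(** In a graph the second argument of [g] stands for [(deg v).-1]: the half-edge towards the root is
    not counted. *)
Fixpoint wsum (g : bool -> nat -> rat) t : rat :=
  match t with
  | Lf _ => 0%R
  | Nd c ts => (g c (size ts) + \sum_(x <- map (wsum g) ts) x)%R
  end.

(** Here [c] is the colour of the vertex above. In a contracted graph colours alternate, and two
    children mean degree at least 3. *)
Fixpoint wf (c : bool) t :=
  match t with
  | Lf _ => true
  | Nd c' ts => [&& c' != c, 1 < size ts & all (wf c') ts]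
  end.

(** The root edge hangs from the boundary, so either colour is allowed, and so is a vertex without
    children: the two lollipops. *)
Definition wf_root t :=
  match t with
  | Lf _ => true
  | Nd c ts => (size ts != 1) && all (wf c) ts
  end.

(* Contracted plabic forests, except for Euler's formula. *)
Definition prePlanar H : Prop :=
  [/\ [/\ forall d, edge H (edge H d) = d, forall d, edge H d != d, uniq (bds H),
          {in bds H, forall d, node H d = d} &
          forall d, has (connect (@glink H) d) (bds H)],
      forall v, v \in internal H -> [/\ deg v != 2, admissible_helicity v & ~~ generic v],
      acyclic H & contracted H].

Section Forest.
Variable H : disk_graph.
Implicit Types (d x y c : dart H).
Local Notation e := (edge H).
Local Notation nd := (node H).

Definition alink (A : pred (dart H)) : rel (dart H) :=
  [rel x y | A x && (e x == y) || (y \in vertex x)].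
Definition avoid d : pred (dart H) := [pred x | (x != d) && (x != e d)].
(* The half-edges lying beyond [d]. *)
Definition side d := [set x | connect (alink (avoid d)) (e d) x].

Hypothesis fH : prePlanar H.

Let eI d : e (e d) = d. Proof. by case: fH => -[]. Qed.
Let eN d : e d != d. Proof. by case: fH => -[]. Qed.
Let bN d : d \in bds H -> nd d = d. Proof. by case: fH => -[_ _ _ h _] _ _ _; apply: h. Qed.
Let ac : acyclic H. Proof. by case: fH. Qed.

Let eInj : injective e. Proof. exact: perm_inj. Qed.

Lemma vertexE x y : (y \in vertex x) = (vertex y == vertex x).
Proof. by rewrite /vertex -eq_porbit_mem. Qed.

Lemma vertex_refl x : x \in vertex x. Proof. exact: porbit_id. Qed.

Lemma alink_connect_sym A : (forall x, A (e x) = A x) -> connect_sym (alink A).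
Proof.
move=> AE; apply: sym_connect_sym => x y /=; congr (_ || _).
  apply/andP/andP=> -[Ax /eqP <-]; by rewrite AE eI eqxx.
by rewrite vertexE eq_sym -vertexE.
Qed.

Lemma avoidE d x : avoid d (e x) = avoid d x.
Proof.
rewrite /avoid /= andbC (inj_eq eInj); congr (_ && _).
by rewrite -(inj_eq eInj) eI.
Qed.

Let vpath x s : path [rel d d' | d' \in vertex (e d)] x s =
  ([seq vertex y | y <- s] == [seq vertex (e y) | y <- belast x s]).
Proof. by elim: s x => //= y s IHs x; rewrite eqseq_cons -IHs vertexE. Qed.

(** A connection avoiding the edge of [d] is projected to vertices, shortened there to a simple
    path, and lifted back to half-edges; together with [d] it would be a [graph_cycle]. *)
Lemma bridge d : ~~ connect (alink (avoid d)) (e d) d.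
Proof.
pose vr : rel {set dart H} := [rel u v |
  [exists x, [&& avoid d x, vertex x == u & vertex (e x) == v]]].
have vrP x y : connect (alink (avoid d)) x y -> connect vr (vertex x) (vertex y).
  case/connectP=> p + ->; elim: p x => //= z p IHp x /andP[/orP[/andP[Ax /eqP <-]|xz]] /IHp; last first.
    by move: xz; rewrite vertexE => /eqP <-.
  apply: connect_trans; apply: connect1; apply/existsP; exists x.
  by rewrite !eqxx Ax.
apply/negP => /vrP /connectP[p0 p0P].
case/shortenP: p0P => p pP pU _ Ed {p0}.
have [s [sp1 sp2 sA]] : exists s, [/\ [seq vertex x | x <- s] = belast (vertex (e d)) p,
    [seq vertex (e x) | x <- s] = p & all (avoid d) s].
  elim: p (vertex (e d)) pP {pU Ed} => [|v p IHp] u /=; first by exists [::].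
  case/andP=> /existsP[x /and3P[Ax /eqP <- /eqP Ev]] /IHp[s [E1 E2 As]].
  by exists (x :: s) => /=; rewrite E1 E2 Ax -Ev.
have Es : rcons [seq vertex x | x <- s] (vertex d) = vertex (e d) :: p by rewrite sp1 Ed -lastI.
have := ac (d :: s); rewrite /graph_cycle /= vpath.
have -> : [seq vertex y | y <- rcons s d] = [seq vertex (e y) | y <- belast d (rcons s d)].
  by rewrite belast_rcons map_rcons Es /= sp2.
rewrite eqxx -rcons_uniq Es pU inE negb_or eN /=.
have -> : e d \notin s.
  by apply/negP => /(allP sA); rewrite /avoid /= eqxx andbF.
suff -> : all (fun d0 => e d0 \notin d :: s) s by [].
apply/allP => x xs; rewrite inE negb_or.
have := allP sA _ xs; rewrite /avoid /= => /andP[xd xed].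
have -> /= : e x != d by rewrite -[d]eI (inj_eq eInj).
apply/negP => exs.
(* A [graph_cycle] may not go back along an edge: as the vertices are distinct, [x] and [e x] would
   each have to follow the other immediately. *)
pose i := index x s; pose j := index (e x) s.
have lti : i < size s by rewrite index_mem.
have ltj : j < size s by rewrite index_mem.
have szp : size p = size s by rewrite -sp2 size_map.
have N1 k : k < size s -> nth set0 (vertex (e d) :: p) k = vertex (nth d s k).
  by move=> ltk; rewrite -Es nth_rcons size_map ltk (nth_map d).
have N2 k : k < size s -> nth set0 (vertex (e d) :: p) k.+1 = vertex (e (nth d s k)).
  by move=> ltk; rewrite /= -{1}sp2 (nth_map d).
have E1 : j = i.+1.
  have := nth_uniq set0 (s := vertex (e d) :: p) (i := j) (j := i.+1).
  rewrite /= szp !ltnS => /(_ (ltnW ltj) lti pU).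
  by rewrite N1 // -[nth _ p i]/(nth set0 (vertex (e d) :: p) i.+1) N2 // !nth_index // eqxx => /esym/eqP.
have E2 : j.+1 = i.
  have := nth_uniq set0 (s := vertex (e d) :: p) (i := j.+1) (j := i).
  rewrite /= szp !ltnS => /(_ ltj (ltnW lti) pU).
  by rewrite N1 // -[nth _ p j]/(nth set0 (vertex (e d) :: p) j.+1) N2 // !nth_index // eI eqxx => /esym/eqP.
by clear -E1 E2; lia.
Qed.

Lemma edge_side d : e d \in side d.
Proof. by rewrite inE connect0. Qed.

Lemma notin_side d : d \notin side d.
Proof. by rewrite inE bridge. Qed.

(** This drives the inductions on subtrees. The part beyond [c] never meets the edge of [d]: [e d]
    lies at the same vertex as [c], so reaching it would mean reaching [c] without using its edge,
    against [bridge]. *)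
Lemma child_side d c : c \in vertex (e d) -> c != e d -> side c \proper side d.
Proof.
move=> cv ced.
have symc := alink_connect_sym (avoidE c).
have edN : e d \notin side c.
  rewrite inE; apply: contra (bridge c) => h; apply: connect_trans h _.
  by apply: connect1; rewrite /alink /= cv orbT.
have cd : c != d.
  apply: contraTneq cv => ->; apply: contra (bridge d) => h.
  by apply: connect1; rewrite /alink /= h orbT.
have Acd : avoid d c by rewrite /avoid /= cd.
have Ced : connect (alink (avoid d)) (e d) c by apply: connect1; rewrite /alink /= cv orbT.
apply/properP; split; last by exists c; rewrite ?notin_side // inE.
apply/subsetP=> x; rewrite inE => /connectP[p + ->].
have : e c \in side d.
  by rewrite inE; apply: connect_trans Ced _; apply: connect1; rewrite /alink /= Acd eqxx.
move: (edge_side c); elim: p (e c) => //= z p IHp y yc yd /andP[yz zp].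
have zc : z \in side c by rewrite inE; apply: connect_trans (connect1 yz); rewrite inE in yc.
apply: (IHp z) => //; rewrite inE in yd; rewrite inE; apply: connect_trans yd _; apply: connect1.
case/orP: yz => [/andP[Ay /eqP Ez]|h]; last by rewrite /alink /= h orbT.
apply/orP; left; rewrite Ez eqxx andbT /avoid /=.
apply/andP; split; apply: contraNneq edN => Ey; last by rewrite -Ey.
by rewrite -Ey Ez.
Qed.

Definition ctree d := code #|side d| d.

Let children d := behead (orbit nd (e d)).

Lemma childrenP d c : c \in children d -> (c \in vertex (e d)) && (c != e d).
Proof.
rewrite /children /vertex porbit_orbit => h; rewrite mem_behead //=.
have := orbit_uniq nd (e d); move: h; rewrite /orbit -orderSpred /= => h /andP[+ _].
by apply: contraNN => /eqP Ec; rewrite -{1}Ec.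
Qed.

Lemma code_stable d N : #|side d| <= N -> code N d = ctree d.
Proof.
rewrite /ctree; have [n] := ubnP #|side d|; elim: n d N => // n IHn d N ltn leN.
have s0 : 0 < #|side d| by apply/card_gt0P; exists (e d); apply: edge_side.
case: N leN => [|N leN]; first by rewrite leqNgt s0.
case Es: #|side d| s0 leN ltn => [//|m] _ leN ltn /=.
case: ifP => // _; congr (Nd _ _); apply/eq_in_map => c /childrenP/andP[cv cd].
have := proper_card (child_side cv cd); rewrite Es ltnS => lec.
rewrite IHn ?(leq_trans lec _) //; first by rewrite [RHS]IHn //; lia.
by lia.
Qed.

Lemma code_is_ctree d : code_is d (ctree d).
Proof. by exists #|side d| => N; apply: code_stable. Qed.

Lemma ctree_bd d : e d \in bds H -> ctree d = Lf (index (e d) (bds H)).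
Proof. by move=> b; rewrite -(code_stable (leqnSn _)) /= b. Qed.

Lemma ctree_nbd d : e d \notin bds H ->
  ctree d = Nd (~~ white (vertex (e d))) (map ctree (children d)).
Proof.
move=> b; rewrite -(code_stable (leqnSn _)) /= (negPf b); congr (Nd _ _).
apply/eq_in_map => c /childrenP/andP[cv cd].
by rewrite code_stable // ltnW // proper_card // child_side.
Qed.

Lemma size_children d : size (children d) = (deg (vertex (e d))).-1.
Proof. by rewrite size_behead size_orbit /deg card_porbit_order. Qed.

Lemma vertex_bd d : d \in bds H -> vertex d = [set d].
Proof.
move=> db; apply/setP=> y; rewrite /vertex porbit_orbit !inE -fconnect_orbit.
by apply/idP/eqP => [/connectP[p + ->]|->//]; elim: p => //= z p IHp; rewrite bN // => /andP[/eqP <-].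
Qed.

Lemma mem_vertex_bd d x : x \in vertex d -> (x \in bds H) = (d \in bds H).
Proof.
move=> xd; apply/idP/idP=> h.
  by move: xd; rewrite vertexE vertex_bd // => /eqP E; have := vertex_refl d; rewrite -E inE => /eqP ->.
by move: xd; rewrite vertex_bd // inE => /eqP ->.
Qed.

Lemma internalE d : (vertex d \in internal H) = (d \notin bds H).
Proof.
rewrite inE imset_f // andbT; congr (~~ _); apply/imsetP/idP => [[b bb E]|db].
  by have := vertex_refl d; rewrite E inE => /eqP ->.
by exists d => //; rewrite vertex_bd.
Qed.

Lemma internalP v : v \in internal H -> exists2 d, d \notin bds H & v = vertex d.
Proof.
by move=> vi; have /setDP[/imsetP[d _ Ev] _] := vi; exists d => //; rewrite -internalE /vertex -Ev.
Qed.

(** Alternation with the vertex of [d] makes sense only when that vertex is internal; otherwise just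
    the root condition can be claimed. *)
Lemma ctree_wf d : wf_root (ctree d) && ((d \in bds H) || wf (~~ white (vertex d)) (ctree d)).
Proof.
have [_ hv _ /forallP hc] := fH.
have [n] := ubnP #|side d|; elim: n d => // n IHn d ltn.
have [b|b] := boolP (e d \in bds H); first by rewrite ctree_bd //= orbT.
rewrite ctree_nbd //=.
have [d2 adm ng] := hv _ (etrans (internalE (e d)) b).
have sz1 : size (children d) != 1 by rewrite size_children; lia.
have al : all (wf (~~ white (vertex (e d)))) (map ctree (children d)).
  apply/allP => t /mapP[c /childrenP/andP[cv cd] ->].
  have /IHn/andP[_] : #|side c| < n by have := proper_card (child_side cv cd); lia.
  rewrite (mem_vertex_bd cv) (negPf b) /=.
  by move: cv; rewrite vertexE => /eqP ->.
rewrite size_map sz1 al !andbT /=.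
have [//|db] /= := boolP (d \in bds H).
have := hc d; rewrite !internalE b db /= => /andP[h1 h2].
(* With [d] internal, a vertex of degree 1 would not be a boundary leaf, and its range of helicities
   would be empty. *)
have d1 : deg (vertex (e d)) != 1.
  apply: contraTneq adm => D1; rewrite /admissible_helicity /boundary_leaf D1 /=.
  case: ifP => [/existsP[x /andP[xv]]|_]; last by move: (hel _) => h; clear; lia.
  have -> : x = e d.
    apply/eqP; have /cards1P[z Ez] : #|vertex (e d)| == 1 by apply/eqP.
    by move: xv (vertex_refl (e d)); rewrite Ez !inE => /eqP -> /eqP ->.
  by rewrite eI (negPf db).
have d0 : 0 < deg (vertex (e d)) by apply/card_gt0P; exists (e d); apply: vertex_refl.
rewrite size_children; apply/andP; split; last by move: d0 d1 d2; case: deg => [|[|[|]]].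
have ng' : ~~ generic (vertex d) by have [] := hv _ (etrans (internalE d) db).
move: h1 h2 ng ng'; rewrite /generic; by case: (white (vertex d)); case: (white (vertex (e d)));
  case: (black (vertex d)); case: (black (vertex (e d))).
Qed.

(* Walking around the graph, keeping it on one side. *)
Definition phi : {perm dart H} := (e * nd)%g.
Lemma phiE x : phi x = nd (e x). Proof. by rewrite permM. Qed.

Definition lab (s : seq (dart H)) := [seq index x (bds H) | x <- s & x \in bds H].

(** The walk goes round the subtree beyond [d] and comes back along the same edge. Summing over
    half-edges instead of vertices lets the sum grow along the walk: the total of a vertex is
    complete when the walk returns by [e d]. *)
Lemma traverse (g : bool -> nat -> rat) (F : dart H -> rat) d :
  (forall v, v \in internal H -> (\sum_(x in v) F x)%R = g (~~ white v) (deg v).-1) ->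
  exists s, [/\ fpath phi d s, last d s = e d, {subset s <= side d},
     lab s = leaves (ctree d) & (\sum_(x <- s | x \notin bds H) F x)%R = wsum g (ctree d)].
Proof.
move=> Fg; have [n] := ubnP #|side d|; elim: n d => // n IHn d ltn.
have [b|b] := boolP (e d \in bds H).
  exists [:: e d]; rewrite ctree_bd //= phiE bN // eqxx /lab /= b /=; split=> //.
    by move=> x; rewrite inE => /eqP ->; apply: edge_side.
  by rewrite big_cons big_nil b.
rewrite ctree_nbd //.
have sub : {subset children d <= [pred c | (c \in vertex (e d)) && (c != e d)]} by move=> c /childrenP.
have pth : fpath nd (e d) (children d).
  by rewrite /children /orbit -orderSpred; apply: fpath_traject.
have lst : nd (last (e d) (children d)) = e d.
  have := cycle_orbit (@perm_inj _ nd) (e d); rewrite /children /orbit -orderSpred /=.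
  by rewrite rcons_path => /andP[_ /eqP].
have [S [S1 S2 S3 S4 S5]] : exists S, [/\ fpath phi (e (e d)) S,
    last (e (e d)) S = e (last (e d) (children d)), {subset S <= side d},
    lab S = flatten (map leaves (map ctree (children d))) &
    (\sum_(x <- S | x \notin bds H) F x)%R = (\sum_(c <- children d) F c + 
       \sum_(x <- map (wsum g) (map ctree (children d))) x)%R].
  (* Generalized to any run of consecutive half-edges around the vertex; their excursions are
     concatenated. *)
  move: (children d) {lst} pth sub => cs pth sub.
  have {}sub c : c \in cs -> [/\ #|side c| < n, c \notin bds H, {subset side c <= side d} & c \in side d].
    move/sub => /andP[cv cd]; split.
    - by have := proper_card (child_side cv cd); lia.
    - by rewrite (mem_vertex_bd cv).
    - by have /proper_sub/subsetP := child_side cv cd.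
    by rewrite inE; apply: connect1; rewrite /alink /= cv orbT.
  elim: cs (e d) pth sub => [|c cs IHcs] x /=.
    by move=> _ _; exists [::]; split=> //=; rewrite !big_nil addr0.
  case/andP=> /eqP Ec cP sub.
  have [c' c'cs|S [S1 S2 S3 S4 S5]] := IHcs c cP; first by apply: sub; rewrite inE c'cs orbT.
  have [lc cb cs1 cs2] := sub c (mem_head _ _).
  have [s [s1 s2 s3 s4 s5]] := IHn c lc.
  exists (c :: s ++ S); split.
  - by rewrite /= phiE eI Ec eqxx cat_path s1 s2.
  - by rewrite /= last_cat s2 S2.
  - move=> y; rewrite inE mem_cat => /or3P[/eqP -> //|/s3/cs1//|/S3//].
  - by rewrite /lab /= (negPf cb) filter_cat map_cat -/(lab s) -/(lab S) s4 S4.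
  rewrite big_cons cb big_cat /= s5 S5 !big_cons.
  by rewrite addrCA !addrA -[(_ + F c + _)%R]addrA [(wsum g _ + _)%R]addrC.
rewrite eI in S1 S2.
exists (rcons S (e d)); split.
- by rewrite rcons_path S1 S2 /= phiE eI lst.
- by rewrite last_rcons.
- by move=> y; rewrite mem_rcons inE => /predU1P[->|/S3//]; apply: edge_side.
- by rewrite /lab filter_rcons (negPf b) -/(lab S) S4.
have Fv : (F (e d) + \sum_(c <- children d) F c = \sum_(x in vertex (e d)) F x)%R.
  transitivity (\sum_(x <- e d :: children d) F x)%R; first by rewrite big_cons.
  have -> : e d :: children d = orbit nd (e d) by rewrite /children /orbit -orderSpred.
  rewrite -big_enum; apply: perm_big.
  apply: uniq_perm; rewrite ?orbit_uniq ?enum_uniq // => y.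
  by rewrite mem_enum porbit_orbit.
rewrite -cats1 big_cat /= S5 big_cons big_nil b addr0 size_map size_children.
by rewrite -Fg ?internalE // -Fv addrC addrA.
Qed.

End Forest.

Lemma fcard_porbits (T : finType) (s : {perm T}) f : f =1 s -> fcard f T = #|porbits s|.
Proof.
move=> fs; rewrite (eq_fcard fs).
pose h (x : T) := porbit s x; pose R := [pred x | froots s x & x \in T].
rewrite -[LHS]/#|R| -(@card_in_imset _ _ h R).
  apply: eq_card => A; apply/imsetP/imsetP => [[x _ ->]|[x _ ->]]; first by exists x.
  exists (froot s x); last first.
    by apply/esym/eqP; rewrite eq_porbit_mem porbit_orbit -fconnect_orbit connect_root.
  by rewrite inE /= (roots_root (fconnect_sym (@perm_inj _ s))).
move=> x y; rewrite !inE !andbT => /eqP rx /eqP ry /eqP; rewrite eq_porbit_mem porbit_orbit -fconnect_orbit.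
by move/(rootP (fconnect_sym (@perm_inj _ s))); rewrite -/(froot s x) rx ry.
Qed.

(** Inversion exchanges left and right multiplication and keeps the orbits. *)
Lemma porbits_mulr_tperm (T : finType) (s : {perm T}) x y :
  #|porbits (s * tperm x y)%g| + (x \notin porbit s y).*2 = #|porbits s| + (x != y).
Proof.
rewrite -porbitsV invMg tpermV -(porbitsV s) -(porbitV s); exact: porbits_mul_tperm.
Qed.

Lemma sub_count_iff (T : eqType) (a b : pred T) s : {in s, forall x, a x -> b x} ->
  (count a s == count b s) = all (fun x => b x ==> a x) s.
Proof.
elim: s => //= x s IHs h.
have le : count a s <= count b s.
  elim: s h {IHs} => //= y s IHs h; apply: leq_add; last by apply: IHs => z; rewrite inE => /predU1P[->|zs]; apply: h; rewrite !inE ?eqxx // zs !orbT.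
  by have := h y; rewrite !inE eqxx orbT => /(_ isT); case: (a y) => //= ->.
have {}IHs := IHs (fun z zs => h z (mem_behead (s := x :: s) zs)).
have := h x (mem_head _ _); case: (a x) => [->//|] /=; rewrite ?eqn_add2l ?IHs //.
case: (b x) => //= _; apply/eqP; lia.
Qed.

Section Forest.
Variable H : disk_graph.
Implicit Types (d x y c : dart H).
Local Notation e := (edge H).
Local Notation nd := (node H).
Hypothesis fH : prePlanar H.

Let eI d : e (e d) = d. Proof. by case: fH => -[]. Qed.
Let eN d : e d != d. Proof. by case: fH => -[]. Qed.
Let bN d : d \in bds H -> nd d = d. Proof. by case: fH => -[_ _ _ h _] _ _ _; apply: h. Qed.
Local Notation phi := (phi H).

(** The walk of [traverse] leads from [d] to [e d]. Hence a component of a forest has a single face,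
    and orbits of [phi] can replace components. *)
Lemma edge_porbit_phi d : e d \in porbit phi d.
Proof.
have [|s [pth lst _ _ _]] := @traverse H fH (fun _ _ => 0%R) (fun _ => 0%R) d.
  by move=> v _; rewrite big1.
rewrite porbit_orbit -fconnect_orbit; apply/connectP; by exists s.
Qed.

Lemma connect_phi x y : connect (@glink H) x y = (y \in porbit phi x).
Proof.
apply/idP/idP.
  case/connectP=> p + ->; elim: p x => [|z p IHp] x /=; first by rewrite porbit_id.
  move=> /andP[xz /IHp]; rewrite -!eq_porbit_mem => /eqP ->.
  rewrite eq_porbit_mem; case/orP: xz => /eqP <-; first exact: edge_porbit_phi.
  have -> : nd x = phi (e x) by rewrite phiE eI.
  have := edge_porbit_phi x; rewrite -!eq_porbit_mem => /eqP <-.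
  by have := porbit_perm phi 1 (e x); rewrite expg1 => ->.
case/porbitP=> i ->; rewrite permX; elim: i => [|i IHi]; first exact: connect0.
apply: connect_trans IHi _; rewrite iterS phiE; set z := iter _ _ _.
apply: (@connect_trans _ _ (e z)); apply: connect1; by rewrite /glink /= eqxx ?orbT.
Qed.

Lemma componentsE : components H = porbits phi.
Proof.
by apply: eq_imset => d; apply/setP=> y; rewrite inE connect_phi.
Qed.

(** At a boundary half-edge the walk closes up, because [node] fixes [b]. *)
Lemma orbit_phi_bd (g : bool -> nat -> rat) (F : dart H -> rat) b : b \in bds H ->
  (forall v, v \in internal H -> (\sum_(x in v) F x)%R = g (~~ white v) (deg v).-1) ->
  [/\ head b (orbit phi b) = b, 
      lab (behead (orbit phi b)) = leaves (ctree b) &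
      (\sum_(x in porbit phi b | x \notin bds H) F x)%R = wsum g (ctree b)].
Proof.
move=> bb Fg; have [s [s1 s2 s3 s4 s5]] := traverse fH b Fg.
have cyc : fcycle phi (b :: s) by rewrite /= rcons_path s1 s2 /= phiE eI bN.
have bs : b \notin s by apply: contra (notin_side fH b); apply: s3.
have Es : orbit phi b = b :: s.
  rewrite -[RHS](_ : rot (index b (b :: s)) (b :: s) = _); last by rewrite /= eqxx rot0.
  apply: orbitE; rewrite ?mem_head //.
  (* A cycle of [phi] repeats the orbit a whole number of times; a second round would put [b] into
     [s], hence beyond its own edge. *)
  have [[|k] Ek] := fcycle_consEflatten cyc; first by rewrite Ek /= cats0 orbit_uniq.
  move: Ek bs; rewrite /= /orbit -orderSpred /= => -[->].
  by rewrite mem_cat inE eqxx orbT.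
rewrite Es; split=> //.
rewrite -s5 -big_filter -[RHS]big_filter.
apply: perm_big; apply: uniq_perm; rewrite ?filter_uniq ?index_enum_uniq //.
  by have := orbit_uniq phi b; rewrite Es => /andP[].
move=> x; rewrite !mem_filter mem_index_enum /= ?andbT [RHS]andbC.
case: (boolP (x \in bds H)) => xb; rewrite ?andbF // !andbT porbit_orbit Es inE.
by case: eqP xb => // ->; rewrite bb.
Qed.

Definition swap_edges (l : seq (dart H)) : {perm dart H} := 
  (\prod_(d <- l) tperm d (e d))%g.

Lemma swap_edgesE l x : uniq (l ++ map e l) ->
  swap_edges l x = if (x \in l) || (e x \in l) then e x else x.
Proof.
elim: l x => [|d l IHl] x; first by rewrite /swap_edges big_nil perm1.
rewrite cat_uniq /= has_sym /= inE !negb_or => /and4P[/andP[dl ul] /and3P[_ del hl] edl um].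
have {}IHl : forall y, swap_edges l y = if (y \in l) || (e y \in l) then e y else y.
  by move=> y; apply: IHl; rewrite cat_uniq ul um has_sym hl.
have mE y : (e y \in l) = (y \in map e l) by rewrite -{2}(eI y) mem_map //; apply: perm_inj.
rewrite /swap_edges big_cons -/(swap_edges l) permM IHl !inE.
have edl' : e d \notin l by rewrite mE.
case: tpermP => [->|->|/eqP xd /eqP xed].
- by rewrite !eI eqxx (negPf edl') (negPf dl).
- by rewrite eI eqxx orbT (negPf edl') (negPf dl).
by rewrite (negPf xd) -(inj_eq (@perm_inj _ e)) eI (negPf xed).
Qed.

(* Adding the edges one at a time: by [bridge], each of them merges two orbits. *)
Lemma porbits_swap_edges l : uniq (l ++ map e l) ->
  #|porbits (swap_edges l * nd)%g| + size l = #|porbits nd|.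
Proof.
elim: l => [|d l IHl]; first by rewrite /swap_edges big_nil mul1g addn0.
move=> u; move: (u); rewrite cat_uniq /= has_sym /= inE !negb_or => /and4P[/andP[dl ul] /and3P[_ del hl] edl um].
have u' : uniq (l ++ map e l) by rewrite cat_uniq ul um has_sym hl.
rewrite -(IHl u') /swap_edges big_cons -mulgA -/(swap_edges l) addnS.
have := porbits_mul_tperm (swap_edges l * nd)%g d (e d) => /=.
rewrite [d == _]eq_sym eN.
suff -> : d \notin porbit (swap_edges l * nd)%g (e d) by move: #|_| #|_| => a b /=; lia.
apply: contra (bridge fH d) => /porbitP[i Ei].
suff h j : connect (alink (avoid d)) (e d) (iter j (swap_edges l * nd)%g (e d)).
  by have := h i; rewrite -permX -Ei.
elim: j => [|j IHj]; first exact: connect0.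
rewrite iterS; apply: connect_trans IHj _; set z := iter _ _ _.
have edl' : e d \notin l by rewrite -(mem_map (@perm_inj _ e)) eI.
rewrite permM swap_edgesE //; case: ifP => zl; last first.
  by apply: connect1; rewrite /alink /= orbC /vertex -(expg1 nd) mem_porbit.
apply: (@connect_trans _ _ (e z)); apply: connect1; rewrite /alink /= /avoid /=.
  rewrite eqxx andbT; apply/orP; left; apply/andP; split; apply: contraTneq zl => ->.
    by rewrite negb_or dl.
  by rewrite eI negb_or dl andbT.
by rewrite orbC /vertex -(expg1 nd) mem_porbit.
Qed.

Lemma card_porbits_phi : #|porbits phi| + fcard e (dart H) = #|porbits nd|.
Proof.
(* One half-edge out of every edge, so that [swap_edges l] is [edge] itself. *)
pose l := enum (roots (frel e)).
have rI x : x \in roots (frel e) -> (e x \in roots (frel e)) = false.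
  rewrite !unfold_in /roots /= => /eqP rx; apply/negP => /eqP.
  have -> : froot e (e x) = froot e x.
    by apply/(rootP (fconnect_sym (@perm_inj _ e))); rewrite fconnect_sym ?fconnect1 //; apply: perm_inj.
  by rewrite rx => /esym/eqP; rewrite (negPf (eN x)).
have u : uniq (l ++ map e l).
  rewrite cat_uniq enum_uniq map_inj_uniq ?enum_uniq //=; last exact: perm_inj.
  rewrite andbT; apply/hasPn => y /mapP[x]; rewrite !mem_enum => xr ->.
  by rewrite rI.
rewrite -(porbits_swap_edges u) /l -cardE; congr (_ + _); last first.
  by apply: eq_card => x; rewrite !inE andbT.
congr #|porbits (_ * _)%g|; apply/permP => x; rewrite swap_edgesE // !mem_enum.
case: ifP => // /negbT; rewrite negb_or => /andP[h1 h2].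
have sy := fconnect_sym (@perm_inj _ e).
have e2 y : fconnect e x y -> (y == x) || (y == e x).
  have gen p z : (z == x) || (z == e x) -> fpath e z p -> (last z p == x) || (last z p == e x).
    elim: p z => //= w p IHp z zx /andP[/eqP <- /IHp]; apply.
    by case/orP: zx => /eqP ->; rewrite ?eI eqxx ?orbT.
  by case/connectP=> p pP ->; apply: gen pP; rewrite eqxx.
case/orP: (e2 _ (connect_root (frel e) x)) => /eqP E.
  by have := roots_root sy x; rewrite E => r; rewrite -topredE /= r in h1.
by have := roots_root sy x; rewrite E => r; rewrite -topredE /= r in h2.
Qed.

End Forest.

(** * Planarity as a stack discipline *)

Section OrbitSurgery.
Variable T : finType.
Implicit Types (s : {perm T}) (x y : T).

Lemma fpath_tperm s x y z p : fpath s z p -> x \notin p -> y \notin p ->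
  fpath (s * tperm x y)%g z p.
Proof.
elim: p z => //= w p IHp z /andP[/eqP Ew pP]; rewrite !inE !negb_or => /andP[xw xp] /andP[yw yp].
by rewrite permM Ew tpermD // eqxx IHp.
Qed.

Lemma orbit_of_cycle (f : T -> T) x p : fcycle f (x :: p) -> uniq (x :: p) -> orbit f x = x :: p.
Proof.
move=> cy un; rewrite (orbitE cy) ?mem_head //= eqxx; exact: rot0.
Qed.

(** In [(s * tperm x y)%g] the transposition acts last: the predecessors of [x] and [y] exchange
    their targets. This cuts a common orbit in two and joins two different ones. *)
Lemma orbit_split s x y A B : orbit s x = x :: A ++ y :: B ->
  orbit (s * tperm x y)%g y = y :: B.
Proof.
move=> E; have := cycle_orbit (@perm_inj _ s) x; have := orbit_uniq s x.
rewrite E /= mem_cat inE !negb_or cat_uniq /= => /and3P[/and3P[xA xy xB] uA /and3P[_ yB uB]].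
rewrite rcons_cat cat_path /= rcons_path => /and3P[_ _ /andP[pB /eqP lB]].
apply: orbit_of_cycle; last by rewrite /= yB.
by rewrite /= rcons_path fpath_tperm //= permM lB tpermL.
Qed.

Lemma orbit_merge s x y A B : orbit s x = x :: A -> orbit s y = y :: B -> y \notin x :: A ->
  orbit (s * tperm x y)%g y = y :: B ++ x :: A.
Proof.
move=> Ex Ey yA; have := cycle_orbit (@perm_inj _ s) x; have := orbit_uniq s x.
have := cycle_orbit (@perm_inj _ s) y; have := orbit_uniq s y.
have dis : ~~ has (mem (x :: A)) (y :: B).
  rewrite -Ex -Ey; apply/hasPn => z; rewrite -fconnect_orbit => yz.
  apply: contra yA => zx; rewrite -Ex -fconnect_orbit; apply: connect_trans (_ : fconnect s z y).
    by rewrite fconnect_orbit.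
  by rewrite fconnect_sym //; apply: perm_inj.
rewrite Ex Ey /= => /andP[yB uB]; rewrite rcons_path => /andP[pB /eqP lB] /andP[xA uA].
rewrite rcons_path => /andP[pA /eqP lA].
move: dis; rewrite /= negb_or inE => /andP[_ dB].
have xB : x \notin B by apply: contra dB => xB; apply/hasP; exists x; rewrite //= mem_head.
move: yA; rewrite inE negb_or => /andP[yx yA].
apply: orbit_of_cycle.
  rewrite /= rcons_cat cat_path fpath_tperm //= permM lB tpermR eqxx /=.
  by rewrite rcons_path fpath_tperm //= permM lA tpermL.
by rewrite /= mem_cat inE !negb_or yB yx yA /= cat_uniq uB has_sym dB /= xA uA.
Qed.

End OrbitSurgery.

(* Reads the boundary from position [k] on; [S] lists the labels of the leaves of
   the components met so far, innermost component first, and must be popped in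
   the order of the boundary: this is the noncrossing condition. *)
Fixpoint run k (S : seq nat) (w : seq (option ptree)) : bool :=
  match w with
  | [::] => S == [::]
  | Some t :: w' => run k.+1 (leaves t ++ S) w'
  | None :: w' => if S is i :: S' then (i == k) && run k.+1 S' w' else false
  end.

Section Planarity.
Variable H : disk_graph.
Implicit Types (d x y c : dart H).
Local Notation e := (edge H).
Local Notation nd := (node H).
Hypothesis fH : prePlanar H.

Let eI d : e (e d) = d. Proof. by case: fH => -[]. Qed.
Let bU : uniq (bds H). Proof. by case: fH => -[]. Qed.
Let bN d : d \in bds H -> nd d = d. Proof. by case: fH => -[_ _ _ h _] _ _ _; apply: h. Qed.
Let cB d : has (connect (@glink H) d) (bds H). Proof. by case: fH => -[]. Qed.
Local Notation phi := (phi H).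

Variable x0 : dart H.
Let n := size (bds H).
Let b i := nth x0 (bds H) i.

Let n0 : 0 < n.
Proof. by have := cB x0; rewrite /n; case: (bds H). Qed.

Let bb i : i < n -> b i \in bds H. Proof. exact: mem_nth. Qed.
Let bE i j : i < n -> j < n -> (b i == b j) = (i == j).
Proof. by move=> li lj; rewrite nth_uniq. Qed.
Let bP x : x \in bds H -> exists2 i, i < n & x = b i.
Proof. by move=> xb; exists (index x (bds H)); rewrite ?index_mem // /b nth_index. Qed.
Let indexb i : i < n -> index (b i) (bds H) = i. Proof. by move=> li; rewrite index_uniq. Qed.

(* The rotation of the first [k] boundary half-edges, one transposition at a
   time; [closed_node] is [node] composed with [bcyc n]. *)
Fixpoint bcyc k : {perm dart H} :=
  if k is k'.+1 then (bcyc k' * tperm (b k'.-1) (b k'))%g else 1%g.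
Definition glued k := (phi * bcyc k)%g.

Lemma bcyc_out k x : k <= n -> x \notin bds H -> bcyc k x = x.
Proof.
elim: k => [|k IHk] lk xb; first by rewrite perm1.
rewrite permM IHk ?(ltnW lk) // tpermD //; apply: contraNneq xb => <-; apply: bb => //.
by apply: leq_ltn_trans lk; apply: leq_pred.
Qed.

Lemma bcyc_bd k j : k <= n -> j < n ->
  bcyc k (b j) = b (if j < k then (if j is j'.+1 then j' else k.-1) else j).
Proof.
elim: k j => [|k IHk] j lk lj; first by rewrite perm1.
have lk' : k.-1 < n by apply: leq_ltn_trans lk; apply: leq_pred.
rewrite permM IHk ?(ltnW lk) // ltnS.
case: (ltngtP j k) => [ljk|lkj|->].
- case: j lj ljk => [|j] lj ljk; first by rewrite tpermL.
  by rewrite tpermD // bE //; lia.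
- by rewrite tpermD // bE //; lia.
by rewrite tpermR; case: k {IHk} lk lk'.
Qed.

Lemma closed_nodeE : closed_node (G := H) =1 (nd * bcyc n)%g.
Proof.
move=> x; rewrite /closed_node permM; case: ifP => [|/negbT] xb; last first.
  rewrite bcyc_out //; apply: contra xb => xb.
  by have := bN xb => /perm_inj <-.
rewrite bN //; have [i li ->] := bP xb; rewrite bcyc_bd // li.
rewrite prev_nth (bb li) /b /n; rewrite /n in li.
case Eb: (bds H) bU li => [|y p] // /andP[yp up].
case: i => [|i] /= li.
  by rewrite memNindex //; apply: set_nth_default.
rewrite index_uniq //.
by rewrite (set_nth_default y) //= ltnW.
Qed.

(** Since [node] fixes every boundary half-edge, each transposition attaches a new fixed point, and
    no orbit is ever split. *)
Lemma card_closed_node : #|porbits (nd * bcyc n)%g| + n.-1 = #|porbits nd|.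
Proof.
have : n <= n by []. 
elim: {-2}n => [|k IHk] lk; first by rewrite mulg1 addn0.
rewrite -(IHk (ltnW lk)) /= mulgA.
case: k {IHk} lk => [|k] lk; first by rewrite /= tperm1 mulg1.
have := porbits_mulr_tperm (nd * bcyc k.+1)%g (b k) (b k.+1).
have -> : b k != b k.+1 by rewrite bE ?(ltnW lk) // ltn_eqF.
have -> : b k \notin porbit (nd * bcyc k.+1)%g (b k.+1).
  apply/negP => /porbitP[i]; rewrite permX.
  have -> : iter i (nd * bcyc k.+1)%g (b k.+1) = b k.+1.
    by elim: i => // i IHi; rewrite iterS IHi permM bN ?bb // bcyc_bd ?(ltnW lk) // ltnn.
  by move/eqP; rewrite bE ?(ltnW lk) //; lia.
by move: #|_| #|_| => u v /=; lia.
Qed.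

(* Passing from [glued k] to [glued k.+1] merges two orbits or splits one. *)
Definition merges k := b k.-1 \notin porbit (glued k) (b k).
Definition first k := all (fun j => b j \notin porbit phi (b k)) (iota 0 k).

Lemma gluedS k : glued k.+1 = (glued k * tperm (b k.-1) (b k))%g.
Proof. by rewrite /glued /= mulgA. Qed.

(** Every transposition changes the number of orbits by one, up for a split and down for a merge. *)
Lemma card_glued : #|porbits (glued n)| + (count merges (iota 1 n.-1)).*2 = #|porbits phi| + n.-1.
Proof.
suff gen k : k <= n -> #|porbits (glued k)| + (count merges (iota 1 k.-1)).*2 = #|porbits phi| + k.-1.
  exact: gen.
elim: k => [|k IHk] lk; first by rewrite /glued /= mulg1.
(* The transposition of index 0 is trivial, as [0.-1 = 0]: there are only [n.-1] proper ones. *)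
case: k IHk lk => [|k] IHk lk; first by rewrite gluedS /= tperm1 mulg1 /glued /= mulg1.
have -> : iota 1 k.+2.-1 = iota 1 k ++ [:: k.+1] by rewrite -[k.+2.-1]addn1 iotaD add1n.
rewrite count_cat /= addn0.
have := IHk (ltnW lk); rewrite [glued k.+2]gluedS /=.
have := porbits_mulr_tperm (glued k.+1) (b k) (b k.+1).
have -> : b k != b k.+1 by rewrite bE ?(ltnW lk) // ltn_eqF.
rewrite -/(merges k.+1) /=.
by case: (merges k.+1); move: #|_| #|_| #|_| (count _ _) => u v w z /=; lia.
Qed.

Lemma first0 : first 0. Proof. by []. Qed.

Lemma card_first : count first (iota 0 n) = #|porbits phi|.
Proof.
pose A := [set k : 'I_n | first k].
have -> : count first (iota 0 n) = #|A|.
  rewrite cardE /enum_mem size_filter -(val_enum_ord n) count_map.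
  by rewrite -enumT; apply: eq_count => k /=; rewrite inE.
rewrite -(@card_in_imset _ _ (fun k : 'I_n => porbit phi (b k))).
  apply: eq_card => P; apply/imsetP/imsetP => [[k _ ->]|[x _ ->]]; first by exists (b k).
  have /hasP[y yb] := cB x; rewrite (connect_phi fH) => yx.
  have ex : exists i, (i < n) && (b i \in porbit phi x).
    by have [i li Ey] := bP yb; exists i; rewrite li -Ey.
  case: (ex_minnP ex) => m /andP[lm bm] mP.
  exists (Ordinal lm); last by apply/esym/eqP; rewrite eq_porbit_mem.
  rewrite inE; apply/allP => j; rewrite mem_iota add0n => /andP[_ ljm] /=.
  apply/negP => bj; have := mP j; rewrite (ltn_trans ljm lm) /=.
  have -> : b j \in porbit phi x.
    by move: bj bm; rewrite -!eq_porbit_mem => /eqP -> .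
  by move=> /(_ isT); rewrite leqNgt ljm.
move=> i j; rewrite !inE => /allP fi /allP fj /eqP; rewrite eq_porbit_mem => bij.
apply: val_inj; case: (ltngtP i j) => //= lij.
  by have := fj i; rewrite mem_iota /= lij bij => /(_ isT).
by have := fi j; rewrite mem_iota /= lij porbit_sym bij => /(_ isT).
Qed.

(** As [bcyc k] moves only [b 0], ..., [b k.-1], the walk can change component only to one met
    before position [k]. *)
Lemma glued_sub k x : 0 < k <= n -> x \in porbit (glued k) (b k.-1) ->
  exists2 i, i < k & x \in porbit phi (b i).
Proof.
case/andP=> k0 lk /porbitP[m ->]; rewrite permX; elim: m => [|m [i li IHm]].
  by exists k.-1; [rewrite ltn_predL|exact: porbit_id].
rewrite iterS; set z := iter _ _ _ in IHm *.
have zp : phi z \in porbit phi (b i).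
  move: IHm; rewrite -!eq_porbit_mem => /eqP <-; apply/eqP.
  by have := porbit_perm phi 1 z; rewrite expg1.
rewrite permM; have [zb|zb] := boolP (phi z \in bds H); last by exists i; rewrite ?bcyc_out.
have [j lj Ez] := bP zb; rewrite Ez bcyc_bd //.
case: ifP => ljk; last by exists i; rewrite // -Ez.
by eexists; last exact: porbit_id; case: j ljk {lj Ez} => [|j] ljk; [rewrite ltn_predL|apply: ltnW].
Qed.

Lemma first_merges k : 0 < k < n -> first k -> merges k.
Proof.
case/andP=> k0 lk /allP fk; apply/negP; rewrite porbit_sym => /glued_sub[|i li bi].
  by rewrite k0 ltnW.
by have := fk i; rewrite mem_iota /= li porbit_sym bi => /(_ isT).
Qed.

Lemma closed_connected : n_comp (@closed_glink H) (dart H) = 1.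
Proof.
(* A graph with the closed rotation as [node], introduced to apply [glink_connect_sym] to it. *)
pose K := DiskGraph e (nd * bcyc n)%g (bds H) (@hel H).
have sK : connect_sym (@closed_glink H).
  have E : @closed_glink H =2 @glink K by move=> x y; rewrite /closed_glink /glink /= closed_nodeE.
  by move=> x y; rewrite !(eq_connect E); apply: (@glink_connect_sym K).
have h x : connect (@closed_glink H) x (b 0).
  have /hasP[y yb xy] := cB x.
  apply: (@connect_trans _ _ y).
    move: xy; apply: connect_sub => z t /orP[] /eqP <-; first by apply: connect1; rewrite /closed_glink /= eqxx.
    have [zb|zb] := boolP (z \in bds H); first by rewrite bN // connect0.
    by apply: connect1; rewrite /closed_glink /= /closed_node (negPf zb) eqxx orbT.
  have [i + ->] := bP yb; elim: i => [|i IHi] li; first exact: connect0.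
  apply: connect_trans (IHi (ltnW li)); apply: connect1; rewrite /closed_glink /= closed_nodeE permM.
  by rewrite bN ?bb // bcyc_bd // li eqxx orbT.
rewrite -(n_comp_connect sK (b 0)); apply: eq_n_comp_r => x.
by rewrite !inE sK h.
Qed.

(* There are [#|porbits phi|] components, and the first half-edge of each of them
   but the first causes a merge; Euler's formula says that there is no other. *)
Lemma planarE : planar H = all (fun k => merges k ==> first k) (iota 1 n.-1).
Proof.
rewrite -sub_count_iff; last first.
  by move=> k; rewrite mem_iota add1n prednK //; apply: first_merges.
have := card_first; rewrite -{1}(prednK n0) /= => cf.
have nc := closed_connected.
rewrite /planar nc (fcard_porbits closed_nodeE).
rewrite (@fcard_porbits _ (glued n)); last first.
  by move=> x /=; rewrite closed_nodeE !permM.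
have := card_glued; have := card_closed_node; have := card_porbits_phi fH.
move: cf; move: #|_| #|_| #|_| #|_| (fcard _ _) (count _ _) (count _ _) => s t u v w y z.
by move=> *; apply/eqP/eqP; lia.
Qed.

(* The labels still to come on the face containing [b k.-1]. *)
Definition pend k : seq nat :=
  if k is 0 then [::] else [seq i <- lab (behead (orbit (glued k) (b k.-1))) | k <= i].

Definition cword := [seq if first k then Some (ctree (b k)) else None | k <- iota 0 n].

Let orbit_consE (s : {perm dart H}) x : orbit s x = x :: behead (orbit s x).
Proof. by rewrite /orbit -orderSpred. Qed.

(** No half-edge of the new component is moved by [bcyc k], so its face is still that of the
    forest. *)
Lemma orbit_glued_first k : 0 < k < n -> first k -> orbit (glued k) (b k) = orbit phi (b k).
Proof.
case/andP=> k0 lk fk.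
have E i : iter i (glued k) (b k) = iter i phi (b k).
  elim: i => // i IHi; rewrite !iterS IHi permM; set z := phi _.
  have zk : z \in porbit phi (b k) by rewrite /z -iterS -permX mem_porbit.
  have [zb|zb] := boolP (z \in bds H); last by rewrite bcyc_out // ltnW.
  have [j lj Ez] := bP zb; rewrite Ez bcyc_bd // ?(ltnW lk) //.
  case: ltnP => // ljk; move/allP/(_ j): fk; rewrite mem_iota /= ljk => /(_ isT).
  by rewrite -Ez zk.
have tr i x : traject (glued k) x i = [seq iter j (glued k) x | j <- iota 0 i].
  by elim: i => // i IHi; rewrite -addn1 iotaD map_cat -IHi /= addn1 trajectSr cats1.
have tr' i x : traject phi x i = [seq iter j phi x | j <- iota 0 i].
  by elim: i => // i IHi; rewrite -addn1 iotaD map_cat -IHi /= addn1 trajectSr cats1.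
rewrite /orbit; have -> : order (glued k) (b k) = order phi (b k).
  rewrite -!card_porbit_order; apply: eq_card => x.
  by apply/porbitP/porbitP => -[i ->]; exists i; rewrite !permX E.
by rewrite tr tr'; apply: eq_map.
Qed.

Lemma labP (s : seq (dart H)) j : (j \in lab s) = (j < n) && (b j \in s).
Proof.
apply/mapP/andP => [[x]|[lj bs]].
  by rewrite mem_filter => /andP[xb xs] ->; rewrite index_mem /b nth_index.
by exists (b j); rewrite ?mem_filter ?bb // indexb.
Qed.

Lemma lab_cat (s1 s2 : seq (dart H)) : lab (s1 ++ s2) = lab s1 ++ lab s2.
Proof. by rewrite /lab filter_cat map_cat. Qed.

Lemma lab_cons j (s : seq (dart H)) : j < n -> lab (b j :: s) = j :: lab s.
Proof. by move=> lj; rewrite /lab /= bb //= indexb. Qed.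

Lemma lab_orbit_phi k : k < n -> lab (behead (orbit phi (b k))) = leaves (ctree (b k)).
Proof.
move=> lk; have [|_ -> //] := @orbit_phi_bd H fH (fun _ _ => 0%R) (fun _ => 0%R) _ (bb lk).
by move=> v _; rewrite big1.
Qed.

Lemma leaves_first k : k < n -> first k -> all (fun i => k < i < n) (leaves (ctree (b k))).
Proof.
move=> lk fk; rewrite -lab_orbit_phi //; apply/allP => j; rewrite labP => /andP[lj bj].
rewrite lj andbT ltnNge; apply/negP => ljk.
have := orbit_uniq phi (b k); rewrite orbit_consE /= => /andP[bk _].
move: ljk; rewrite leq_eqVlt => /predU1P[E|ljk]; first by rewrite E in bj; rewrite bj in bk.
move/allP/(_ j): fk; rewrite mem_iota /= ljk porbit_orbit => /(_ isT).
by rewrite mem_behead.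
Qed.

(** The push: the transposition joins the untouched face of the new component to the current face,
    right in front of what was pending. *)
Lemma pend_first k : k < n -> first k -> pend k.+1 = leaves (ctree (b k)) ++ pend k.
Proof.
move=> lk fk; have lv := leaves_first lk fk.
case: k lk fk lv => [|k] lk fk lv.
  rewrite /= gluedS /= tperm1 mulg1 /glued /= mulg1 cats0 lab_orbit_phi //.
  by apply/all_filterP; apply: sub_all lv => i /andP[].
have mk := first_merges (k := k.+1) lk fk; rewrite /merges /= in mk.
rewrite [LHS]/= gluedS [k.+1.-1]/= .
have E1 := orbit_consE (glued k.+1) (b k).
have E2 := orbit_glued_first (k := k.+1) lk fk; rewrite orbit_consE in E2.
have nk : b k.+1 \notin b k :: behead (orbit (glued k.+1) (b k)).
  by rewrite -E1 -porbit_orbit porbit_sym.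
rewrite (orbit_merge E1 (orbit_consE (glued k.+1) (b k.+1)) nk) //=.
rewrite lab_cat lab_cons 1?ltnW // filter_cat; congr (_ ++ _).
  have -> : behead (orbit (glued k.+1) (b k.+1)) = behead (orbit phi (b k.+1)).
    by rewrite orbit_glued_first.
  by rewrite lab_orbit_phi //; apply/all_filterP; apply: sub_all lv => i /andP[].
rewrite /= ltnNge leqnSn /=; apply: eq_in_filter => j; rewrite labP => /andP[lj bj].
rewrite [RHS]leq_eqVlt; case: eqP => // Ej.
by rewrite -Ej in bj; move: nk; rewrite inE bj orbT.
Qed.

(** The pop: the current face is cut at [b k]. The half-edges in [A] are lost to it, so the stack
    discipline demands that [A] carry no pending label. *)
Lemma pend_later k : 0 < k < n -> ~~ merges k ->
  exists A B, [/\ orbit (glued k) (b k.-1) = b k.-1 :: A ++ b k :: B,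
    orbit (glued k.+1) (b k) = b k :: B &
    pend k = [seq i <- lab A | k <= i] ++ k :: pend k.+1].
Proof.
case/andP=> k0 lk; rewrite negbK porbit_sym porbit_orbit orbit_consE inE => /predU1P[/eqP|bk].
  by rewrite bE //; lia.
case/splitPr E: _ / bk => [A B]; exists A, B.
have E1 : orbit (glued k) (b k.-1) = b k.-1 :: A ++ b k :: B by rewrite orbit_consE E.
have E2 := orbit_split E1; rewrite -gluedS in E2; split=> //.
have -> : pend k = [seq i <- lab (behead (orbit (glued k) (b k.-1))) | k <= i] by case: k k0 {lk E E1 E2}.
rewrite E lab_cat lab_cons // filter_cat /= leqnn E2 /=; congr (_ ++ _ :: _).
apply: eq_in_filter => j; rewrite labP => /andP[lj bj].
rewrite leq_eqVlt; case: eqP => // Ej.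
by rewrite -Ej in bj; have := orbit_uniq (glued k.+1) (b k); rewrite E2 /= bj.
Qed.

Lemma pend_n : pend n = [::].
Proof.
rewrite /pend -(prednK n0) prednK //; apply/eqP/negPn; rewrite -has_filter.
apply/hasPn => j; rewrite labP => /andP[lj _]; by rewrite -ltnNge.
Qed.

Lemma drop_cword k : k < n -> 
  drop k cword = (if first k then Some (ctree (b k)) else None) :: drop k.+1 cword.
Proof.
move=> lk; rewrite (drop_nth None) ?size_map ?size_iota // (nth_map 0) ?size_iota // nth_iota //.
Qed.

Lemma planar_run : planar H = run 0 [::] cword.
Proof.
rewrite planarE.
have st k S : k = n -> run k S (drop k cword) = (S == [::]).
  by move=> ->; rewrite drop_oversize // size_map size_iota.
have r1 : run 0 [::] cword = run 1 (pend 1) (drop 1 cword).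
  by rewrite -[cword in LHS]drop0 drop_cword // first0 pend_first.
rewrite {}r1; apply/idP/idP.
  move=> /allP mf.
  (* If only new components merge, no later half-edge of a component already met has been cut off
     from the current face. The induction is on [n - k], going back from [k.+1] to [k]. *)
  have inv k : 0 < k <= n -> forall j, k <= j < n -> 
      (exists2 i, i < k & b j \in porbit phi (b i)) -> b j \in orbit (glued k) (b k.-1).
    have [m] := ubnP (n - k); elim: m k => // m IHm k lm /andP[k0 lk] j /andP[lkj lj] [i lik bij].
    have ltk : k < n by apply: leq_ltn_trans lj.
    have := IHm k.+1; rewrite /= ltk => /(_ _ isT j) IH.
    have [mk|mk] := boolP (merges k).
      have fk : first k by apply: implyP (mf k _) mk; rewrite mem_iota add1n prednK ?k0.
      have nij : b j \notin porbit phi (b k).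
        apply/negP => bjk; move/allP/(_ i): fk; rewrite mem_iota /= lik => /(_ isT).
        by move: bij bjk; rewrite -!eq_porbit_mem => /eqP -> /eqP <-; rewrite eqxx.
      have : b j \in orbit (glued k.+1) (b k).
        apply: IH; first by lia.
          rewrite lj andbT ltn_neqAle lkj andbT; apply: contraNneq nij => ->; exact: porbit_id.
        by exists i => //; apply: leqW.
      have nk : b k \notin b k.-1 :: behead (orbit (glued k) (b k.-1)).
        by rewrite -orbit_consE -porbit_orbit porbit_sym.
      rewrite gluedS (orbit_merge (orbit_consE _ _) (orbit_consE _ _) nk) -!orbit_consE.
      rewrite -cat_cons -orbit_consE mem_cat orbit_glued_first ?k0 //.
      by rewrite -porbit_orbit (negPf nij).
    have [|A [B [E1 E2 _]]] := pend_later _ mk; first by rewrite k0.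
    move: lkj; rewrite leq_eqVlt => /predU1P[<-|lkj]; first by rewrite E1 inE mem_cat mem_head !orbT.
    have : b j \in orbit (glued k.+1) (b k).
      by apply: IH; [lia|rewrite lkj|exists i => //; apply: leqW].
    by rewrite E2 E1 => h; rewrite inE mem_cat h !orbT.
  have gen k : 0 < k <= n -> run k (pend k) (drop k cword).
    have [m] := ubnP (n - k); elim: m k => // m IHm k lm /andP[k0].
    rewrite leq_eqVlt => /predU1P[->|lk]; first by rewrite st // pend_n.
    rewrite drop_cword //; have IH : run k.+1 (pend k.+1) (drop k.+1 cword) by apply: IHm; lia.
    case: ifP => [fk|/negbT nfk] /=; first by rewrite -pend_first.
    have mk : ~~ merges k.
      by apply: contra nfk => mk; apply: implyP (mf k _) mk; rewrite mem_iota add1n prednK ?k0.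
    have [|A [B [E1 E2 E3]]] := pend_later _ mk; first by rewrite k0.
    (* A pending label on [A] would belong to a component already met, so by [inv] it would still be
       on the face at [k.+1], which is disjoint from [A]. *)
    have A0 : [seq i <- lab A | k <= i] = [::].
      apply/eqP/negPn; rewrite -has_filter; apply/hasPn => j; rewrite labP => /andP[lj bj].
      apply/negP => lkj.
      have := orbit_uniq (glued k) (b k.-1); rewrite E1 /= cat_uniq => /and4P[_ _ /hasPn dj _].
      have jk : j != k by apply: contraTneq bj => ->; apply: dj; rewrite mem_head.
      have := inv k.+1 _ j; rewrite /= E2 => /(_ lk); rewrite ltn_neqAle eq_sym jk lkj lj => /(_ isT) h.
      suff : b j \in b k :: B by move/dj; rewrite /= bj.
      apply: h; have [i li bi] : exists2 i, i < k & b j \in porbit phi (b i).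
        by apply: glued_sub; rewrite ?k0 ?(ltnW lk) // porbit_orbit E1 inE mem_cat bj orbT.
      by exists i => //; apply: leqW.
    by rewrite E3 A0 /= eqxx.
  by apply: gen; rewrite n0.
move=> r; apply/allP => k; rewrite mem_iota add1n prednK // => /andP[k0 lk].
have gen j : 0 < j <= k -> run j (pend j) (drop j cword) -> merges k ==> first k.
  have [m] := ubnP (k - j); elim: m j => // m IHm j lm /andP[j0 lj].
  have ljn : j < n by apply: leq_ltn_trans lk.
  rewrite drop_cword //; case: ifP => [fj|nfj] /=.
    move: lj; rewrite leq_eqVlt => /predU1P[<-|lj]; first by rewrite fj implybT.
    by rewrite -pend_first //; apply: IHm; lia.
  case E: (pend j) => [//|i S] /andP[/eqP Ei].
  (* A successful pop means that [j] is pending, so [b j] is on the current face and nothing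
     merges. *)
  have nm : ~~ merges j.
    rewrite negbK porbit_sym porbit_orbit.
    have : j \in pend j by rewrite E Ei mem_head.
    rewrite /pend; case: j {lm lj nfj E Ei} j0 ljn => // j _ ljn.
    by rewrite mem_filter labP => /and3P[_ _ /mem_behead].
  move: lj; rewrite leq_eqVlt => /predU1P[<-|lj]; first by rewrite (negPf nm).
  have [|A [B [E1 E2 E3]]] := pend_later _ nm; first by rewrite j0.
  (* If [A] had a pending label, the first one would be the top of the stack, that is [j]; but [b j]
     comes after [A]. *)
  have A0 : [seq i <- lab A | j <= i] = [::].
    move: E3; rewrite E Ei; case EA: [seq i <- lab A | j <= i] => [//|a A'] /= [Ea _].
    have : j \in [seq i <- lab A | j <= i] by rewrite EA -Ea mem_head.
    rewrite mem_filter labP => /and3P[_ _ bj].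
    have := orbit_uniq (glued j) (b j.-1); rewrite E1 /= cat_uniq => /and4P[_ _ /hasPn dj _].
    by have := dj (b j) (mem_head _ _); rewrite /= bj.
  move: E3; rewrite E A0 Ei /= => -[->]; apply: IHm; lia.
by apply: gen r; rewrite k0.
Qed.

End Planarity.

(** * Words of forests and their statistics *)

Fixpoint unlabel t := match t with Lf _ => Lf 0 | Nd c ts => Nd c (map unlabel ts) end.

(** A vertex with [m > 0] children has helicity 1 if white and [m] if black; the surplus of the
    black ones is added up. *)
Fixpoint excess t :=
  match t with Lf _ => 0 | Nd c ts => (if c then (size ts).-1 else 0) + sumn (map excess ts) end.
(* The black lollipop has helicity 0 and degree 1, so that its excess
   [deg - 2] is -1, which the truncated [excess] misses. *)
Definition khel t := if t is Nd true [::] then 0 else (excess t).+1.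
Definition nleaves t := size (leaves t).

Definition wleaves (w : seq (option ptree)) := \sum_(o <- w) if o is Some t then nleaves t else 0.
Definition whel (w : seq (option ptree)) := \sum_(o <- w) if o is Some t then khel t else 0.
Definition wtrees (w : seq (option ptree)) := count isSome w.

Fixpoint hrun h (w : seq (option ptree)) : bool :=
  match w with
  | [::] => h == 0
  | Some t :: w' => hrun (nleaves t + h) w'
  | None :: w' => if h is h'.+1 then hrun h' w' else false
  end.

Definition wunlabel := map (omap unlabel).

Lemma nleaves_unlabel t : nleaves (unlabel t) = nleaves t.
Proof.
rewrite /nleaves; elim: t => //= c ts; elim: ts => //= t ts IHts IH.
rewrite !size_cat IH ?mem_head //; congr (_ + _); apply: IHts => u uts.
by apply: IH; rewrite inE uts orbT.
Qed.

Lemma unlabel_leaves_inj t t' : unlabel t = unlabel t' -> leaves t = leaves t' -> t = t'.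
Proof.
elim: t t' => [i|c ts IH] [j|c' ts'] //=; first by move=> _ [->].
case=> <- Es El; congr (Nd _ _); elim: ts ts' IH Es El => [|t ts IHts] [|t' ts'] //= IH [E1 E2] El.
have sz : size (leaves t) = size (leaves t').
  by have := congr1 nleaves E1; rewrite !nleaves_unlabel.
move/eqP: El; rewrite eqseq_cat // => /andP[/eqP El1 /eqP El2].
rewrite (IH t (mem_head _ _) t') //; congr (_ :: _); apply: IHts => // u uts.
by apply: IH; rewrite inE uts orbT.
Qed.

Lemma relabel t s : size s = nleaves t -> exists2 t', unlabel t' = unlabel t & leaves t' = s.
Proof.
rewrite /nleaves; elim: t s => [i|c ts IH] s /=.
  by case: s => [|j []] // _; exists (Lf j).
move=> sz; suff [ts' E1 E2] : exists2 ts', map unlabel ts' = map unlabel ts & flatten (map leaves ts') = s.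
  by exists (Nd c ts'); rewrite /= ?E1.
elim: ts s IH sz => [|t ts IHts] s IH /=; first by case: s => // _; exists [::].
rewrite size_cat => sz.
have [|t' E1 E2] := IH t (mem_head _ _) (take (nleaves t) s).
  by rewrite size_takel // sz leq_addr.
have [u uts||ts' E3 E4] := IHts (drop (nleaves t) s).
- by apply: IH; rewrite inE uts orbT.
- by rewrite size_drop sz addKn.
by exists (t' :: ts') => /=; rewrite ?E1 ?E3 // E2 E4 cat_take_drop.
Qed.

Lemma run_hrun k S w : run k S w -> hrun (size S) (wunlabel w).
Proof.
elim: w k S => [|[t|] w IHw] k S /=; first by move/eqP->.
  by move/IHw; rewrite size_cat nleaves_unlabel.
by case: S => // i S /andP[_ /IHw].
Qed.

(** The labels are recovered backwards: the stack is empty at the end, a pop at position [k] must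
    have removed [k], and a push had put on top as many labels as its tree has leaves. *)
Lemma run_inj k S S' w w' : wunlabel w = wunlabel w' -> run k S w -> run k S' w' -> S = S' /\ w = w'.
Proof.
elim: w w' k S S' => [|o w IHw] [|o' w'] //= k S S'; first by move=> _ /eqP-> /eqP->.
case: o o' => [t|] [t'|] //= [].
  move=> Et Ew r r'; have [] := IHw _ _ _ _ Ew r r'.
  have sz : size (leaves t) = size (leaves t').
    by have := congr1 nleaves Et; rewrite !nleaves_unlabel.
  move/eqP; rewrite eqseq_cat // => /andP[/eqP El /eqP ->] ->.
  by rewrite (unlabel_leaves_inj Et El).
move=> Ew; case: S => // i S /andP[/eqP -> r]; case: S' => // i' S' /andP[/eqP -> r'].
by have [-> ->] := IHw _ _ _ _ Ew r r'.
Qed.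

(** The backward reading behind [run_inj], now used to construct the labels. *)
Lemma hrun_fill h w k : hrun h w -> exists S w', [/\ size S = h, wunlabel w' = wunlabel w & run k S w'].
Proof.
elim: w h k => [|[t|] w IHw] h k /=.
- by move/eqP->; exists [::], [::].
- case/(IHw _ k.+1) => S [w' [sz Ew r]].
  have [|t' Et El] := @relabel t (take (nleaves t) S); first by rewrite size_takel // sz leq_addr.
  exists (drop (nleaves t) S), (Some t' :: w'); split.
  - by rewrite size_drop sz addKn.
  - by rewrite /= Et Ew.
  by rewrite /= El cat_take_drop.
case: h => // h /(IHw _ k.+1)[S [w' [sz Ew r]]].
by exists (k :: S), (None :: w'); rewrite /= sz Ew eqxx.
Qed.

Lemma hrun_size h w : hrun h w -> size w = h + wleaves w + wtrees w.
Proof.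
rewrite /wleaves /wtrees; elim: w h => [|[t|] w IHw] h /=; rewrite ?big_nil ?big_cons.
- by move/eqP->.
- by move/IHw->; lia.
by case: h => // h /IHw->; lia.
Qed.

Lemma wunlabel_leaves w : wleaves (wunlabel w) = wleaves w.
Proof. by rewrite /wleaves big_map; apply: eq_bigr => -[t|] //= _; rewrite nleaves_unlabel. Qed.

Lemma excess_unlabel t : excess (unlabel t) = excess t.
Proof.
elim: t => //= c ts IH; rewrite size_map -map_comp; congr (_ + sumn _).
by apply/eq_in_map => t /IH.
Qed.

Lemma khel_unlabel t : khel (unlabel t) = khel t.
Proof. by rewrite /khel -(excess_unlabel t); case: t => // -[] // []. Qed.

Lemma wunlabel_hel w : whel (wunlabel w) = whel w.
Proof. by rewrite /whel big_map; apply: eq_bigr => -[t|] //= _; rewrite khel_unlabel. Qed.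

Lemma wunlabel_trees w : wtrees (wunlabel w) = wtrees w.
Proof. by rewrite /wtrees count_map; apply: eq_count => -[]. Qed.

Local Open Scope ring_scope.

(** Euler's relation for trees: a vertex with [m] children replaces one leaf by [m]. It makes the
    dimension depend on the leaves only. *)
Lemma wsum_leaves t : wsum (fun _ m => m%:R - 1) t = (nleaves t)%:R - 1.
Proof.
rewrite /nleaves; elim: t => [i|c ts IH] /=; first by rewrite subrr.
rewrite addrAC; congr (_ - 1); elim: ts IH => [|t ts IHts] IH /=; first by rewrite big_nil addr0.
rewrite big_cons IH ?mem_head // size_cat natrD -IHts; last by move=> u uts; apply: IH; rewrite inE uts orbT.
by rewrite -natr1; ring.
Qed.

Lemma wsum_excess c t : wf c t -> wsum (fun c m => if c then m%:R - 1 else 0) t = (excess t)%:R.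
Proof.
elim: t c => [i|c ts IH] c' //= /and3P[_ sz al].
rewrite natrD; congr (_ + _); first by case: c {al}; case: ts sz {IH} => //= t ts _; rewrite -natr1 addrK.
elim: ts al IH {sz} => [|t ts IHts] /=; first by rewrite big_nil.
move=> /andP[wt al] IH; rewrite big_cons natrD (IH t (mem_head _ _) c) // IHts // => u uts.
by apply: IH; rewrite inE uts orbT.
Qed.

Lemma wsum_khel t : wf_root t -> 1 + wsum (fun c m => if c then m%:R - 1 else 0) t = (khel t)%:R.
Proof.
case: t => [i|c ts] /=; first by rewrite addr0.
case: ts => [_|t ts /andP[sz al]]; first by case: c; rewrite /= big_nil; ring.
(* Hung below a vertex of the opposite colour, the root vertex satisfies [wf]. *)
have w : wf (~~ c) (Nd c (t :: ts)).
  by apply/and3P; split=> //; [case: (c)|move: sz => /=; case: (size ts)].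
rewrite -[RHS]/((khel (Nd c (t :: ts)))%:R).
have -> : khel (Nd c (t :: ts)) = (excess (Nd c (t :: ts))).+1 by case: (c).
by rewrite -[X in 1 + X]/(wsum _ (Nd c (t :: ts))) (wsum_excess w) -natr1 addrC.
Qed.

Section Numbers.
Variable H : disk_graph.
Implicit Types (d x y c : dart H).
Local Notation nd := (node H).
Hypothesis fH : prePlanar H.
Local Notation phi := (phi H).

Let bU : uniq (bds H). Proof. by case: fH => -[]. Qed.
Let cB d : has (connect (@glink H) d) (bds H). Proof. by case: fH => -[]. Qed.

(** A form of [first] without a default half-edge, which the empty graph does not have. *)
Definition isfirst d := all (fun c => c \notin porbit phi d) (take (index d (bds H)) (bds H)).
Definition hword : seq (option ptree) :=
  [seq if isfirst d then Some (ctree d) else None | d <- bds H].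

Lemma hwordE x0 : hword = cword x0.
Proof.
have E := map_nth_iota0 x0 (leqnn (size (bds H))); rewrite take_size in E.
rewrite /hword /cword -[X in map _ X = _]E -map_comp.
apply/eq_in_map => k; rewrite mem_iota add0n => /= lk.
congr (if _ then _ else _); rewrite /isfirst index_uniq // /first.
by rewrite -(map_nth_iota0 x0 (ltnW lk)) all_map.
Qed.

Lemma planar_hword : planar H = run 0 [::] hword.
Proof.
case Eb: (bds H) => [|x0 s]; last by rewrite (hwordE x0) (planar_run fH x0).
(* Every half-edge is connected to the boundary, so an empty boundary leaves the empty graph. *)
rewrite /hword Eb /=; have nod (d : dart H) : False by have := cB d; rewrite Eb.
by rewrite /planar /n_comp_mem !eq_card0 // => x; case: (nod x).
Qed.

Lemma sum_porbits (V : nmodType) (G : {set dart H} -> V) :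
  \sum_(P in porbits phi) G P = \sum_(d <- bds H | isfirst d) G (porbit phi d).
Proof.
pose A := [set d in bds H | isfirst d].
have -> : porbits phi = [set porbit phi d | d in A].
  apply/setP => P; apply/imsetP/imsetP => [[x _ ->]|[x _ ->]]; last by exists x.
  have /hasP[y yb] := cB x; rewrite (connect_phi fH) => yx.
  pose s := [seq d <- bds H | d \in porbit phi x].
  have ys : y \in s by rewrite mem_filter yx.
  pose z := nth y (bds H) (find (mem (porbit phi x)) (bds H)).
  have hz : has (mem (porbit phi x)) (bds H) by apply/hasP; exists y.
  have zx : z \in porbit phi x by have := nth_find y hz.
  have Ez : porbit phi x = porbit phi z by apply/esym/eqP; rewrite eq_porbit_mem.
  exists z => //; rewrite inE /isfirst index_uniq -?has_find //.
  rewrite mem_nth -?has_find //=; apply/allP => c cz; rewrite -Ez.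
  have lc : (index c (bds H) < find (mem (porbit phi x)) (bds H))%N by apply: index_ltn.
  have cb := mem_take cz.
  by have := before_find y lc; rewrite nth_index // => /negbT.
rewrite big_imset /=; last first.
  move=> c d; rewrite !inE => /andP[cb fc] /andP[db fd] /eqP; rewrite eq_porbit_mem => cd.
  case: (ltngtP (index c (bds H)) (index d (bds H))) => [lt|lt|]; last exact: index_inj.
    by move/allP/(_ c): fd; rewrite in_take // lt porbit_sym -eq_porbit_mem eq_sym eq_porbit_mem cd => /(_ isT).
  by move/allP/(_ d): fc; rewrite in_take // lt porbit_sym cd => /(_ isT).
rewrite [RHS]big_mkcond /= big_uniq // -big_mkcondr.
by apply: eq_bigl => d; rewrite inE.
Qed.

(** The walks of [traverse] sum over half-edges, so the value of a vertex is shared equally among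
    its own. *)
Let vfE (F : {set dart H} -> rat) (v : {set dart H}) : v \in internal H ->
  \sum_(x in v) F (vertex x) / (deg (vertex x))%:R = F v.
Proof.
case/(internalP fH) => d db ->.
have -> : \sum_(x in vertex d) F (vertex x) / (deg (vertex x))%:R =
    \sum_(x in vertex d) F (vertex d) / (deg (vertex d))%:R.
  by apply: eq_bigr => x; rewrite vertexE => /eqP ->.
rewrite sumr_const -[LHS]mulr_natr /deg divfK // pnatr_eq0 -lt0n.
by apply/card_gt0P; exists d; apply: vertex_refl.
Qed.

Lemma sum_internal_in (F : {set dart H} -> rat) (C : {set dart H}) : (forall x, x \in C -> nd x \in C) ->
  \sum_(v in internal H | v \subset C) F v =
  \sum_(x in C | x \notin bds H) F (vertex x) / (deg (vertex x))%:R.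
Proof.
move=> Cn; have vC x : x \in C -> vertex x \subset C.
  move=> xC; apply/subsetP => y /porbitP[i ->]; rewrite permX.
  by elim: i => // i IHi; apply: Cn.
rewrite [RHS](partition_big (@vertex H) [pred v | (v \in internal H) && (v \subset C)]) /=; last first.
  by move=> x /andP[xC xb]; rewrite internalE // xb vC.
apply: eq_bigr => v /andP[vi vs]; rewrite -[LHS](vfE F vi); apply: eq_bigl => x.
have [d db Ev] := internalP fH vi; rewrite Ev vertexE.
case: eqP => E; rewrite ?andbF // andbT.
rewrite Ev -E in vs; rewrite (subsetP vs) ?vertex_refl //=.
have : x \in vertex d by rewrite vertexE E.
by move/(mem_vertex_bd fH) ->; rewrite db.
Qed.

Lemma sum_internal_porbit (g : bool -> nat -> rat) (F : {set dart H} -> rat) d :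
  (forall v, v \in internal H -> F v = g (~~ white v) (deg v).-1) -> d \in bds H ->
  \sum_(v in internal H | v \subset porbit phi d) F v = wsum g (ctree d).
Proof.
move=> Fg db.
rewrite sum_internal_in; last first.
  move=> x; rewrite -!(connect_phi fH) => dx; apply: connect_trans dx _.
  by apply: connect1; rewrite /glink /= eqxx orbT.
have [|_ _ //] := @orbit_phi_bd H fH g (fun x => F (vertex x) / (deg (vertex x))%:R) d db.
by move=> v vi; rewrite vfE // Fg.
Qed.

Lemma sum_internal (g : bool -> nat -> rat) (F : {set dart H} -> rat) :
  (forall v, v \in internal H -> F v = g (~~ white v) (deg v).-1) ->
  \sum_(v in internal H) F v = \sum_(d <- bds H | isfirst d) wsum g (ctree d).
Proof.
move=> Fg.
transitivity (\sum_(v in internal H | v \subset [set: dart H]) F v).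
  by apply: eq_bigl => v; rewrite subsetT andbT.
rewrite sum_internal_in; last by move=> x; rewrite !inE.
rewrite (partition_big (porbit phi) (mem (porbits phi))) /=; last by move=> x _; apply: imset_f.
rewrite sum_porbits big_seq_cond [RHS]big_seq_cond; apply: eq_bigr => d /andP[db _].
rewrite -(sum_internal_porbit Fg db) sum_internal_in; last first.
  move=> x; rewrite -!(connect_phi fH) => dx; apply: connect_trans dx _.
  by apply: connect1; rewrite /glink /= eqxx orbT.
by apply: eq_bigl => x; rewrite inE eq_porbit_mem andbC.
Qed.

Lemma hel_internal v : v \in internal H -> hel v = if white v then 1 else (deg v)%:Z - 1.
Proof. by have [_ hv _ _] := fH; case/hv => _ _; apply: nongeneric_hel. Qed.

Lemma deg_gt0 v : v \in internal H -> (0 < deg v)%N.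
Proof. by case/(internalP fH) => d _ ->; apply/card_gt0P; exists d; apply: vertex_refl. Qed.

Lemma count_orbit d : d \in bds H -> 
  count [in porbit phi d] (bds H) = (nleaves (ctree d)).+1.
Proof.
move=> db; have [|E1 E2 _] := @orbit_phi_bd H fH (fun _ _ => 0%R) (fun _ => 0%R) _ db.
  by move=> v _; rewrite big1.
rewrite /nleaves -E2 /lab size_map.
have E : orbit phi d = d :: behead (orbit phi d) by rewrite /orbit -orderSpred.
have u := orbit_uniq phi d.
transitivity (size [seq x <- orbit phi d | x \in bds H]); last by rewrite E /= db.
rewrite -size_filter; apply: perm_size; apply: uniq_perm; rewrite ?filter_uniq // => x.
by rewrite !mem_filter porbit_orbit andbC.
Qed.

Hypothesis pH : planar H.

Lemma hword_hrun : hrun 0 (wunlabel hword).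
Proof. by apply: (@run_hrun 0 [::]); rewrite -planar_hword. Qed.

Lemma size_hword : size hword = nbd H. Proof. exact: size_map. Qed.

Lemma hword_nbd : nbd H = (wleaves hword + wtrees hword)%N.
Proof.
by rewrite -size_hword; have := hrun_size hword_hrun; rewrite size_map wunlabel_leaves wunlabel_trees.
Qed.

Let sum_first (G : ptree -> nat) : (\sum_(o <- hword) (if o is Some t then G t else 0) = 
  \sum_(d <- bds H | isfirst d) G (ctree d))%N.
Proof.
rewrite /hword big_map big_mkcond /= [RHS]big_mkcond; apply: eq_bigr => d _.
by case: (isfirst d).
Qed.

Lemma helicityE : helicity H = (whel hword)%:R.
Proof.
(* This is h(v) - deg(v)/2 for [m] children. By [wsum_leaves] the halves add up to -(l-1)/2 in a
   component with l leaves, and its l+1 boundary vertices turn this into the 1 included in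
   [khel]. *)
pose g (c : bool) m : rat := (if c then m%:R - 1 else 0) - (m%:R - 1) / 2.
rewrite /helicity (@sum_internal g); last first.
  move=> v vi; have d0 := deg_gt0 vi; rewrite hel_internal // /g.
  rewrite -(prednK d0) /=; move: (deg v).-1 => m; case: (white v) => /=; rewrite -natr1; first by field.
  by rewrite rmorphB /= rmorph1 -natr1; field.
have wg t : wsum g t = wsum (fun w m => if w then m%:R - 1 else 0) t - wsum (fun _ m => m%:R - 1) t / 2.
  elim: t => [i|c ts IH] /=; first by rewrite mul0r subr0.
  suff -> : \sum_(x <- [seq wsum g i | i <- ts]) x = 
     \sum_(x <- [seq wsum (fun w m => if w then m%:R - 1 else 0) i | i <- ts]) x -
     (\sum_(x <- [seq wsum (fun _ m => m%:R - 1) i | i <- ts]) x) / 2.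
    by rewrite /g /=; set A := \sum_(_ <- _) _; set B := \sum_(_ <- _) _; case: c; field.
  rewrite !big_map mulr_suml -sumrB big_seq [RHS]big_seq; apply: eq_bigr => t /IH //.
rewrite hword_nbd /whel sum_first natrD /wleaves sum_first.
have -> : (wtrees hword = \sum_(d <- bds H | isfirst d) 1)%N.
  by rewrite sum1_count /wtrees /hword count_map; apply: eq_count => d /=; case: (isfirst d).
rewrite -natrD -big_split /= !natr_sum mulr_suml -big_split /=; apply: eq_bigr => d _.
have /andP[wr _] := ctree_wf fH d.
by rewrite -wsum_khel // wg wsum_leaves natrD; field.
Qed.

(** A component with l leaves has l+1 boundary vertices and dimension l, in the exceptional case n
    <= 2 as well as in the general one, where [wsum_leaves] applies. *)
Lemma mdimE : mdim H = (wleaves hword)%:Z.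
Proof.
rewrite /mdim componentsE // sum_porbits /wleaves sum_first -[RHS]natz natr_sum.
rewrite big_seq_cond [RHS]big_seq_cond; apply: eq_bigr => d /andP[db _].
rewrite /mdim_component count_orbit //.
case: ifP => _; first by rewrite natz -addn1 PoszD addrK.
apply: (@intr_inj rat); rewrite rmorphD /= rmorph1 rmorph_sum /=.
rewrite (@sum_internal_porbit (fun _ m => m%:R - 1) (fun v => (mdim_vertex v - 1)%:~R)) //.
  by rewrite wsum_leaves subrKC natz.
move=> v vi; have [_ hv _ _] := fH; have [_ _ ng] := hv _ vi.
by rewrite /mdim_vertex (negPf ng) -(prednK (deg_gt0 vi)) /= -addn1 PoszD addrK rmorphB.
Qed.

Lemma connectedE : connected H = (wtrees hword == 1%N).
Proof.
rewrite /connected componentsE //.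
have := @sum_porbits nat (fun _ => 1%N); rewrite sum1_card => ->.
congr (_ == _); rewrite [LHS](_ : _ = \sum_(d <- bds H | isfirst d) 1)%N // sum1_count.
by rewrite /wtrees /hword count_map; apply: eq_count => d /=; case: (isfirst d).
Qed.

Lemma hword_wf : all (fun o => if o is Some t then wf_root t else true) hword.
Proof.
rewrite /hword all_map; apply/allP => d _ /=; case: (isfirst d) => //.
by case/andP: (ctree_wf fH d).
Qed.

End Numbers.

Local Open Scope nat_scope.

Lemma contracted_plabic_forestP H : contracted_plabic_forest H <-> prePlanar H /\ planar H.
Proof.
split.
  case=> /andP[/andP[/and5P[/forallP eH uH /allP bH /forallP cH pH] /forall_inP hv] /forall_inP hg] ac co.
  split=> //; split=> //; last by move=> v vi; have /andP[? ?] := hv v vi; split=> //; apply: hg.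
  split=> //; [by move=> d; apply/eqP; case/andP: (eH d)|by move=> d; case/andP: (eH d)|].
  by move=> d /bH /eqP.
case=> -[[eI eN bU bN cB] hv ac co] pH; split=> //; apply/andP; split; last first.
  by apply/forall_inP => v /hv[].
apply/andP; split; last by apply/forall_inP => v /hv[-> ->].
apply/and5P; split=> //; first by apply/forallP => d; rewrite eN eI eqxx.
  by apply/allP => d /bN ->.
exact/forallP.
Qed.

Lemma first_in_component H (d : dart H) : prePlanar H -> exists b, 
  [/\ b \in bds H, isfirst b & b \in porbit (phi H) d].
Proof.
move=> fH; have [[_ _ _ _ cB] _ _ _] := fH.
have /hasP[y yb] := cB d; rewrite (connect_phi fH) => yd.
pose P := mem (porbit (phi H) d).
have hz : has P (bds H) by apply/hasP; exists y.
pose z := nth y (bds H) (find P (bds H)).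
have zd : z \in porbit (phi H) d by have := nth_find y hz.
have lz : find P (bds H) < size (bds H) by rewrite -has_find.
have [[_ _ bU _ _] _ _ _] := fH.
exists z; split=> //; first by rewrite mem_nth.
rewrite /isfirst index_uniq //; apply/allP => c cz.
have Ez : porbit (phi H) d = porbit (phi H) z by apply/esym/eqP; rewrite eq_porbit_mem.
rewrite -Ez; have lc : index c (bds H) < find P (bds H) by apply: index_ltn.
by have := before_find y lc; rewrite nth_index ?(mem_take cz) // => /negbT.
Qed.

(** By [run_inj] planarity restores the erased labels; equal labelled words then supply the equal
    codes that [isotopicP] asks for. *)
Lemma same_word_isotopic H K : prePlanar H -> prePlanar K -> planar H -> planar K ->
  wunlabel (hword H) = wunlabel (hword K) -> isotopic H K.
Proof.
move=> fH fK pH pK Ew.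
have [_ {}Ew] : [::] = [::] :> seq nat /\ hword H = hword K.
  by apply: (run_inj (k := 0) Ew); rewrite -planar_hword.
have sz : size (bds H) = size (bds K) by have := congr1 size Ew; rewrite !size_map.
have gen (H' K' : disk_graph) (fH' : prePlanar H') (fK' : prePlanar K') (E : hword H' = hword K') d :
  exists i, [/\ i < size (bds H'), connect (@glink H') d (nth d (bds H') i) &
     forall d', exists t, code_is (nth d (bds H') i) t /\ code_is (nth d' (bds K') i) t].
  have sz' : size (bds H') = size (bds K') by have := congr1 size E; rewrite !size_map.
  have [b [bb fb bd]] := first_in_component d fH'.
  exists (index b (bds H')); rewrite index_mem nth_index //; split=> //; first by rewrite (connect_phi fH').
  move=> d'; exists (ctree b); split; first exact: code_is_ctree.
  have li : index b (bds H') < size (bds H') by rewrite index_mem.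
  have := congr1 (fun s => nth None s (index b (bds H'))) E.
  rewrite /hword (nth_map b) // (nth_map d') -?sz' // nth_index // fb.
  by case: ifP => // _ [->]; apply: code_is_ctree.
apply: isotopicP => //.
- by have [_ /(_ (conj fH pH)) []] := contracted_plabic_forestP H.
- by have [_ /(_ (conj fK pK)) []] := contracted_plabic_forestP K.
- by move=> d; apply: gen.
move=> d; have [i [li ci hi]] := gen K H fK fH (esym Ew) d.
exists i; rewrite sz; split=> // d'; have [t [h1 h2]] := hi d'; by exists t.
Qed.

Lemma isotopic_hword H K : prePlanar H -> prePlanar K -> isotopic H K -> hword H = hword K.
Proof.
move=> fH fK [f [fbij fe fn fb fh]]; have fI := bij_inj fbij.
have [[_ _ _ bH _] _ _ _] := fH.
rewrite /hword -fb -map_comp; apply: eq_map => d /=; congr (if _ then Some _ else None).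
  rewrite /isfirst -fb index_map // -map_take all_map; apply: eq_all => c /=; congr (~~ _).
  have E i : iter i (phi K) (f d) = f (iter i (phi H) d).
    by elim: i => //= i ->; rewrite !phiE fn fe.
  apply/porbitP/porbitP => -[i Ei]; exists i; rewrite permX; rewrite permX in Ei; first by rewrite E -Ei.
  by apply: fI; rewrite Ei E.
have h := isotopic_code fI fe fn fb fh bH.
set N := maxn #|side d| #|side (f d)|.
by rewrite -(code_stable fH (leq_maxl _ _ : _ <= N)) -(code_stable fK (leq_maxr _ _ : _ <= N)) h.
Qed.

(** * Realizing words by graphs *)

Fixpoint subtrees t : seq ptree :=
  t :: (if t is Nd _ ts then flatten (map subtrees ts) else [::]).

Fixpoint nnodes t : nat := if t is Nd _ ts then (sumn (map nnodes ts)).+1 else 0.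

(* [(i, u, b)] names the two half-edges of the edge above the subtree [u] of the
   component rooted at the boundary position [i]; it points towards [u] when [b]
   is false. *)
Definition dname := (nat * ptree * bool)%type.

(** The face of the component, in the order in which [phi] has to visit it. The graph is built from
    its faces, and its rotation is recovered from them as [nphi \o flip]. *)
Fixpoint contour i t : seq dname :=
  (i, t, false) :: (if t is Nd _ ts then flatten (map (contour i) ts) else [::]) ++ [:: (i, t, true)].

Lemma subtrees_refl t : t \in subtrees t.
Proof. by case: t => * /=; rewrite mem_head. Qed.

Lemma mem_subtrees c ts u : u \in subtrees (Nd c ts) -> u = Nd c ts \/ exists2 t, t \in ts & u \in subtrees t.
Proof.
rewrite /= inE => /predU1P[->|/flattenP[s /mapP[t tts ->] us]]; first by left.
by right; exists t.
Qed.

Lemma child_subtrees c ts t u : t \in ts -> u \in subtrees t -> u \in subtrees (Nd c ts).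
Proof.
move=> tts ut; rewrite /= inE; apply/orP; right; apply/flattenP; exists (subtrees t) => //; exact: map_f.
Qed.

Lemma subtrees_trans t u v : u \in subtrees t -> v \in subtrees u -> v \in subtrees t.
Proof.
elim: t => [i|c ts IH]; first by rewrite inE => /eqP ->.
case/mem_subtrees=> [-> //|[t tts ut]] vu; exact: (child_subtrees _ tts (IH t tts ut vu)).
Qed.

Lemma nnodes_child c ts t : t \in ts -> nnodes t < nnodes (Nd c ts).
Proof. 
rewrite /= ltnS; elim: ts => //= u ts IHts; rewrite inE => /predU1P[->|/IHts h]; first exact: leq_addr.
by apply: leq_trans h _; apply: leq_addl.
Qed.

Lemma nnodes_subtrees t u : u \in subtrees t -> u = t \/ nnodes u < nnodes t.
Proof.
elim: t => [i|c ts IH]; first by rewrite inE => /eqP ->; left.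
case/mem_subtrees=> [-> |[t tts ut]]; [by left|right].
by case: (IH t tts ut) => [->|h]; [|apply: ltn_trans h _]; apply: nnodes_child.
Qed.

Lemma mem_contour i t x : (x \in contour i t) = (x.1.1 == i) && (x.1.2 \in subtrees t).
Proof.
case: x => [[j u] b]; elim: t => [l|c ts IH] /=.
  by rewrite !inE !xpair_eqE; case: b; rewrite ?andbT ?andbF ?orbF.
rewrite inE mem_cat !inE !xpair_eqE /=.
have -> : ((j, u, b) \in flatten [seq contour i j0 | j0 <- ts]) =
   (j == i) && (u \in flatten [seq subtrees i | i <- ts]).
  apply/flattenP/andP => [[s /mapP[t tts ->]]|[ji /flattenP[s /mapP[t tts ->] ut]]].
    rewrite IH //= => /andP[-> ut]; split=> //; apply/flattenP; exists (subtrees t) => //; exact: map_f.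
  exists (contour i t); first exact: map_f.
  by rewrite IH //= ji.
by clear IH; case: (j == i) => //; rewrite ?andbF //=; case: b; case: (u == _); rewrite ?orbT ?orbF.
Qed.

Lemma leaves_subtrees t u : u \in subtrees t -> {subset leaves u <= leaves t}.
Proof.
elim: t => [i|c ts IH]; first by rewrite inE => /eqP ->.
case/mem_subtrees=> [-> //|[t tts ut]] l lu; apply/flattenP; exists (leaves t); first exact: map_f.
exact: (IH t tts ut).
Qed.

Lemma Lf_subtrees t l : (Lf l \in subtrees t) = (l \in leaves t).
Proof.
apply/idP/idP => [/leaves_subtrees|]; first by apply; rewrite inE.
elim: t => [i|c ts IH] /=; first by rewrite !inE => /eqP ->.
case/flattenP => s /mapP[t tts ->] /(IH t tts) h; exact: (child_subtrees _ tts h).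
Qed.

Lemma wf_leaves c t : wf c t -> 0 < nleaves t.
Proof.
elim: t c => [//|c ts IH] c' /= /and3P[_]; case: ts IH => // t ts IH _ /= /andP[wt _].
rewrite /nleaves /= size_cat; apply: leq_trans (leq_addr _ _); exact: (IH t (mem_head _ _) c wt).
Qed.

Lemma wf_subtrees c t u : wf c t -> u \in subtrees t -> exists c', wf c' u.
Proof.
elim: t c => [i|c ts IH] c'; first by move=> _; rewrite inE => /eqP ->; exists true.
move=> w; case/mem_subtrees=> [->|[t tts ut]]; first by exists c'.
case/and3P: w => _ _ /allP /(_ t tts) wt; exact: (IH t tts c wt ut).
Qed.

Lemma wf_wf_root c t : wf c t -> wf_root t.
Proof. by case: t => //= c' ts /and3P[_ h ->]; rewrite andbT; case: (size ts) h => [|[]]. Qed.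

Lemma wf_root_child c ts t : wf_root (Nd c ts) -> t \in ts -> wf c t.
Proof. by move=> /= /andP[_ /allP]; apply. Qed.

Lemma wf_root_subtrees t u : wf_root t -> u \in subtrees t -> wf_root u.
Proof.
case: t => [i|c ts] w; first by rewrite inE => /eqP ->.
case/mem_subtrees=> [-> //|[t tts ut]].
by have [c' wu] := wf_subtrees (wf_root_child w tts) ut; apply: wf_wf_root wu.
Qed.

(** Names are unambiguous: a proper subtree has a leaf, so a subtree occurring at two places would
    repeat a label, and a tree differs from what is below it by [nnodes]. *)
Lemma uniq_contour i t : wf_root t -> uniq (leaves t) -> uniq (contour i t).
Proof.
elim: t => [l|c ts IH] w u /=; first by rewrite inE xpair_eqE andbF.
have nin b : (i, Nd c ts, b) \notin flatten [seq contour i j | j <- ts].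
  apply/negP => /flattenP[s /mapP[t tts ->]]; rewrite mem_contour /= => /andP[_ h].
  by have := nnodes_child c tts; case: (nnodes_subtrees h) => [->|]; lia.
rewrite mem_cat inE xpair_eqE andbF orbF nin cat_uniq /= orbF nin /= andbT.
move: w u => /= /andP[_ al]; have {}IH : {in ts, forall t, uniq (leaves t) -> uniq (contour i t)}.
  by move=> t tts; apply: IH => //; apply: wf_wf_root (allP al _ tts).
elim: ts al IH {nin} => //= t ts IHts /andP[wt al] IH.
rewrite !cat_uniq => /and3P[u1 /hasPn dj u2].
rewrite IH ?mem_head //=; apply/andP; split; last first.
  by apply: IHts => // s sts; apply: IH; rewrite inE sts orbT.
apply/hasPn => -[[j v] b] /flattenP[s /mapP[r rts ->]]; rewrite !mem_contour /= => /andP[_ vr].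
apply/negP => /andP[_ vt].
have [c' wv] := wf_subtrees wt vt; have := wf_leaves wv.
rewrite /nleaves; case E: (leaves v) => [//|l ls] _.
have lv : l \in leaves v by rewrite E mem_head.
have := dj l; rewrite (leaves_subtrees vt lv) => h; suff : false by []; apply: h.
by apply/flattenP; exists (leaves r); [exact: map_f|exact: (leaves_subtrees vr)].
Qed.

Section NextL.
Variable T : eqType.
Implicit Types (LL : seq (seq T)) (s : seq T) (x : T).

(** Outside [s] the function [next s] is the identity, so for disjoint cycles this is their product,
    defined on the whole type. *)
Definition nextL LL x := foldr (fun s y => next s y) x LL.

Lemma nextL_inj LL : uniq (flatten LL) -> injective (nextL LL).
Proof.
elim: LL => [|s LL IH] /=; first by move=> _ x y.
rewrite cat_uniq => /and3P[us _ /IH i] x y /(can_inj (prev_next us)); exact: i.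
Qed.

Lemma nextL_mem LL s x : uniq (flatten LL) -> s \in LL -> x \in s -> nextL LL x = next s x.
Proof.
elim: LL => //= s' LL IH; rewrite cat_uniq => /and3P[us /hasPn dj u]; rewrite inE.
have nx p y : y \notin p -> next p y = y by rewrite next_nth => /negPf ->.
have idL M y : y \notin flatten M -> nextL M y = y.
  elim: M => //= p M IHM; rewrite mem_cat negb_or => /andP[yp /IHM ->]; exact: nx.
case/predU1P=> [->|sLL] xs.
  rewrite idL //; apply/negP => /dj /=; by rewrite xs.
rewrite IH // nx //; apply: dj; apply/flattenP; exists s; rewrite ?mem_next //.
Qed.

Lemma nextL_cycle LL s : uniq (flatten LL) -> s \in LL -> fcycle (nextL LL) s.
Proof.
move=> u sLL; have us : uniq s.
  elim: LL u sLL => //= s' LL IH; rewrite cat_uniq => /and3P[us _ u]; rewrite inE => /predU1P[->//|]; exact: IH.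
have := cycle_next us; apply: (sub_in_cycle (P := [in s])); last exact/allP.
by move=> x y xs _ /= /eqP <-; rewrite (nextL_mem u sLL xs).
Qed.
End NextL.

Section Contours.
Variables (phi : dname -> dname) (i : nat).
Definition flip (x : dname) : dname := (x.1.1, x.1.2, ~~ x.2).
Definition kids (t : ptree) : seq dname := if t is Nd _ ts then [seq (i, c, false) | c <- ts] else [::].

Lemma flipK : involutive flip.
Proof. by case=> [[j u] b]; rewrite /flip /= negbK. Qed.

Lemma contour_sub t u : sorted (frel phi) (contour i t) -> u \in subtrees t ->
  sorted (frel phi) (contour i u).
Proof.
elim: t => [l|c ts IH]; first by move=> h; rewrite inE => /eqP ->.
move=> h; case/mem_subtrees=> [-> //|[t tts ut]]; apply: (IH t tts) ut => {IH}.
move: h; case/path.splitPr: tts => ts1 ts2.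
rewrite [contour i _]/= map_cat flatten_cat /= => h.
have {}h := path_sorted h; rewrite -!catA in h.
have [_ {}h] := cat_sorted2 h.
by have [{}h _] := cat_sorted2 h.
Qed.

(** Since [flip] jumps from the first entry of a child's contour to its last one, [phi \o flip]
    skips the subtree and goes on to the next child. *)
Lemma path_kids ts x z : path (frel phi) x (flatten (map (contour i) ts) ++ [:: z]) ->
  path (frel (phi \o flip)) (flip x) ([seq (i, c, false) | c <- ts] ++ [:: z]).
Proof.
elim: ts x => [|t ts IHts] x /=; first by rewrite flipK.
rewrite -catA.
have -> : contour i t ++ flatten [seq contour i i0 | i0 <- ts] ++ [:: z] =
  (i, t, false) :: ((if t is Nd _ ts then flatten (map (contour i) ts) else [::]) ++ 
   (i, t, true) :: (flatten [seq contour i i0 | i0 <- ts] ++ [:: z])).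
  by case: t => [l|c us] //=; rewrite -catA.
rewrite /= flipK => /andP[-> h]; rewrite cat_path in h.
by case/andP: h => _ /= /andP[_ /IHts].
Qed.

Lemma cycle_kids c ts : sorted (frel phi) (contour i (Nd c ts)) ->
  fcycle (phi \o flip) ((i, Nd c ts, true) :: kids (Nd c ts)).
Proof. by move=> /= /path_kids; rewrite -cats1. Qed.
End Contours.

Lemma uniq_flatten_mem (T : eqType) (LL : seq (seq T)) s : uniq (flatten LL) -> s \in LL -> uniq s.
Proof.
elim: LL => //= s' LL IH; rewrite cat_uniq inE => /and3P[us' _ /IH h].
by case/predU1P=> [->|].
Qed.

Lemma uniq_flatten_inj (T S : eqType) (f : S -> seq T) R r r' x : uniq (flatten (map f R)) ->
  r \in R -> r' \in R -> x \in f r -> x \in f r' -> r = r'.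
Proof.
elim: R => //= a R IH; rewrite cat_uniq !inE => /and3P[_ /hasPn dj u].
have mf b : b \in R -> x \in f b -> x \in flatten (map f R).
  by move=> bR xb; apply/flattenP; exists (f b) => //; apply: map_f.
case/predU1P=> [->|rR] /predU1P[->|r'R] // xr xr'; last exact: IH.
  by have := dj x (mf _ r'R xr'); rewrite /= xr.
by have := dj x (mf _ rR xr); rewrite /= xr'.
Qed.

Lemma uniq_flatten_map (T S : eqType) (f : S -> seq T) R : uniq R ->
  {in R, forall r, uniq (f r)} -> 
  {in R &, forall r r' x, x \in f r -> x \in f r' -> r = r'} ->
  uniq (flatten (map f R)).
Proof.
elim: R => //= a R IH /andP[aR uR] uf ff; rewrite cat_uniq uf ?mem_head //=.
apply/andP; split.
  apply/hasPn => x /flattenP[s /mapP[r rR ->] xr]; apply/negP => xa.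
  have E := ff a r (mem_head _ _) (mem_behead (s := a :: R) rR) x xa xr.
  by rewrite E rR in aR.
apply: IH => // [r rR|r r' rR r'R x]; first by apply: uf; rewrite inE rR orbT.
by apply: ff; rewrite inE ?rR ?r'R orbT.
Qed.

Lemma parent_subtree t u : u \in subtrees t -> u != t ->
  exists c ts, Nd c ts \in subtrees t /\ u \in ts.
Proof.
elim: t => [i|c ts IH]; first by rewrite inE => /eqP ->; rewrite eqxx.
case/mem_subtrees=> [->|[t tts ut]]; first by rewrite eqxx.
have [->|neq] := eqVneq u t; first by exists c, ts; rewrite subtrees_refl.
have [c' [ts' [h1 h2]]] := IH t tts ut neq.
by exists c', ts'; split=> //; apply: child_subtrees tts h1.
Qed.

Lemma uniq_leaves_subtrees t u : uniq (leaves t) -> u \in subtrees t -> uniq (leaves u).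
Proof.
elim: t => [i|c ts IH] ul; first by rewrite inE => /eqP ->.
case/mem_subtrees=> [-> //|[t tts ut]]; apply: (IH t tts _ ut).
exact: uniq_flatten_mem ul (map_f leaves tts).
Qed.

Section SeqPerm.
Variables (T : choiceType) (L : seq T) (f : T -> T).
Hypotheses (fI : injective f) (fL : forall x, x \in L -> f x \in L).
Definition seq_fun (x : seq_sub L) : seq_sub L := SeqSub (fL (valP x)).
Lemma seq_fun_inj : injective seq_fun.
Proof. by move=> x y /(congr1 val) /= /fI /val_inj. Qed.
Definition seq_perm := perm seq_fun_inj.
Lemma val_seq_perm x : val (seq_perm x) = f (val x). Proof. by rewrite permE. Qed.
End SeqPerm.

Section Realize.
Variables (R : seq (nat * ptree)) (n : nat).
Hypothesis R_wf : forall r, r \in R -> wf_root r.2.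
Hypothesis R_perm : perm_eq (flatten [seq r.1 :: leaves r.2 | r <- R]) (iota 0 n).
Hypothesis R_lt : forall r l, r \in R -> l \in leaves r.2 -> r.1 < l.

Let R_uniq : uniq (flatten [seq r.1 :: leaves r.2 | r <- R]).
Proof. by rewrite (perm_uniq R_perm) iota_uniq. Qed.

Let R_fst r r' : r \in R -> r' \in R -> r.1 = r'.1 -> r = r'.
Proof.
by move=> rR r'R E; apply: (uniq_flatten_inj R_uniq rR r'R (x := r.1)); rewrite ?E mem_head.
Qed.

Let R_uniqR : uniq R.
Proof.
move: R_uniq; elim: R => //= a L IH; rewrite mem_cat negb_or => /andP[/andP[_ h]].
rewrite cat_uniq => /and3P[_ _ /IH ->].
rewrite andbT; apply: contra h => aL; apply/flattenP; exists (a.1 :: leaves a.2); last exact: mem_head.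
by apply/mapP; exists a.
Qed.

Let R_uniql r : r \in R -> uniq (leaves r.2).
Proof.
move=> rR; have := uniq_flatten_mem R_uniq (map_f (fun r => r.1 :: leaves r.2) rR).
by case/andP.
Qed.

Definition contours := [seq contour r.1 r.2 | r <- R].
Definition dnames := flatten contours.

Lemma dnamesP x : reflect (exists2 r, r \in R & (x.1.1 == r.1) && (x.1.2 \in subtrees r.2)) (x \in dnames).
Proof.
apply: (iffP flattenP) => [[s /mapP[r rR ->]]|[r rR h]]; first by rewrite mem_contour; exists r.
by exists (contour r.1 r.2); [exact: map_f|rewrite mem_contour].
Qed.

Lemma uniq_dnames : uniq dnames.
Proof.
apply: uniq_flatten_map => // [r rR|r r' rR r'R x].
  by apply: uniq_contour; [apply: R_wf|apply: R_uniql].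
by rewrite !mem_contour => /andP[/eqP E _] /andP[/eqP E' _]; apply: R_fst => //; rewrite -E.
Qed.

Lemma flip_dnames x : x \in dnames -> flip x \in dnames.
Proof. by case/dnamesP => r rR h; apply/dnamesP; exists r. Qed.

Definition nphi := nextL contours.
Definition nnode := nphi \o flip.

Lemma nnode_dnames x : x \in dnames -> nnode x \in dnames.
Proof.
move/flip_dnames => /flattenP[s sR xs]; rewrite /nnode /= /nphi (nextL_mem uniq_dnames sR xs).
by apply/flattenP; exists s; rewrite ?mem_next.
Qed.

Lemma nnode_inj : injective nnode.
Proof. by apply: inj_comp; [apply: nextL_inj uniq_dnames|apply: (can_inj flipK)]. Qed.

Local Notation rdart := (seq_sub dnames).
Definition redge : {perm rdart} := seq_perm (can_inj flipK) flip_dnames.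
Definition rnode : {perm rdart} := seq_perm nnode_inj nnode_dnames.

(** A half-edge belongs to the vertex it leaves: a boundary vertex if it goes up from a leaf, or
    down from the position of a root. *)
Definition isbd (x : dname) :=
  if x.2 then (if x.1.2 is Lf _ then true else false) else (x.1.1, x.1.2) \in R.
Definition key (x : dname) := if x.2 then (if x.1.2 is Lf l then l else 0) else x.1.1.

Definition rbds : seq rdart :=
  sort (relpre (fun x => key (val x)) leq) [seq x <- enum {: rdart} | isbd (val x)].

(** An internal vertex is recognized by its only half-edge going up, which names its colour and
    children; [size ts] is its degree minus one. *)
Definition rhel (v : {set rdart}) : int :=
  if [pick x in v | (val x).2] is Some x then
    (if (val x).1.2 is Nd c ts then if c then Posz (size ts) else Posz 1 else Posz 0)
  else Posz 0.

Definition rgraph := DiskGraph redge rnode rbds rhel.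

Lemma mem_rbds (x : rdart) : (x \in rbds) = isbd (val x).
Proof. by rewrite mem_sort mem_filter mem_enum andbT. Qed.

Lemma uniq_rbds : uniq rbds.
Proof. by rewrite sort_uniq filter_uniq ?enum_uniq. Qed.

(** Roots have distinct positions, so no proper subtree is taken for a root. *)
Lemma keys_contour r : r \in R -> [seq key x | x <- contour r.1 r.2 & isbd x] = r.1 :: leaves r.2.
Proof.
case: r => i t rR; rewrite /=.
have inner u : (forall v, v \in subtrees u -> (i, v) \notin R) ->
    [seq key x | x <- contour i u & isbd x] = leaves u.
  elim: u => [l|c ts IH] h.
    by rewrite /= /isbd /= (negPf (h _ (subtrees_refl _))).
  rewrite /= {1}/isbd /= (negPf (h _ (subtrees_refl _))) filter_cat /= cats0.
  have {}h : {in ts, forall u, forall v, v \in subtrees u -> (i, v) \notin R}.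
    by move=> u uts v vu; apply: h; apply: child_subtrees uts vu.
  elim: ts IH h => //= u ts IHts IH h; rewrite filter_cat map_cat IH ?mem_head //; last first.
    by apply: h; rewrite mem_head.
  by rewrite IHts // => w wts; [apply: IH|apply: h]; rewrite inE wts orbT.
have prop v : v \in subtrees t -> v != t -> (i, v) \notin R.
  by move=> vt; apply: contra => vR; apply/eqP; have [] := R_fst vR rR erefl.
case: t rR prop => [l|c ts] rR prop; rewrite /= {1}/isbd /= rR //=.
congr (_ :: _); rewrite filter_cat /= cats0.
have {}prop : {in ts, forall u, forall v, v \in subtrees u -> (i, v) \notin R}.
  move=> u uts v vu; apply: prop; first exact: child_subtrees uts vu.
  apply/eqP => E; have := nnodes_child c uts; rewrite E in vu.
  by case: (nnodes_subtrees vu) => [->|]; lia.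
elim: ts prop {rR} => //= u ts IHts h; rewrite filter_cat map_cat inner; last by apply: h; rewrite mem_head.
by rewrite IHts // => w wts; apply: h; rewrite inE wts orbT.
Qed.

Lemma map_key_rbds : [seq key (val x) | x <- rbds] = iota 0 n.
Proof.
rewrite /rbds -sort_map -[RHS](sorted_sort leq_trans (iota_sorted 0 n)).
apply/perm_sortP; [exact: leq_total|exact: leq_trans|exact: anti_leq|].
apply: perm_trans R_perm; rewrite (map_comp key val) -filter_map.
apply: (@perm_trans _ [seq key x | x <- dnames & isbd x]).
  apply: perm_map; apply: perm_filter; apply: uniq_perm; rewrite ?uniq_dnames //.
    by rewrite map_inj_uniq ?enum_uniq //; apply: val_inj.
  move=> x; apply/mapP/idP => [[y _ ->]|xd]; first exact: valP.
  by exists (SeqSub xd); rewrite ?mem_enum.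
rewrite /dnames /contours.
suff -> : forall L, {subset L <= R} -> [seq key x | x <- flatten [seq contour r.1 r.2 | r <- L] & isbd x] = 
     flatten [seq r.1 :: leaves r.2 | r <- L] by [].
elim=> //= a L IH h; rewrite filter_cat map_cat keys_contour ?h ?mem_head //=.
by rewrite IH // => r rL; apply: h; rewrite inE rL orbT.
Qed.

Lemma size_rbds : size rbds = n.
Proof. by rewrite -(size_map (fun x => key (val x))) map_key_rbds size_iota. Qed.

Lemma index_rbds (x : rdart) : isbd (val x) -> index x rbds = key (val x).
Proof.
rewrite -mem_rbds => xb; have lx : index x rbds < n by rewrite -size_rbds index_mem.
have := congr1 (fun s => nth 0 s (index x rbds)) map_key_rbds.
by rewrite /= (nth_map x) ?size_rbds // nth_index // nth_iota.
Qed.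

Lemma contour_cycle r : r \in R -> fcycle nphi (contour r.1 r.2).
Proof. by move=> rR; apply: nextL_cycle; [exact: uniq_dnames|exact: map_f]. Qed.

Lemma contour_sorted r u : r \in R -> u \in subtrees r.2 -> sorted (frel nphi) (contour r.1 u).
Proof.
move=> rR; apply: contour_sub; have := contour_cycle rR; case: (contour _ _) => //= x s.
by rewrite rcons_path => /andP[].
Qed.

Lemma rnode_bd x : x \in rbds -> rnode x = x.
Proof.
rewrite mem_rbds => xb; apply: val_inj; rewrite val_seq_perm; move: xb (valP x).
case: (val x) => [[i u] b]; rewrite /isbd /nnode /flip /=; case: b => /=.
  case: u => // l _ /dnamesP[r rR /= /andP[/eqP -> lu]].
  by have := contour_sorted rR lu; rewrite /= andbT => /eqP.
move=> iu _; have := contour_cycle iu.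
case: u {iu} => [l|c ts] /=; first by case/and3P => _ /eqP.
by rewrite rcons_path last_cat /= => /andP[_ /eqP].
Qed.

Lemma rvertex r c ts : r \in R -> Nd c ts \in subtrees r.2 ->
  exists X S, [/\ val X = (r.1, Nd c ts, true), orbit rnode X = X :: S,
    map val S = kids r.1 (Nd c ts), rhel (vertex (G := rgraph) X) = if c then Posz (size ts) else Posz 1 &
    deg (vertex (G := rgraph) X) = (size ts).+1].
Proof.
move=> rR ur.
have Xd : (r.1, Nd c ts, true) \in dnames by apply/dnamesP; exists r; rewrite //= eqxx.
have kd : all (mem dnames) (kids r.1 (Nd c ts)).
  apply/allP => x /mapP[t tts ->]; apply/dnamesP; exists r; rewrite //= eqxx /=.
  apply: subtrees_trans ur _; apply: child_subtrees tts (subtrees_refl _).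
have [S SE] : exists S : seq rdart, map val S = kids r.1 (Nd c ts).
  elim: (kids _ _) kd => [_|x s IH /= /andP[xd /IH[S <-]]]; first by exists [::].
  by exists (SeqSub xd :: S).
pose X : rdart := SeqSub Xd; exists X, S.
have uS : uniq (X :: S).
  rewrite -(map_inj_uniq val_inj) /= SE; apply/andP; split; first by apply/mapP => -[].
  have := uniq_contour r.1 (wf_root_subtrees (R_wf rR) ur).
  have ul : uniq (leaves (Nd c ts)).
    exact: uniq_leaves_subtrees (R_uniql rR) ur.
  move/(_ ul) => /= /andP[_]; rewrite cat_uniq => /and3P[+ _ _].
  apply: subseq_uniq; elim: (ts) => //= t us IH; rewrite -cat1s; apply: cat_subseq => //.
  by rewrite sub1seq; case: t {IH} => *; rewrite mem_head.
have oS : orbit rnode X = X :: S.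
  apply: orbit_of_cycle => //; have := cycle_kids (contour_sorted rR ur).
  rewrite -SE -[(_, _, _)]/(val X) -map_cons cycle_map; apply: sub_cycle => a b /=.
  by rewrite -(inj_eq val_inj) val_seq_perm.
split=> //; last by rewrite /deg card_porbit_order -size_orbit oS /= -(size_map val) SE size_map.
rewrite /rhel; case: pickP => [x /andP[xv xb]|/(_ X)]; last by rewrite /vertex /= porbit_id.
move: xv; rewrite porbit_orbit oS inE => /predU1P[-> //|xS].
have : val x \in kids r.1 (Nd c ts) by rewrite -SE map_f.
by case/mapP=> t _ E; rewrite E in xb.
Qed.

Let redgeE (x : rdart) : val (redge x) = flip (val x).
Proof. exact: val_seq_perm. Qed.

Let redgeK x : redge (redge x) = x.
Proof. by apply: val_inj; rewrite !redgeE flipK. Qed.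

Let rbd_vertex x : x \in rbds -> vertex (G := rgraph) x = [set x].
Proof.
move=> xb; apply/setP=> y; rewrite /vertex porbit_orbit !inE -fconnect_orbit.
by apply/idP/eqP => [/connectP[p + ->]|->//]; elim: p => //= z p IHp; rewrite rnode_bd // => /andP[/eqP <-].
Qed.

Lemma rvertexP (X : rdart) : X \notin rbds -> exists r c ts,
  [/\ r \in R, Nd c ts \in subtrees r.2,
   val X \in (r.1, Nd c ts, true) :: kids r.1 (Nd c ts),
   forall Y : rdart, (Y \in vertex (G := rgraph) X) = (val Y \in (r.1, Nd c ts, true) :: kids r.1 (Nd c ts)) &
   rhel (vertex (G := rgraph) X) = (if c then Posz (size ts) else Posz 1) /\
   deg (vertex (G := rgraph) X) = (size ts).+1].
Proof.
rewrite mem_rbds => Xb.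
have [r [c [ts [rR ur Xs]]]] : exists r c ts, [/\ r \in R, Nd c ts \in subtrees r.2 &
   val X \in (r.1, Nd c ts, true) :: kids r.1 (Nd c ts)].
  move: Xb (valP X); case: (val X) => [[i u] b]; rewrite /isbd /=; case: b => /=.
    case: u => // c ts _ /dnamesP[r rR /= /andP[/eqP -> ur]]; exists r, c, ts; split=> //.
    exact: mem_head.
  move=> iu /dnamesP[r rR /= /andP[/eqP Ei ur]].
  have [|c [ts [h1 h2]]] := parent_subtree ur.
    by apply: contraNneq iu => ->; rewrite Ei -surjective_pairing.
  by exists r, c, ts; split=> //; rewrite inE /= Ei map_f ?orbT.
have [X0 [S [E1 E2 E3 E4 E5]]] := rvertex rR ur.
have EV (Y : rdart) : (Y \in vertex (G := rgraph) X0) = (val Y \in (r.1, Nd c ts, true) :: kids r.1 (Nd c ts)).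
  rewrite porbit_orbit -[node rgraph]/rnode E2 -E3 -E1 -map_cons mem_map //; exact: val_inj.
have EX : vertex (G := rgraph) X = vertex (G := rgraph) X0.
  by apply/eqP; rewrite -vertexE EV.
by exists r, c, ts; rewrite EX; split.
Qed.

Let step_down (x y : rdart) : (val x).2 = false -> y \in vertex (G := rgraph) (redge x) -> y != redge x ->
  (val y).2 = false /\ nnodes (val y).1.2 < nnodes (val x).1.2.
Proof.
move=> xb yv yx; have [xe|xe] := boolP (redge x \in rbds).
  by move: yv yx; rewrite rbd_vertex // inE => ->.
have [r [c [ts [rR ur + EV _]]]] := rvertexP xe; rewrite EV in yv.
rewrite redgeE inE => /predU1P[Ex|/mapP[t _]]; last by rewrite /flip xb.
move: yv; rewrite inE -Ex -redgeE (inj_eq val_inj) (negPf yx) /= => /mapP[t tts ->] /=; split=> //.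
by move: Ex; rewrite /flip => -[_ -> _]; apply: nnodes_child.
Qed.

Let step_up (x y : rdart) : (val x).2 = true -> y \in vertex (G := rgraph) (redge x) ->
  (val y).2 = true -> nnodes (val x).1.2 < nnodes (val y).1.2.
Proof.
move=> xb yv yb; have [xe|xe] := boolP (redge x \in rbds).
  by move: yv; rewrite rbd_vertex // inE => /eqP Ey; move: yb; rewrite Ey redgeE /flip xb.
have [r [c [ts [rR ur + EV _]]]] := rvertexP xe; rewrite EV in yv.
rewrite redgeE inE => /predU1P[|/mapP[t tts]]; rewrite /flip xb //= => -[_ ->].
move: yv; rewrite inE => /predU1P[-> /=|/mapP[t' _ E]]; last by rewrite E in yb.
exact: nnodes_child.
Qed.

(** On a path without backtracking, once an edge is followed downwards all later ones are, and the
    subtrees shrink; a path that only goes up has growing subtrees. Neither can close up. *)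
Lemma racyclic : acyclic rgraph.
Proof.
move=> s; apply/negP => /and4P[s0 cy us /allP es].
pose r' : rel rdart := [rel x y | (y \in vertex (G := rgraph) (redge x)) && (y != redge x)].
have {}cy : path.cycle r' s.
  apply: (sub_in_cycle (P := [in s])) cy; last exact/allP.
  move=> x y xs ys h; apply/andP; split; first exact: h.
  by apply: contraTneq ys => ->; apply: es.
have dn p (x : rdart) : path r' x p -> p != [::] -> (val x).2 = false -> nnodes (val (last x p)).1.2 < nnodes (val x).1.2.
  elim: p x => //= y p IHp x /andP[/andP[xy1 xy2] yp] _ xb.
  have [yb lt] := step_down xb xy1 xy2.
  by have [->//|p0] := eqVneq p [::]; apply: ltn_trans (IHp _ yp p0 yb) lt.
have up p (x : rdart) : path r' x p -> p != [::] -> (val x).2 -> all (fun y : rdart => (val y).2) p ->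
    nnodes (val x).1.2 < nnodes (val (last x p)).1.2.
  elim: p x => //= y p IHp x /andP[/andP[xy1 xy2] yp] _ xb /andP[yb ap].
  have lt := step_up xb xy1 yb.
  by have [->//|p0] := eqVneq p [::]; apply: ltn_trans lt (IHp _ yp p0 yb ap).
have [|/hasPn al] := boolP (has (fun x : rdart => ~~ (val x).2) s).
  case/hasP=> x xs xb; have [i s' Es] := rot_to xs.
  have := cy; rewrite -(rot_cycle i) Es /= => /dn; rewrite last_rcons => h.
  have : nnodes (val x).1.2 < nnodes (val x).1.2; last by rewrite ltnn.
  by apply: h; [case: (s')|apply: negbTE].
case: s s0 cy al {us es} => // x s _ /= cy al.
have := up _ _ cy; rewrite last_rcons ltnn => h; suff : false by [].
have xb : (val x).2 by have := al x (mem_head _ _); rewrite negbK.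
apply: h => //; first by case: (s).
by apply/allP => y; rewrite mem_rcons => ys; have := al y ys; rewrite negbK.
Qed.

Let phi_val (x : rdart) : val (phi rgraph x) = nphi (val x).
Proof. by rewrite phiE /= val_seq_perm redgeE /nnode /= flipK. Qed.

Lemma rorbit r (x y : rdart) : r \in R -> val x \in contour r.1 r.2 ->
  (y \in porbit (phi rgraph) x) = (val y \in contour r.1 r.2).
Proof.
move=> rR xr.
have [S SE] : exists S : seq rdart, map val S = contour r.1 r.2.
  have : all (mem dnames) (contour r.1 r.2).
    by apply/allP => z zr; apply/flattenP; exists (contour r.1 r.2); rewrite ?map_f //; apply: map_f.
  elim: (contour _ _) => [_|z s IH /= /andP[zd /IH[S <-]]]; first by exists [::].
  by exists (SeqSub zd :: S).
have cy : fcycle (phi rgraph) S.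
  have := contour_cycle rR; rewrite -SE cycle_map; apply: sub_cycle => a b /=.
  by rewrite -(inj_eq val_inj) phi_val.
rewrite -SE !mem_map in xr *; try exact: val_inj.
by rewrite porbit_orbit -fconnect_orbit (fconnect_cycle cy).
Qed.

Lemma rroot r : r \in R -> exists2 b : rdart, b \in rbds & val b = (r.1, r.2, false).
Proof.
move=> rR; have bd : (r.1, r.2, false) \in dnames.
  by apply/dnamesP; exists r; rewrite //= eqxx subtrees_refl.
by exists (SeqSub bd); rewrite // mem_rbds /isbd /= -surjective_pairing.
Qed.

Lemma rinternal (x : rdart) : vertex (G := rgraph) x \in internal rgraph -> x \notin rbds.
Proof.
move=> /setDP[_ h]; apply: contra h => xb; apply/imsetP; exists x => //; exact: rbd_vertex.
Qed.

Lemma rprePlanar : prePlanar rgraph.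
Proof.
have bN : {in bds rgraph, forall d, node rgraph d = d} by move=> x; apply: rnode_bd.
split; last 1 first.
(* It suffices to look at an edge from its upper end; [redge] exchanges the two ends. *)
- have main (x : rdart) : (val x).2 = false -> x \notin rbds -> redge x \notin rbds ->
      ~~ (white (vertex (G := rgraph) x) && white (vertex (G := rgraph) (redge x))) &&
      ~~ (black (vertex (G := rgraph) x) && black (vertex (G := rgraph) (redge x))).
    move=> xb xn en; have [r [c [ts [rR ur Xs _ [h1 d1]]]]] := rvertexP xn.
    have [r' [c' [ts' [rR' ur' Xs' _ [h2 d2]]]]] := rvertexP en.
    move: Xs'; rewrite redgeE inE => /predU1P[|/mapP[t _]]; last by rewrite /flip xb.
    rewrite /flip => -[_ Eu _].
    move: Xs; rewrite inE => /predU1P[E|/mapP[t tts E]]; first by rewrite E in xb.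
    rewrite E /= in Eu; rewrite {t E}Eu in tts.
    have w := wf_root_subtrees (R_wf rR) ur.
    have /and3P[cc sz' _] := wf_root_child w tts.
    have sz : size ts != 1 by move: w => /= /andP[].
    rewrite /white /black /hel /= h1 h2 d1 d2.
    have sz1 : 1 < size ts by case: (ts) tts sz => [|? []].
    clear -cc sz1 sz'; by case: c cc; case: c' => // _; apply/andP; split; lia.
  apply/forallP => x; apply/implyP => /andP[xi ei].
  have xn : x \notin rbds by apply: rinternal.
  have en : redge x \notin rbds by apply: rinternal.
  case xb: (val x).2; last exact: main.
  have := main (redge x); rewrite redgeK redgeE /flip xb => /(_ erefl en xn) /andP[h1 h2].
  by apply/andP; split; rewrite andbC.
- split=> //.
  + by move=> d; apply/eqP => /(congr1 val); rewrite redgeE /flip; case: (val d) => [[i u] []].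
  + exact: uniq_rbds.
  move=> x; have /dnamesP[r rR /andP[/eqP xi xr]] := valP x.
  have [b bb Eb] := rroot rR; apply/hasP; exists b => //.
  rewrite (@glink_connect_sym rgraph redgeK).
  have : x \in porbit (phi rgraph) b by rewrite (rorbit _ rR) mem_contour ?Eb /= ?xi ?eqxx ?subtrees_refl.
  case/porbitP=> m ->; rewrite permX; elim: m => [|m IHm]; first exact: connect0.
  apply: connect_trans IHm _; rewrite iterS phiE; set z := iter _ _ _.
  apply: (@connect_trans _ _ (edge rgraph z)); apply: connect1; by rewrite /glink /= eqxx ?orbT.
- move=> v vi; have /setDP[/imsetP[x _ Ev] _] := vi; rewrite {v}Ev in vi *.
  have xn : x \notin rbds by apply: rinternal.
  have [r [c [ts [rR ur Xs EV [h1 d1]]]]] := rvertexP xn.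
  have w := wf_root_subtrees (R_wf rR) ur.
  have sz : size ts != 1 by move: w => /= /andP[].
  rewrite -/(vertex (G := rgraph) x) /admissible_helicity /generic /white /black /hel /= h1 d1.
  split; first by rewrite eqSS.
    (* A vertex without children must be a root, since [wf] excludes it elsewhere; so it is a
       boundary leaf, where helicities 0 and 1 are both admissible. *)
    have [t0|tsn] := eqVneq ts [::].
      case: ifP => [_|/negbT/negP[]]; first by rewrite t0 /=; case: (c).
      rewrite /boundary_leaf d1 t0 /=; apply/existsP; exists x; rewrite porbit_id /=.
      rewrite [_ \in _]mem_rbds redgeE; move: Xs; rewrite t0 /= mem_seq1 => /eqP ->.
      have [E|nr] := eqVneq (Nd c ts) r.2; first by rewrite /isbd /= -t0 E -surjective_pairing.
      have [c' [ts' [h1' h2']]] := parent_subtree ur nr.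
      by have := wf_root_child (wf_root_subtrees (R_wf rR) h1') h2'; rewrite t0 /= andbF.
    have sz1 : 1 < size ts by case: (ts) tsn sz => [|? []].
    rewrite /boundary_leaf d1; have -> /= : ((size ts).+1 == 1) = false by case: (size ts) sz1.
    by clear -sz1; case: c; lia.
  have -> : (Posz (size ts).+1 - 1)%R = Posz (size ts) by rewrite -addn1 PoszD addrK.
  by case: (c); rewrite eqxx ?andbF.
- exact: racyclic.
Qed.

Lemma rcode N (x : rdart) : (val x).2 = false -> nnodes (val x).1.2 < N ->
  @code rgraph N x = (val x).1.2.
Proof.
elim: N x => // N IHN x xb ltN; rewrite [LHS]/=.
have [xe|xe] := boolP (redge x \in rbds).
  rewrite index_rbds -?mem_rbds // redgeE /flip xb /=; move: xe; rewrite mem_rbds redgeE /isbd /flip xb /key /=.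
  by case: ((val x).1.2).
have [r [c [ts [rR ur + _ [h1 d1]]]]] := rvertexP xe.
rewrite redgeE inE => /predU1P[Ex|/mapP[t _]]; last by rewrite /flip xb.
have Eu : (val x).1.2 = Nd c ts by move: Ex; rewrite /flip => -[].
have sz : size ts != 1 by have := wf_root_subtrees (R_wf rR) ur => /= /andP[].
rewrite Eu; congr (Nd _ _).
  by rewrite /white /hel /= h1; case: (c); rewrite ?eqz_nat ?negbK ?sz.
have [X [S [E1 E2 E3 _ _]]] := rvertex rR ur.
have -> : redge x = X by apply: val_inj; rewrite E1 redgeE Ex.
rewrite E2 /=.
apply: (@eq_from_nth _ (Lf 0)); first by rewrite size_map -(size_map val) E3 size_map.
move=> i; rewrite size_map => li; rewrite (nth_map x) //.
have Ei : val (nth x S i) = (r.1, nth (Lf 0) ts i, false).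
  rewrite -(nth_map x (val x)) // E3 (nth_map (Lf 0)) //.
  by rewrite -(size_map (fun c => (r.1, c, false))) -[map _ _]E3 size_map.
rewrite IHN Ei //=; apply: leq_trans (nnodes_child c (mem_nth (Lf 0) _)) _.
  by rewrite -(size_map (fun c => (r.1, c, false))) -[map _ _]E3 size_map.
by rewrite -Eu.
Qed.

Lemma rctree (x : rdart) : (val x).2 = false -> @ctree rgraph x = (val x).1.2.
Proof.
move=> xb; set N := maxn #|side (H := rgraph) x| (nnodes (val x).1.2).+1.
rewrite -(code_stable rprePlanar (leq_maxl _ _ : _ <= N)); apply: rcode => //.
exact: leq_maxr.
Qed.

(** By [R_lt] a root precedes the leaves of its own component. *)
Lemma rfirst (x : rdart) : x \in rbds -> isfirst (H := rgraph) x = ~~ (val x).2.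
Proof.
move=> xb; have := valP x => /dnamesP[r rR /andP[/eqP xi xr]].
have xc : val x \in contour r.1 r.2 by rewrite mem_contour xi eqxx.
have key_r (y : rdart) : y \in rbds -> val y \in contour r.1 r.2 -> key (val y) \in r.1 :: leaves r.2.
  by move=> yb yc; rewrite -keys_contour // map_f // mem_filter -mem_rbds yb.
have xn := xb; rewrite mem_rbds in xn.
case E: (val x).2; last first.
  apply/allP => y yt; have yb := mem_take yt.
  apply: contraTN yt; rewrite (rorbit _ rR) // => yc.
  rewrite in_take // -leqNgt !index_rbds -?mem_rbds //.
  have -> : key (val x) = r.1 by rewrite /key E.
  have := key_r y yb yc; rewrite inE => /predU1P[->//|/(R_lt rR) /ltnW //].
apply/negP => /allP /(_ _) h; have [b bb Eb] := rroot rR.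
have := h b; rewrite in_take // !index_rbds -?mem_rbds // (rorbit _ rR) // mem_contour Eb /= eqxx subtrees_refl.
suff -> : key (r.1, r.2, false) < key (val x) by move=> /(_ isT).
apply: (R_lt rR); rewrite -Lf_subtrees; move: xn xr; rewrite /isbd E /key E.
by case: ((val x).1.2).
Qed.

Lemma rhword : hword rgraph = 
  [seq if ~~ (val x).2 then Some (val x).1.2 else None | x : rdart <- rbds].
Proof.
rewrite /hword; apply/eq_in_map => x xb; rewrite rfirst //.
by case E: (val x).2 => //=; rewrite rctree.
Qed.

Lemma rhword_nth k : k < n -> forall t, 
  (nth None (hword rgraph) k == Some t) = ((k, t) \in R).
Proof.
move=> lk t; rewrite rhword; case E: rbds => [|x0 s]; first by move: lk; rewrite -size_rbds E.
rewrite -E (nth_map x0) ?size_rbds //; set x := nth x0 rbds k.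
have xb : x \in rbds by rewrite mem_nth ?size_rbds.
have kx : key (val x) = k by rewrite -index_rbds -?mem_rbds // index_uniq ?size_rbds ?uniq_rbds.
apply/eqP/idP => [|kR].
  case b: (val x).2 => //= -[<-]; rewrite -kx /key b.
  by move: xb; rewrite mem_rbds /isbd b.
have [b bb Eb] := rroot kR.
have -> : x = b by rewrite /x -(nth_index x0 bb) index_rbds -?mem_rbds // Eb.
by rewrite Eb.
Qed.

End Realize.

Fixpoint roots_from k (w : seq (option ptree)) : seq (nat * ptree) :=
  match w with
  | [::] => [::]
  | Some t :: w' => (k, t) :: roots_from k.+1 w'
  | None :: w' => roots_from k.+1 w'
  end.

Lemma mem_roots_from k w i t : ((i, t) \in roots_from k w) = (k <= i) && (nth None w (i - k) == Some t).
Proof.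
elim: w k => [|o w IHw] k /=; first by rewrite nth_nil andbF.
have : forall b, b = ((i, t) \in roots_from k.+1 w) -> ((i == k) && (o == Some t)) || b = (k <= i) && (nth None (o :: w) (i - k) == Some t).
  move=> b ->; rewrite IHw; case: (ltngtP k i) => [lt|//|->] /=; last by rewrite subnn orbF.
  by rewrite subnS; case: (i - k) (subn_gt0 k i) => [|m]; rewrite lt.
case: o => [s|] h; last by rewrite -(h _ erefl) andbF.
rewrite inE xpair_eqE -(h _ erefl); congr (_ && _ || _).
by apply/eqP/eqP => [->|[->]].
Qed.

(** Each label is popped at the position it names; the positions that pop nothing are those of the
    roots. *)
Lemma run_perm k S w : run k S w ->
  perm_eq (S ++ flatten [seq r.1 :: leaves r.2 | r <- roots_from k w]) (iota k (size w)).
Proof.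
elim: w k S => [|[t|] w IHw] k S /=; first by move/eqP->.
  move/IHw => h; rewrite -(perm_cons k) in h; apply: perm_trans h.
  by rewrite -cat_cons perm_catCA cat_cons perm_cons -catA.
by case: S => // i S /andP[/eqP -> /IHw h]; rewrite cat_cons perm_cons.
Qed.

Lemma run_lt k S w r l : run k S w -> r \in roots_from k w -> l \in leaves r.2 -> r.1 < l.
Proof.
elim: w k S => //= -[t|] w IHw k S; last by case: S => // i S /andP[_]; apply: IHw.
move=> h; rewrite inE => /predU1P[-> /= lt|]; last exact: IHw h.
have := perm_mem (run_perm h) l; rewrite !mem_cat lt mem_iota /= => /esym /andP[] //.
Qed.

Lemma roots_from_mem k w r : r \in roots_from k w -> Some r.2 \in w.
Proof.
by elim: w k => //= -[t|] w IHw k; rewrite !inE; [case/predU1P=> [->|/IHw ->]; rewrite ?eqxx ?orbT|move/IHw].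
Qed.

Definition wf_word (w : seq (option ptree)) := all (fun o => if o is Some t then wf_root t else true) w.

(** Planarity is read off the word by [planar_hword], once the constructed graph is known to have
    the word [w]. *)
Lemma realize_run w : wf_word w -> run 0 [::] w ->
  exists G, [/\ prePlanar G, planar G & hword G = w].
Proof.
move=> wf rw; pose R := roots_from 0 w.
have Rw r : r \in R -> wf_root r.2 by move/roots_from_mem/(allP wf).
have Rp : perm_eq (flatten [seq r.1 :: leaves r.2 | r <- R]) (iota 0 (size w)) by apply: run_perm rw.
have Rl r l : r \in R -> l \in leaves r.2 -> r.1 < l by apply: run_lt rw.
exists (rgraph Rw Rp); have fG := rprePlanar Rw Rp.
have E : hword (rgraph Rw Rp) = w.
  have sz : size (hword (rgraph Rw Rp)) = size w by rewrite size_map; apply: size_rbds.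
  apply: (@eq_from_nth _ None) => // k; rewrite sz => lk.
  have h t := rhword_nth Rw Rp Rl lk t.
  case E: (nth None w k) => [t|].
    by apply/eqP; rewrite h mem_roots_from subn0 E eqxx.
  case E': (nth None (hword _) k) => [t|] //.
  by have := h t; rewrite E' eqxx mem_roots_from subn0 E.
by split=> //; rewrite planar_hword // E.
Qed.

(** * Enumeration and generating series *)

(** Here [c] is the colour of the vertex above. The families are mutually recursive through [F],
    which is called only for fewer leaves: in [forests_from] the first subtree and the rest both
    have at least one. *)
Definition trees_from (F : bool -> nat -> seq (seq ptree)) c i : seq ptree :=
  (if i == 1 then [:: Lf 0] else [::]) ++ map (Nd (~~ c)) (F (~~ c) i).
Definition lists_from (F : bool -> nat -> seq (seq ptree)) c i : seq (seq ptree) :=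
  map (fun t => [:: t]) (trees_from F c i) ++ F c i.
Definition forests_from (F : bool -> nat -> seq (seq ptree)) c m : seq (seq ptree) :=
  flatten [seq [seq t :: ts | t <- trees_from F c i, ts <- lists_from F c (m - i)] | i <- iota 1 m.-1].

Fixpoint forests_fuel N : bool -> nat -> seq (seq ptree) :=
  if N is N'.+1 then forests_from (forests_fuel N') else fun _ _ => [::].

(* Lists of at least two subtrees below a vertex of colour [c]. *)
Definition forests c m := forests_fuel m c m.
Definition trees := trees_from forests.
Definition lists := lists_from forests.

Lemma forests_fuelE N c m : m <= N -> forests_fuel N c m = forests c m.
Proof.
have gen M M' : m <= M -> m <= M' -> forests_fuel M c m = forests_fuel M' c m.
  have [k] := ubnP m; elim: k c m M M' => // k IHk c' m' M M' ltk.
  case: M => [|M]; first by rewrite leqn0 => /eqP -> _; case: M'.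
  case: M' => [_|M' lM lM']; first by rewrite leqn0 => /eqP ->.
  rewrite /= /forests_from; congr flatten; apply/eq_in_map => i; rewrite mem_iota => /andP[i0 li].
  have im : i < m' by clear -i0 li; lia.
  have E d j : j < m' -> forests_fuel M d j = forests_fuel M' d j.
    by move=> lj; apply: IHk; lia.
  rewrite /trees_from /lists_from /trees_from !E //; lia.
by move=> leN; apply: gen.
Qed.

Lemma forestsE c m : forests c m = forests_from forests c m.
Proof.
rewrite -(forests_fuelE c (leqnSn m)) /= /forests_from; congr flatten; apply/eq_in_map => i.
rewrite mem_iota => /andP[i0 li].
have im : i < m by clear -i0 li; lia.
have E d j : j < m -> forests_fuel m d j = forests d j by move=> lj; apply: forests_fuelE; apply: ltnW.
rewrite /trees_from /lists_from /trees_from !E //; lia.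
Qed.

Definition unlabelled t := unlabel t == t.

Lemma nleaves_Nd c ts : nleaves (Nd c ts) = sumn (map nleaves ts).
Proof. by rewrite /nleaves /= size_flatten /shape -map_comp. Qed.

Lemma unlabelled_Nd c ts : unlabelled (Nd c ts) = all unlabelled ts.
Proof.
rewrite /unlabelled /=; elim: ts => [|t ts IH] /=; first by rewrite eqxx.
by rewrite -IH; apply/eqP/andP => [[-> ->]|[/eqP -> /eqP[->]]].
Qed.

Lemma Nd_inj c : injective (Nd c). Proof. by move=> ts ts' []. Qed.

Definition okforest c m ts := [&& all (wf c) ts, all unlabelled ts & sumn (map nleaves ts) == m].

Lemma mem_forests_gen m :
  (forall c ts, (ts \in forests c m) = (1 < size ts) && okforest c m ts) /\
  (forall c t, (t \in trees c m) = [&& wf c t, unlabelled t & nleaves t == m]).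
Proof.
have [k] := ubnP m; elim: k m => // k IHk m ltk.
have Fm c ts : (ts \in forests c m) = (1 < size ts) && okforest c m ts.
  rewrite forestsE /forests_from; apply/flattenP/idP.
    case=> s /mapP[i]; rewrite mem_iota => /andP[i0 li] ->.
    have im : i < m by clear -i0 li; lia.
    case/allpairsP=> -[t us] /= [ti usi ->].
    have [_ Ti] := IHk i (leq_trans im ltk); move: ti; rewrite Ti => /and3P[wt nt /eqP lt].
    have lm : m - i < k by lia.
    have [Fi' Ti'] := IHk _ lm.
    have : 0 < size us /\ okforest c (m - i) us.
      move: usi; rewrite mem_cat => /orP[/mapP[u]|].
        by rewrite Ti' => /and3P[wu nu /eqP lu] ->; rewrite /okforest /= wu nu addn0 lu eqxx.
      by rewrite Fi' => /andP[/ltnW].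
    case=> us0 /and3P[w2 n2 /eqP l2]; rewrite /okforest /= ltnS us0 wt nt w2 n2 lt l2 /=.
    by rewrite subnKC ?eqxx // ltnW.
  case: ts => [//|t us] /= /andP[us0 /and3P[/andP[wt w2] /andP[nt n2] /eqP /= lm]].
  have t0 := wf_leaves wt.
  have u0 : 0 < sumn (map nleaves us).
    case: us us0 w2 {n2 lm} => // u us _ /= /andP[/wf_leaves wu _]; exact: leq_trans wu (leq_addr _ _).
  exists [seq t0 :: ts | t0 <- trees c (nleaves t), ts <- lists c (m - nleaves t)].
    apply: map_f; rewrite mem_iota t0 /=; lia.
  apply/allpairsP; exists (t, us); split=> //=.
    have [|_ ->] := IHk (nleaves t); first by lia.
    by rewrite wt nt eqxx.
  have lm' : m - nleaves t < k by lia.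
  have [F' T'] := IHk _ lm'.
  rewrite mem_cat; case: us us0 w2 n2 lm u0 => // u [|u' us] _ w2 n2 lm u0.
    apply/orP; left; apply: map_f; rewrite T'; move: w2 n2 lm => /=.
    rewrite !andbT addn0 => -> -> <-; by rewrite addKn eqxx.
  by apply/orP; right; rewrite F'; apply/andP; split=> //; apply/and3P; split=> //; rewrite -lm addKn.
split=> // c t; rewrite mem_cat; case: t => [l|c' ts].
  rewrite /= [X in _ || X](_ : _ = false) ?orbF; last by apply/negP => /mapP[].
  rewrite /unlabelled /nleaves /= [m == 1]eq_sym; case: (1 == m); rewrite ?andbF ?inE ?andbT //.
rewrite [X in X || _](_ : _ = false); last by case: (m == 1); rewrite ?inE //; apply/eqP.
rewrite /= unlabelled_Nd nleaves_Nd -!andbA.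
have [->|cc] := eqVneq c' (~~ c).
  by rewrite mem_map ?Fm //; [case: c|exact: Nd_inj].
have -> : (c' != c) = false by move: cc; case: c; case: c'.
by apply/negP => /mapP[us _ [E]]; rewrite E eqxx in cc.
Qed.

Lemma mem_forests c m ts : (ts \in forests c m) = (1 < size ts) && okforest c m ts.
Proof. by have [-> _] := mem_forests_gen m. Qed.

Lemma mem_trees c m t : (t \in trees c m) = [&& wf c t, unlabelled t & nleaves t == m].
Proof. by have [_ ->] := mem_forests_gen m. Qed.

Lemma uniq_trees_of c m : uniq (forests (~~ c) m) -> uniq (trees c m).
Proof.
move=> u; rewrite cat_uniq map_inj_uniq ?u ?andbT; last exact: Nd_inj.
apply/andP; split; first by case: ifP.
by apply/hasPn => x /mapP[ts _ ->]; case: ifP => //= _; rewrite inE; apply/eqP.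
Qed.

Lemma uniq_forests c m : uniq (forests c m).
Proof.
have [k] := ubnP m; elim: k c m => // k IHk c m ltk.
rewrite forestsE; apply: uniq_flatten_map; first exact: iota_uniq.
  move=> i; rewrite mem_iota => /andP[i0 li].
  have im : i < m by clear -i0 li; lia.
  have u1 : uniq (trees c i) by apply: uniq_trees_of; apply: IHk; lia.
  have u2 : uniq (lists c (m - i)).
    rewrite cat_uniq map_inj_uniq; last by move=> t t' [].
    rewrite uniq_trees_of ?IHk ?andbT /=; try lia.
    apply/hasPn => ts; rewrite mem_forests => /andP[sz _]; apply/negP => /mapP[t _ E].
    by rewrite E in sz.
  by apply: allpairs_uniq => // -[a b] [a' b'] _ _ [-> ->].
move=> i j _ _ x /allpairsP[[t ts] /= [h1 _ ->]] /allpairsP[[t' ts'] /= [h2 _ [E _]]].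
by move: h1 h2; rewrite -/(trees c i) -/(trees c j) !mem_trees => /and3P[_ _ /eqP <-] /and3P[_ _ /eqP <-]; rewrite E.
Qed.

(* The components with [j.+1] boundary vertices, one of them being the root. *)
Definition comps j : seq ptree :=
  if j == 0 then [:: Nd false [::]; Nd true [::]]
  else (if j == 1 then [:: Lf 0] else [::]) ++ map (Nd false) (forests false j) ++ map (Nd true) (forests true j).

Lemma mem_comps j t : (t \in comps j) = [&& wf_root t, unlabelled t & nleaves t == j].
Proof.
rewrite /comps; case: j => [|j] /=.
  rewrite !inE; apply/orP/idP => [|/and3P[w n l]].
    by case=> /eqP ->; rewrite unlabelled_Nd.
  case: t w n l => // c [|t ts] w n l; first by case: c {w n l}; [right|left].
  move: w l => /= /andP[_ /andP[/wf_leaves]]; rewrite nleaves_Nd /=; case: (nleaves t) => //.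
rewrite mem_cat; case: t => [l|c ts].
  rewrite [X in _ || X](_ : _ = false) ?orbF; last by rewrite mem_cat; apply/negP => /orP[] /mapP[].
  rewrite /unlabelled /nleaves /= eqSS; case: j => [|j]; rewrite ?inE ?andbF //= andbT.
  by apply/eqP/eqP => [[->]|[->]].
rewrite [X in X || _](_ : _ = false); last by case: j => [|j]; rewrite ?inE //; apply/eqP.
have -> : (Nd c ts \in [seq Nd false i | i <- forests false j.+1] ++ [seq Nd true i | i <- forests true j.+1])
   = (ts \in forests c j.+1).
  have ne b : (Nd b ts \in [seq Nd (~~ b) i | i <- forests (~~ b) j.+1]) = false.
    by apply/negP => /mapP[us _ [E _]]; case: b E.
  by rewrite mem_cat; case: c; [rewrite (ne true)|rewrite (ne false) orbF]; rewrite mem_map //; apply: Nd_inj.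
rewrite mem_forests /okforest /= unlabelled_Nd nleaves_Nd !andbA; 
have sz : all (wf c) ts -> sumn (map nleaves ts) == j.+1 -> (1 < size ts) = (size ts != 1).
  by case: (ts) => [|t [|]].
case al: (all (wf c) ts) => //=; rewrite ?andbF //.
by case sm: (sumn _ == _); rewrite ?andbF //= sz.
Qed.

Local Open Scope ring_scope.

(** * Generating series of subtrees and of components *)

Section TreeSeries.
Variables (K : fieldType) (y q : K).

(** One leaf is left out of the exponent of [q], so that prepending a child multiplies weights up to
    the factor [cwt c]: one [q] for the second leaf left out, and one [y] if the vertex is black. *)
Definition wt t : K := y ^+ excess t * q ^+ (nleaves t).-1.
Definition cwt c : K := if c then y * q else q.

Lemma wt_cons c t ts : (0 < nleaves t)%N -> (0 < size ts)%N -> (0 < sumn (map nleaves ts))%N ->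
  wt (Nd c (t :: ts)) = cwt c * (wt t * wt (Nd c ts)).
Proof.
rewrite /wt !nleaves_Nd /=; case: (nleaves t) => // a _; case: ts => [//|u ts] _.
rewrite -[(sumn _ > 0)%N]/((0 < sumn (map nleaves (u :: ts)))%N); set b := sumn _.
move=> b0; have -> : ((a.+1 + b).-1 = a + b.-1 + 1)%N by lia.
rewrite /cwt; case: c => /=; rewrite !exprD expr1; last by ring.
by rewrite exprS; ring.
Qed.

Definition Useries c : fps K := Fps (fun m => \sum_(t <- trees c m) wt t).
Definition Nseries c : fps K := Fps (fun m => \sum_(ts <- forests c m) wt (Nd c ts)).
Definition Tseries : fps K := fps_X K + Nseries false + Nseries true.

Lemma UseriesE c : Useries c = fps_X K + Nseries (~~ c).
Proof.
apply: fpsP => m; rewrite fps_coefD /= /trees /trees_from big_cat big_map /=.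
congr (_ + _); case: eqP => _; rewrite ?big_nil // big_cons big_nil addr0.
by rewrite /wt /= !expr0 mulr1.
Qed.

Lemma Nseries0 c : Nseries c 0%N = 0. Proof. by rewrite /= big_nil. Qed.
Lemma Useries0 c : Useries c 0%N = 0. Proof. by rewrite UseriesE fps_coefD Nseries0 addr0. Qed.

Lemma NseriesE c : Nseries c = fps_const (cwt c) * (Useries c * (Useries c + Nseries c)).
Proof.
apply: fpsP => m; rewrite fps_coefCM fps_coefM.
case: m => [|m]; first by rewrite big_ord1 Useries0 mul0r mulr0 Nseries0.
(* The extreme terms of the convolution vanish, in accordance with the range [iota 1 m.-1] in
   [forests_from]. *)
rewrite big_ord_recl Useries0 mul0r add0r big_ord_recr /=.
rewrite [bump 0 m]/bump leq0n add1n subnn !big_nil addr0 mulr0 addr0.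
rewrite forestsE /forests_from big_flatten big_map.
rewrite -(big_mkord xpredT (fun i => (\sum_(t <- trees c (bump 0 i)) wt t) * 
   (\sum_(t <- trees c (m.+1 - bump 0 i)%N) wt t + \sum_(ts <- forests c (m.+1 - bump 0 i)%N) wt (Nd c ts)))).
rewrite -[iota 1 m.+1.-1]/(iota (1 + 0) m) iotaDl big_map mulr_sumr /index_iota subn0.
apply: eq_bigr => i _; rewrite big_allpairs_dep big_distrl mulr_sumr big_seq [RHS]big_seq /=.
apply: eq_bigr => t; rewrite -/(trees _ _) mem_trees => /and3P[wt_t _ _].
rewrite -/(lists _ _) [in RHS]mulrDr mulrDr !mulr_sumr /lists /lists_from big_cat big_map /=.
have t0 := wf_leaves wt_t.
congr (_ + _); rewrite big_seq [RHS]big_seq; apply: eq_bigr => u.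
  rewrite -/(trees _ _) mem_trees => /and3P[wu _ _]; have u0 := wf_leaves wu.
  rewrite wt_cons //= ?addn0 //; congr (_ * (_ * _)).
  (* Lists of one child are not in [forests], but [wt] gives a vertex with one child the weight of
     that child. *)
  by rewrite /wt nleaves_Nd /= !addn0; case: (c).
rewrite mem_forests => /andP[sz /and3P[wu _ _]].
rewrite wt_cons //; first exact: ltnW.
by case: u sz wu => // u us _ /= /andP[/wf_leaves wu _]; apply: leq_trans wu (leq_addr _ _).
Qed.

Lemma TseriesE c : Tseries = Useries c + Nseries c.
Proof. by rewrite /Tseries UseriesE; case: c => //=; rewrite addrAC. Qed.

Lemma Tseries0 : Tseries 0%N = 0.
Proof. by rewrite (TseriesE true) fps_coefD Useries0 Nseries0 addr0. Qed.

Lemma UTseries c : Useries c * (1 + fps_const (cwt c) * Tseries) = Tseries.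
Proof. by rewrite {2}(TseriesE c) [in RHS]NseriesE -(TseriesE c); ring. Qed.

(** Eliminates both [Useries] from the two instances of [UTseries] and from their sum, which is x +
    T because the single leaf is counted in both. *)
Lemma Tseries_eq : fps_X K * ((1 + fps_const q * Tseries) * (1 + fps_const (y * q) * Tseries)) =
  Tseries * (1 - fps_const q ^+ 2 * fps_const y * Tseries ^+ 2).
Proof.
have E1 := UTseries true; have E0 := UTseries false; rewrite /cwt in E0 E1.
have ET : Useries true + Useries false = fps_X K + Tseries.
  by rewrite !UseriesE /Tseries /=; ring.
have {ET} -> : fps_X K = Useries true + Useries false - Tseries by rewrite ET addrK.
rewrite rmorphM /= in E1 *.
move: E0 E1; move: (Useries true) (Useries false) Tseries => u v t E0 E1.
transitivity ((u * (1 + fps_const y * fps_const q * t)) * (1 + fps_const q * t) + 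
   (v * (1 + fps_const q * t)) * (1 + fps_const y * fps_const q * t) - 
   t * ((1 + fps_const q * t) * (1 + fps_const y * fps_const q * t))); first by ring.
by rewrite E0 E1; ring.
Qed.

(** A component with leaves is a tree of [Tseries] hung from its root; [khel] and [nleaves] exceed
    the exponents in [wt] by one, whence [y * q]. Without leaves there are the two lollipops, giving
    [1 + y]. *)
Lemma sum_comps j : \sum_(t <- comps j) y ^+ khel t * q ^+ nleaves t = 
  (if j == 0%N then 1 + y else 0) + y * q * Tseries j.
Proof.
case: j => [|j]; first by rewrite Tseries0 mulr0 addr0 /= !big_cons big_nil /= addr0 !expr0 expr1 !mulr1 addrC.
rewrite /comps add0r -[Tseries _]/(fps_X K j.+1 + Nseries false j.+1 + Nseries true j.+1) /=.
rewrite !big_cat !big_map /= !mulrDr -!addrA !mulr_sumr.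
have sz c ts : ts \in forests c j.+1 -> y ^+ khel (Nd c ts) * q ^+ nleaves (Nd c ts) = y * q * wt (Nd c ts).
  rewrite mem_forests => /andP[sz /and3P[_ _ /eqP lv]]; rewrite /wt nleaves_Nd lv /= .
  by case: c => /=; case: ts sz {lv} => // t ts _; rewrite !exprS; ring.
congr (_ + (_ + _)).
- rewrite eqSS; case: j {sz} => [|j] /=; rewrite ?big_nil ?mulr0 // big_cons big_nil addr0 !expr1 mulr1 //.
- by rewrite big_seq [RHS]big_seq; apply: eq_bigr => ts /sz.
by rewrite big_seq [RHS]big_seq; apply: eq_bigr => ts /sz.
Qed.

End TreeSeries.

(** * Lagrange inversion for formal power series *)

Section Lagrange.
Variable K : fieldType.
Implicit Types (f g h : fps K).
Local Notation X := (fps_X K).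

Definition fps_deriv f : fps K := Fps (fun n => n.+1%:R * f n.+1).

Lemma fps_derivM f g : fps_deriv (f * g) = fps_deriv f * g + f * fps_deriv g.
Proof.
apply: fpsP => n; rewrite fps_coefD [LHS]/= !fps_coefM mulr_sumr.
transitivity (\sum_(i < n.+2) i%:R * f i * g (n.+1 - i)%N + \sum_(i < n.+2) f i * ((n.+1 - i)%:R * g (n.+1 - i)%N)).
  rewrite -big_split /=; apply: eq_bigr => i _.
  have {1}-> : (n.+1 = i + (n.+1 - i))%N by rewrite subnKC // -ltnS.
  by rewrite natrD; ring.
congr (_ + _).
  by rewrite big_ord_recl !mul0r add0r; apply: eq_bigr => i _; rewrite /= subSS.
rewrite big_ord_recr /= subnn mul0r mulr0 addr0; apply: eq_bigr => i _.
by rewrite subSn // -ltnS.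
Qed.

Lemma fps_derivX : fps_deriv X = 1.
Proof. by apply: fpsP => -[|n]; rewrite fps_coef1 /= ?mulr1 ?mulr0. Qed.

Lemma fps_derivXn f n : fps_deriv (f ^+ n.+1) = f ^+ n * fps_deriv f *+ n.+1.
Proof.
elim: n => [|n IHn]; first by rewrite expr0 mul1r expr1.
by rewrite exprS fps_derivM IHn [in RHS]mulrS mulrnAr mulrA -exprS mulrC.
Qed.

Lemma fps_coefMn f m n : (f *+ m) n = f n *+ m.
Proof. by elim: m => [|m IHm]; rewrite ?mulr0n ?fps_coef0 // !mulrS fps_coefD IHm. Qed.

Lemma fps_coefXnM f m n : (X ^+ m * f) (n + m)%N = f n.
Proof.
elim: m => [|m IHm]; first by rewrite mul1r addn0.
by rewrite exprS -mulrA addnS fps_coefXM.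
Qed.

Hypothesis char0 : forall n, (n.+1%:R : K) != 0.

(** With [phi] as X / f, this is the residue of f' / f^(m+1), the residue of a derivative unless m =
    0. Characteristic 0 allows the division by m. *)
Lemma coef_derivXn (phi f : fps K) m : phi 0%N = 1 -> f * phi = X ->
  (phi ^+ m.+1 * fps_deriv f) m = (m == 0%N)%:R.
Proof.
move=> phi0 fphi.
have df : fps_deriv f * phi + f * fps_deriv phi = 1 by rewrite -fps_derivM fphi fps_derivX.
have df2 : phi ^+ 2 * fps_deriv f = phi - X * fps_deriv phi.
  by rewrite -[in RHS]fphi -[phi in X in X - _]mul1r -df; ring.
case: m => [|m].
  rewrite expr1; have := congr1 (fun u : fps K => u 0%N) df.
  rewrite fps_coefD !fps_coefM0 fps_coef1 phi0 => <-.
  have -> : f 0%N = 0 by have := congr1 (fun u : fps K => u 0%N) fphi; rewrite fps_coefM0 phi0 mulr1.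
  by rewrite mulr1 mul1r mul0r addr0.
rewrite exprSr exprSr -mulrA -mulrA [phi * _]mulrA -expr2 df2 mulrBr fps_coefB -exprSr.
have h := congr1 (fun u : fps K => u m) (fps_derivXn phi m).
rewrite fps_coefMn -mulr_natl in h.
have {}h : (phi ^+ m.+1) m.+1 = (phi ^+ m * fps_deriv phi) m := mulfI (char0 m) h.
by rewrite mulrCA fps_coefXM h subrr.
Qed.

(* The classical proof with residues, made polynomial: differentiating [g(f) = x]
   and multiplying by [phi ^+ n.+1] kills all terms but the last. *)
Lemma lagrange_inversion (phi g f : fps K) n : phi 0%N = 1 -> f * phi = X -> fps_comp g f = X ->
  g n.+1 = n.+1%:R^-1 * (phi ^+ n.+1) n.
Proof.
move=> phi0 fphi gf.
have f0 : f 0%N = 0.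
  have := congr1 (fun u : fps K => u 0%N) fphi.
  by rewrite fps_coefM0 phi0 mulr1.
have sum1 m : (m <= n)%N -> (1 : fps K) m = \sum_(i < n.+1) g i.+1 * fps_deriv (f ^+ i.+1) m.
  move=> lm; have -> : (1 : fps K) m = m.+1%:R * fps_comp g f m.+1 by rewrite gf -fps_derivX.
  rewrite (@fps_comp_widen _ n.+2) // big_ord_recl expr0 fps_coef1 mulr0 add0r mulr_sumr.
  by apply: eq_bigr => i _; rewrite mulrCA.
have -> : (phi ^+ n.+1) n = g n.+1 * n.+1%:R; last by rewrite mulrCA mulVf ?mulr1.
rewrite -[phi ^+ _]mul1r fps_coefM.
transitivity (\sum_(i < n.+1) g i.+1 * (fps_deriv (f ^+ i.+1) * phi ^+ n.+1) n).
  transitivity (\sum_(m < n.+1) \sum_(i < n.+1) g i.+1 * (fps_deriv (f ^+ i.+1) m * (phi ^+ n.+1) (n - m)%N)).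
    apply: eq_bigr => m _; rewrite sum1 -1?ltnS // mulr_suml.
    by apply: eq_bigr => i _; rewrite mulrA.
  by rewrite exchange_big; apply: eq_bigr => i _; rewrite -mulr_sumr.
(* The factor [f ^+ i] turns [i] of the factors [phi] into [X ^+ i]; what is left vanishes by
   [coef_derivXn] unless [i = n]. *)
have step (i : 'I_n.+1) : (fps_deriv (f ^+ i.+1) * phi ^+ n.+1) n = (n - i == 0)%N%:R *+ i.+1.
  have lin : (i <= n)%N by rewrite -ltnS.
  rewrite fps_derivXn mulrnAl fps_coefMn; congr (_ *+ _).
  rewrite -(coef_derivXn (n - i) phi0 fphi).
  have -> : f ^+ i * fps_deriv f * phi ^+ n.+1 = X ^+ i * (phi ^+ (n - i).+1 * fps_deriv f).
    have -> : phi ^+ n.+1 = phi ^+ i * phi ^+ (n - i).+1 by rewrite -exprD addnS subnKC.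
    by rewrite -fphi exprMn -!mulrA; congr (_ * _); rewrite mulrCA; congr (_ * _); rewrite mulrC.
  by have := fps_coefXnM (phi ^+ (n - i).+1 * fps_deriv f) i (n - i); rewrite subnK.
rewrite (eq_bigr _ (fun i _ => congr1 ( *%R _) (step i))).
rewrite big_ord_recr /= subnn eqxx big1 ?add0r // => i _.
by rewrite subn_eq0 leqNgt ltn_ord mul0rn mulr0.
Qed.

Lemma fps_compD f g h : fps_comp (f + g) h = fps_comp f h + fps_comp g h.
Proof. by apply: fpsP => n; rewrite fps_coefD /= -big_split; apply: eq_bigr => i _; rewrite /= mulrDl. Qed.

Lemma fps_compC c h : fps_comp (fps_const c) h = fps_const c.
Proof.
apply: fpsP => n /=; rewrite big_ord_recl expr0 fps_coef1 big1 /= ?addr0.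
  by case: n => [|n]; rewrite /= ?mulr1 ?mulr0.
by move=> i _; rewrite mul0r.
Qed.

Lemma fps_X_inj f g : X * f = X * g -> f = g.
Proof.
move=> E; apply: fpsP => n; have := congr1 (fun u : fps K => u n.+1) E.
by rewrite !fps_coefXM.
Qed.

Lemma coefM_comp f g h n : g 0%N = 0 ->
  (h * fps_comp f g) n = \sum_(j < n.+1) f j * (h * g ^+ j) n.
Proof.
move=> g0; rewrite fps_coefM.
transitivity (\sum_(i < n.+1) \sum_(j < n.+1) f j * (h i * (g ^+ j) (n - i)%N)).
  apply: eq_bigr => i _; rewrite (@fps_comp_widen _ n.+1) ?ltnS ?leq_subr // mulr_sumr.
  by apply: eq_bigr => j _; rewrite mulrCA.
by rewrite exchange_big; apply: eq_bigr => j _; rewrite -mulr_sumr.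
Qed.

End Lagrange.

Section Inverse.
Variables (K : fieldType) (y q : K).
Local Notation X := (fps_X K).
Local Notation Y := (fps_const y).
Local Notation Q := (fps_const q).
Local Notation T := (Tseries y q).
Local Notation C := (X * (1 - Q ^+ 2 * X ^+ 2 * Y) / ((1 + X * Q) * (1 + X * Y * Q))).

Lemma comp_Tseries : fps_comp C T = X.
Proof.
have T0 : T 0%N = 0 := Tseries0 y q.
pose D : fps K := (1 + X * Q) * (1 + X * Y * Q).
have D0 : D 0%N = 1.
  by rewrite fps_coefM0 !fps_coefD -mulrA !fps_coefXM fps_coef1 !addr0 mulr1.
have UD : D \is a GRing.unit by rewrite fps_unitE D0 oner_eq0.
have CD : C * D = X * (1 - Q ^+ 2 * X ^+ 2 * Y) by rewrite -/D divrK.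
have cX : fps_comp X T = T by apply: fps_compX.
have cD : fps_comp D T = (1 + Q * T) * (1 + fps_const (y * q) * T).
  rewrite /D fps_compM // !fps_compD !fps_comp1 !fps_compM // !fps_compC cX rmorphM /=.
  by ring.
have cN : fps_comp (X * (1 - Q ^+ 2 * X ^+ 2 * Y)) T = T * (1 - Q ^+ 2 * Y * T ^+ 2).
  have -> : 1 - Q ^+ 2 * X ^+ 2 * Y = 1 + fps_const (- q ^+ 2 * y) * X ^+ 2.
    by rewrite rmorphM rmorphN rmorphXn /=; ring.
  rewrite fps_compM // fps_compD fps_comp1 fps_compM // fps_compXn // fps_compC cX.
  by rewrite rmorphM rmorphN rmorphXn /=; ring.
have UD' : fps_comp D T \is a GRing.unit by rewrite fps_unitE fps_comp_coef0 D0 oner_eq0.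
apply: (mulIr UD'); rewrite -fps_compM // CD cN cD; exact/esym/Tseries_eq.
Qed.

(** By [comp_Tseries] the series T is a right inverse; composing with the two-sided inverse given by
    [fps_compinvP] identifies them. *)
Lemma compinv_Tseries : fps_compinv C = T.
Proof.
have C0 : C 0%N = 0 by rewrite -mulrA fps_XM0.
have [g0 _ gC] : is_compinv C (fps_compinv C).
  by apply: fps_compinvP => //; rewrite -mulrA; apply: Cseries_coef1.
transitivity (fps_comp (fps_compinv C) (fps_comp C T)); first by rewrite comp_Tseries fps_comp_X.
by rewrite fps_compA ?Tseries0 // gC fps_compX ?Tseries0.
Qed.
End Inverse.

(** * Words of given length and starting height, and their series *)

Fixpoint words n h : seq (seq (option ptree)) :=
  if n is n'.+1 then
    (if h is h'.+1 then map (cons None) (words n' h') else [::]) ++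
    flatten [seq [seq Some t :: w | t <- comps j, w <- words n' (j + h)] | j <- iota 0 n]
  else if h == 0%N then [:: [::]] else [::].

Lemma wordsS n h : words n.+1 h = 
  (if h is h'.+1 then map (cons None) (words n h') else [::]) ++
  flatten [seq [seq Some t :: w | t <- comps j, w <- words n (j + h)] | j <- iota 0 n.+1].
Proof. by []. Qed.

(** The bound on [j] in [words] loses nothing: by [hrun_size] every leaf of a tree needs a later
    letter that pops it. *)
Lemma mem_words n h w : (w \in words n h) = 
  [&& size w == n, hrun h w, wf_word w & wunlabel w == w].
Proof.
elim: n h w => [|n IHn] h w.
  by case: w => [|o w]; case: h => [|h] //=.
rewrite wordsS mem_cat; case: w => [|[t|] w].
- rewrite [X in X || _](_ : _ = false); last by case: h => // h; apply/negP => /mapP[].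
  by rewrite orFb; apply: negbTE; apply/negP => /flattenP[s /mapP[j _ ->] /allpairsP[[t w] []]].
- rewrite [X in X || _](_ : _ = false); last by case: h => // h; apply/negP => /mapP[? _ []].
  rewrite orFb [RHS]/= eqSS /wunlabel [RHS]/= eqseq_cons.
  have -> : (Some (unlabel t) == Some t) = unlabelled t by apply/eqP/eqP => [[->]|->].
  apply/flattenP/idP => [[s /mapP[j _ ->] /allpairsP[[t' w'] /= [tj wj [-> ->]]]]|].
    move: tj wj; rewrite mem_comps IHn => /and3P[-> -> /eqP ->] /and4P[-> -> -> ->] //.
  case/and4P=> sw hw /andP[wt ww] /andP[nt nw].
  exists [seq Some t0 :: w0 | t0 <- comps (nleaves t), w0 <- words n (nleaves t + h)].
    apply: (map_f (fun j => [seq Some t0 :: w0 | t0 <- comps j, w0 <- words n (j + h)])).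
    rewrite (mem_iota 0 n.+1) /= add0n ltnS -(eqP sw).
    by have := hrun_size hw; lia.
  apply/allpairsP; exists (t, w) => /=; split=> //; first by rewrite mem_comps wt nt eqxx.
  by rewrite IHn sw hw [wf_word w]ww.
rewrite [X in _ || X](_ : _ = false) ?orbF; last first.
  by apply/negP => /flattenP[s /mapP[j _ ->] /allpairsP[[t' w'] /= [_ _]]].
rewrite /= eqSS /wunlabel /= eqseq_cons eqxx /=; case: h => [|h]; first by rewrite andbF.
by rewrite mem_map ?IHn // => u v [].
Qed.

Lemma uniq_comps j : uniq (comps j).
Proof.
rewrite /comps; case: ifP => _ /=; first by rewrite inE andbT; apply/eqP.
rewrite cat_uniq cat_uniq !map_inj_uniq ?uniq_forests; try exact: Nd_inj.
apply/and3P; split; first by case: ifP.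
  apply/hasPn => t; rewrite mem_cat => /orP[] /mapP[ts _ ->]; case: ifP => //= _; rewrite inE; exact/eqP.
rewrite andbT /=; apply/hasPn => t /mapP[ts _ ->]; apply/negP => /mapP[us _ []] //.
Qed.

Lemma uniq_words n h : uniq (words n h).
Proof.
elim: n h => [|n IHn] h; first by rewrite /=; case: ifP.
rewrite wordsS cat_uniq; apply/and3P; split.
- by case: h => // h; rewrite map_inj_uniq ?IHn // => u v [].
- apply/hasPn => w /flattenP[s /mapP[j _ ->] /allpairsP[[t' w'] /= [_ _ ->]]].
  by case: h => // h; apply/negP => /mapP[].
apply: (@uniq_flatten_map _ _ (fun j => [seq Some t :: w | t <- comps j, w <- words n (j + h)]) (iota 0 n.+1)).
- exact: iota_uniq.
- move=> j _; apply: allpairs_uniq; rewrite ?uniq_comps ?IHn //.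
  by move=> [a b] [a' b'] _ _ /= [-> ->].
move=> i j _ _ w /allpairsP[[t u] /= [ti _ ->]] /allpairsP[[t' u'] /= [tj _ [E _]]].
by move: ti tj; rewrite !mem_comps E => /and3P[_ _ /eqP <-] /and3P[_ _ /eqP <-].
Qed.

Section WordSeries.
Variables (K : fieldType) (y q : K) (P F : fps K).
Local Notation X := (fps_X K).
Hypothesis P0 : P 0%N = 0.
Hypothesis PS : forall j, P j.+1 = \sum_(t <- comps j) y ^+ khel t * q ^+ nleaves t.
Hypothesis FE : F = 1 + fps_comp P (X * F).

Definition wword (w : seq (option ptree)) : K := y ^+ whel w * q ^+ wleaves w.

(** Multiplying [FE] by (xF)^h sorts the words by their first letter: (xF)^h = x (xF)^(h-1) F is a
    pop when h > 0, and the j-th term x P_{j+1} (xF)^(j+h) F is a tree with j leaves. For h = 0 the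
    term 1 is the empty word. *)
Lemma sum_words n h : \sum_(w <- words n h) wword w = ((X * F) ^+ h * F) n.
Proof.
have g0 : (X * F) 0%N = 0 by rewrite fps_XM0.
have F0 : F 0%N = 1 by rewrite FE fps_coefD fps_comp_coef0 P0 fps_coef1 addr0.
have PE : P = X * fps_divX P by rewrite fps_divXK.
have PF : fps_comp P (X * F) = X * (F * fps_comp (fps_divX P) (X * F)).
  by rewrite {1}PE fps_compM // fps_compX // mulrA.
elim: n h => [|n IHn] h.
  case: h => [|h]; rewrite [words _ _]/=; last by rewrite big_nil exprS -!mulrA fps_XM0.
  by rewrite big_cons big_nil addr0 mul1r F0 /wword /whel /wleaves !big_nil !expr0 mulr1.
have -> : ((X * F) ^+ h * F) n.+1 = (if h is h'.+1 then ((X * F) ^+ h' * F) n else 0) +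
    ((X * F) ^+ h * F * fps_comp (fps_divX P) (X * F)) n.
  have E : (X * F) ^+ h * F = (X * F) ^+ h + X * ((X * F) ^+ h * F * fps_comp (fps_divX P) (X * F)).
    by rewrite {2}FE PF mulrDr mulr1; congr (_ + _); ring.
  rewrite [in LHS]E fps_coefD fps_coefXM; congr (_ + _).
  case: h {E} => [|h]; first by rewrite expr0 fps_coef1.
  by rewrite exprS mulrAC -mulrA fps_coefXM mulrC.
rewrite coefM_comp // wordsS big_cat; congr (_ + _).
  case: h => [|h]; first by rewrite big_nil.
  by rewrite big_map -IHn; apply: eq_bigr => w _; rewrite /wword /whel /wleaves !big_cons !add0n.
rewrite big_flatten big_map -[X in iota _ X]subn0 -/(index_iota 0 n.+1) big_mkord.
apply: eq_bigr => j _; rewrite big_allpairs_dep.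
rewrite mulrAC -exprD addnC -IHn /= PS mulr_suml big_seq [RHS]big_seq; apply: eq_bigr => t.
rewrite mem_comps => /and3P[_ _ /eqP lt]; rewrite mulr_sumr; apply: eq_bigr => w _.
by rewrite /wword /whel /wleaves !big_cons !exprD; ring.
Qed.
End WordSeries.

(** * Isotopy classes counted by words *)

Lemma wf_unlabel c t : wf c (unlabel t) = wf c t.
Proof.
elim: t c => //= c ts IH c'; rewrite size_map all_map; congr [&& _, _ & _].
by apply: eq_in_all => t /IH /= ->.
Qed.

Lemma wf_root_unlabel t : wf_root (unlabel t) = wf_root t.
Proof.
case: t => //= c ts; rewrite size_map all_map; congr (_ && _).
by apply: eq_all => t /=; rewrite wf_unlabel.
Qed.

Lemma wf_word_unlabel w : wf_word (wunlabel w) = wf_word w.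
Proof. by rewrite /wf_word all_map; apply: eq_all => -[t|] //=; rewrite wf_root_unlabel. Qed.

Lemma number_by_words (Q : disk_graph -> Prop) (L : seq (seq (option ptree))) : uniq L ->
  (forall G, Q G -> [/\ prePlanar G, planar G & wunlabel (hword G) \in L]) ->
  (forall w, w \in L -> exists2 G, Q G & wunlabel (hword G) = w) ->
  number_up_to_isotopy Q (size L).
Proof.
move=> uL QL LQ.
have ex (i : 'I_(size L)) : exists G, Q G /\ wunlabel (hword G) = nth [::] L i.
  by have [G QG E] := LQ _ (mem_nth [::] (ltn_ord i)); exists G.
have [G GP] := choice ex; exists G; split=> [i|i j|H QH].
- by have [] := GP i.
- have [Qi Ei] := GP i; have [Qj Ej] := GP j.
  have [fi _ _] := QL _ Qi; have [fj _ _] := QL _ Qj.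
  move/(isotopic_hword fi fj) => E; apply/val_inj/eqP.
  by rewrite /= -(nth_uniq [::] _ _ uL) ?ltn_ord // -Ei -Ej E.
have [fH pH HL] := QL _ QH.
have lt : (index (wunlabel (hword H)) L < size L)%N by rewrite index_mem.
exists (Ordinal lt); have [Qi Ei] := GP (Ordinal lt); have [fi pi _] := QL _ Qi.
by apply: same_word_isotopic => //; rewrite Ei /= nth_index.
Qed.

Lemma realize_word n w : w \in words n 0 ->
  exists2 G, contracted_plabic_forest G & wunlabel (hword G) = w.
Proof.
rewrite mem_words => /and4P[_ hw ww /eqP uw].
have [S [w' [S0 Ew r]]] := hrun_fill 0 hw.
rewrite (size0nil S0) in r.
have [|G [fG pG E]] := realize_run _ r; first by rewrite -wf_word_unlabel Ew uw.
by exists G; [apply/contracted_plabic_forestP|rewrite E Ew].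
Qed.

Lemma forest_word G : contracted_plabic_forest G ->
  [/\ prePlanar G, planar G & wunlabel (hword G) \in words (nbd G) 0].
Proof.
move/contracted_plabic_forestP=> [fG pG]; split=> //.
rewrite mem_words size_map size_hword eqxx hword_hrun //= wf_word_unlabel [wf_word _](hword_wf fG) /=.
apply/eqP; rewrite /wunlabel -map_comp; apply: eq_map => -[t|] //=; congr Some.
by elim: t => //= c ts IH; congr (Nd _ _); rewrite -map_comp; apply/eq_in_map => t /IH.
Qed.

Lemma has_typeE G (k n : int) : prePlanar G -> planar G ->
  has_type G k n <-> (Posz (whel (wunlabel (hword G))) = k /\ Posz (nbd G) = n).
Proof.
move=> fG pG; rewrite /has_type helicityE // wunlabel_hel.
split=> -[h1 h2]; split=> //; last by rewrite -h1.
by apply: (@intr_inj rat); rewrite -h1.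
Qed.

Lemma coef_yq_sum (A : Type) (L : seq A) (a b : A -> nat) (k r : int) :
  coef_yq (\sum_(x <- L) 'X^(a x) * ('X^(b x))%:P) k r =
  (count (fun x => (Posz (a x) == k) && (Posz (b x) == r)) L)%:R.
Proof.
case: k => [k|k]; last by rewrite /= (eq_count (a2 := pred0)) ?count_pred0.
case: r => [r|r]; last by rewrite /= (eq_count (a2 := pred0)) ?count_pred0 // => x; rewrite andbF.
rewrite /coef_yq coef_sum coef_sum -sum1_count natr_sum [RHS]big_mkcond /=; apply: eq_bigr => x _.
rewrite coefMC coefXn eqz_nat [_ == k]eq_sym; case: (k == a x) => /=; last by rewrite mul0r coef0.
by rewrite mul1r coefXn eqz_nat eq_sym; case: eqP.
Qed.

Lemma Qyq_char0 n : (n.+1%:R : Qyq) != 0.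
Proof.
have -> : (n.+1%:R : Qyq) = tofracQ n.+1%:R by rewrite /tofracQ rmorph_nat.
rewrite /tofracQ tofrac_eq0 -(rmorph_nat (@polyC {poly rat})) polyC_eq0.
by rewrite -(rmorph_nat (@polyC rat)) polyC_eq0 pnatr_eq0.
Qed.

Definition yQ : Qyq := tofracQ 'X.
Definition qQ : Qyq := tofracQ 'X%:P.

Lemma tofracQ_sum (A : Type) (L : seq A) (a b : A -> nat) :
  tofracQ (\sum_(x <- L) 'X^(a x) * ('X^(b x))%:P) = \sum_(x <- L) yQ ^+ a x * qQ ^+ b x.
Proof.
rewrite /tofracQ rmorph_sum; apply: eq_bigr => x _.
by rewrite rmorphM rmorphXn /= polyC_exp rmorphXn.
Qed.

Lemma Cseries_inverse : fps_compinv Cseries = Tseries yQ qQ.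
Proof. exact: compinv_Tseries. Qed.

Lemma Ptree0 : Ptree 0%N = 0. Proof. by rewrite fps_XM0. Qed.

Lemma PtreeS j : Ptree j.+1 = \sum_(t <- comps j) yQ ^+ khel t * qQ ^+ nleaves t.
Proof.
have h (K : fieldType) (c : K) : (1 + fps_const c) j = if j == 0%N then 1 + c else 0.
  by rewrite fps_coefD fps_coef1 /=; case: j => [|j] /=; rewrite ?addr0.
by rewrite sum_comps /Ptree fps_coefXM Cseries_inverse fps_coefD -rmorphM fps_coefCM h.
Qed.

(** Composing x / (1 + P) with its inverse gives x; clear the denominator and cancel x. *)
Lemma PforestP : Pforest = 1 + fps_comp Ptree (vx * Pforest).
Proof.
have [g0 fg _] := Ptree_compinv; rewrite -PforestE in g0 fg.
have U : 1 + Ptree \is a GRing.unit.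
  by rewrite fps_unitE fps_coefD fps_coef1 Ptree0 addr0 oner_eq0.
have := congr1 (fun u => u * fps_comp (1 + Ptree) (vx * Pforest)) fg.
rewrite -fps_compM // divrK // fps_compX // fps_compD fps_comp1.
exact: fps_X_inj.
Qed.

Definition tree_word j t : seq (option ptree) := Some t :: nseq j None.

Lemma tree_word_stats j t :
  [/\ whel (tree_word j t) = khel t, wleaves (tree_word j t) = nleaves t & wtrees (tree_word j t) = 1%N].
Proof.
rewrite /whel /wleaves /wtrees /= !big_cons; split; last by rewrite count_nseq.
  by rewrite big1_seq ?addn0 // => o /andP[_ /nseqP[->]].
by rewrite big1_seq ?addn0 // => o /andP[_ /nseqP[->]].
Qed.

(** At height 0 nothing can be popped, so the word opens with its only tree; the other letters are
    pops, as many as the tree has leaves. *)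
Lemma tree_wordP j w : (w \in words j.+1 0) && (wtrees w == 1%N) = 
  (w \in map (tree_word j) (comps j)).
Proof.
apply/andP/mapP => [[wj /eqP w1]|[t tj ->]]; last first.
  have [_ _ ->] := tree_word_stats j t; split=> //; move: tj.
  rewrite mem_comps mem_words => /and3P[wt nt /eqP lt]; apply/and4P; split.
  - by rewrite /= size_nseq.
  - by rewrite /= lt addn0; elim: (j).
  - by rewrite /wf_word /= wt all_nseq orbT.
  by apply/eqP; rewrite /wunlabel /= (eqP nt) map_nseq.
move: wj; rewrite mem_words => /and4P[/eqP sw hw ww /eqP uw].
have hs := hrun_size hw.
case: w w1 sw hw ww uw hs => [//|[t|] w] // [w1] [sw] hw /andP[wt _] [ut _] hs.
have Ew : w = nseq j None.
  rewrite -sw; move/eqP: w1; rewrite -leqn0 leqNgt -has_count -all_predC; elim: w {sw hw hs} => //= -[] //= w IH /IH <-; rewrite ?size_nseq //.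
exists t; last by rewrite Ew.
rewrite mem_comps wt /unlabelled ut eqxx /=.
have [_ El Et] := tree_word_stats j t; rewrite Ew -/(tree_word j t) El Et /= size_nseq in hs.
by apply/eqP; lia.
Qed.

Theorem theorem3p15 :
  (forall n k r : int, exists2 N : nat,
     number_up_to_isotopy
       (fun G => [/\ contracted_plabic_tree G, has_type G k n & mdim G = r]) N &
     has_coef Ptree n k r N%:R) /\
  (forall n k r : int, exists2 N : nat,
     number_up_to_isotopy
       (fun G => [/\ contracted_plabic_forest G, has_type G k n & mdim G = r]) N &
     has_coef Pforest n k r N%:R) /\
  (forall n : nat, Pforest n = n.+1%:R^-1 * ((1 + Ptree) ^+ n.+1) n).
Proof.
have coef0 k r : coef_yq 0 k r = 0 by case: k => [k|k]; case: r => [r|r]; rewrite /= ?coef0.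
split; [|split].
- move=> n k r; case: n => [[|j]|n].
  (* Without boundary vertices the graph is empty; it has no component and so is not connected. *)
  + exists 0%N; last by exists 0; rewrite ?coef0 // Ptree0 /tofracQ rmorph0.
    apply: (@number_by_words _ [::]) => // G [[fG cG] tG _].
    have [pG plG _] := forest_word fG.
    have := cG; rewrite connectedE //; move: tG => /(has_typeE _ _ pG plG) [_ [n0]].
    by rewrite /hword; move: n0; rewrite /nbd; case: (bds G).
  + pose cond t := (Posz (khel t) == k) && (Posz (nleaves t) == r).
    exists (size [seq tree_word j t | t <- comps j & cond t]); last first.
      exists (\sum_(t <- comps j) 'X^(khel t) * ('X^(nleaves t))%:P).
        by rewrite tofracQ_sum PtreeS.
      by rewrite coef_yq_sum size_map size_filter.
    apply: number_by_words.
    * by rewrite map_inj_uniq ?filter_uniq ?uniq_comps // => t t' [].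
    * move=> G [[fG cG] tG mG]; have [pG plG wG] := forest_word fG; split=> //.
      have /(has_typeE _ _ pG plG) [hk [hn]] := tG.
      rewrite hn in wG; rewrite connectedE // -wunlabel_trees in cG.
      have := tree_wordP j (wunlabel (hword G)); rewrite wG cG => /esym/mapP[t tj Ew].
      have [Eh El _] := tree_word_stats j t.
      rewrite Ew map_f // mem_filter tj andbT /cond -hk -mG mdimE // Ew Eh.
      by rewrite -wunlabel_leaves Ew El !eqxx.
    move=> w /mapP[t]; rewrite mem_filter => /andP[/andP[/eqP hk /eqP hr] tj Ew].
    have [Eh El Et] := tree_word_stats j t.
    have /andP[wj _] : (w \in words j.+1 0) && (wtrees w == 1%N) by rewrite tree_wordP Ew map_f.
    have [G fG EG] := realize_word wj; exists G => //.
    have [pG plG wG] := forest_word fG; split.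
    * by split; rewrite // connectedE // -wunlabel_trees EG Ew Et.
    * apply/has_typeE => //; rewrite EG Ew Eh; split=> //; congr Posz.
      by move: wj; rewrite -EG mem_words size_map size_hword => /and4P[/eqP].
    by rewrite mdimE // -wunlabel_leaves EG Ew El.
  exists 0%N; last by exists 0; rewrite ?coef0 // /tofracQ rmorph0.
  by apply: (@number_by_words _ [::]) => // G [_ [_]].
- move=> n k r; case: n => [n|n]; last first.
    exists 0%N; last by exists 0; rewrite ?coef0 // /tofracQ rmorph0.
    by apply: (@number_by_words _ [::]) => // G [_ [_]].
  pose cond w := (Posz (whel w) == k) && (Posz (wleaves w) == r).
  exists (size [seq w <- words n 0 | cond w]); last first.
    exists (\sum_(w <- words n 0) 'X^(whel w) * ('X^(wleaves w))%:P).
      have := sum_words Ptree0 PtreeS PforestP n 0; rewrite expr0 mul1r => <-.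
      by rewrite tofracQ_sum.
    by rewrite coef_yq_sum size_filter.
  apply: number_by_words.
  + by rewrite filter_uniq ?uniq_words.
  + move=> G [fG tG mG]; have [pG plG wG] := forest_word fG; split=> //.
    have /(has_typeE _ _ pG plG) [hk [hn]] := tG.
    by rewrite mem_filter -hn wG andbT /cond hk -mG mdimE // wunlabel_leaves !eqxx.
  move=> w; rewrite mem_filter => /andP[/andP[/eqP hk /eqP hr] wn].
  have [G fG Ew] := realize_word wn; exists G => //.
  have [pG plG wG] := forest_word fG; split=> //.
    apply/has_typeE => //; rewrite Ew; split=> //; congr Posz.
    by move: wn; rewrite -Ew mem_words size_map size_hword => /and4P[/eqP].
  by rewrite mdimE // -wunlabel_leaves Ew.
move=> n; have [g0 fg gf] := Ptree_compinv.
have U : 1 + Ptree \is a GRing.unit.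
  by rewrite fps_unitE fps_coefD fps_coef1 Ptree0 addr0 oner_eq0.
have phi0 : (1 + Ptree) 0%N = 1 by rewrite fps_coefD fps_coef1 Ptree0 addr0.
exact: (lagrange_inversion Qyq_char0 n phi0 (divrK U vx) gf).
Qed.
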